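(* Let $d\ge 1$ and let $\Gamma$ be a Schottky subgroup of $\mathbf{PU}(1,d+1)$ in good position, with limit set $\Lambda_\Gamma\subset\partial\mathbf{H}_{\mathbf{C}}^{d+1}$ and Poincaré exponent $\delta_\Gamma$. Then for every $\xi\in\partial\mathbf{H}_{\mathbf{C}}^{d+1}$, the dimension of $\Lambda_\Gamma$ transverse to the foliation by chains passing through $\xi$ is equal to $\delta_\Gamma$; that is, $$\dim\big(\pi_\xi(\Lambda_\Gamma\setminus\{\xi\})\big)=\delta_\Gamma .$$
   Context: Throughout $\dim$ of a set is Hausdorff dimension. Complex hyperbolic space. On $\mathbf{C}^{d+2}$ (coordinates $x_0,\dots,x_{d+1}$) let $\langle x,y\rangle=\overline{x_0}y_{d+1}+\overline{x_{d+1}}y_0-\sum_{k=1}^d\overline{x_k}y_k$, a Hermitian form of signature $(1,d+1)$. $\mathbf{PU}(1,d+1)$ is the projective unitary group of this form. In the complex projective space $\mathbf{P}_{\mathbf{C}}^{d+1}$ of $\mathbf{C}^{d+2}$ put $\mathbf{H}_{\mathbf{C}}^{d+1}=\{[x]:\langle x,x\rangle>0\}$ and $\partial\mathbf{H}_{\mathbf{C}}^{d+1}=\{[x]:\langle x,x\rangle=0\}$. The hyperbolic metric $d_{hyp}$ is normalized by $\cosh d_{hyp}([x],[y])=|\langle x,y\rangle|/\sqrt{\langle x,x\rangle\langle y,y\rangle}$. The boundary carries the Gromov–Bourdon metric $d([x],[y])=\sqrt{|\langle x,y\rangle|/(\|x\|\,\|y\|)}$ ($\|\cdot\|$ the standard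 norm of $\mathbf{C}^{d+2}$). A chain in $\partial\mathbf{H}_{\mathbf{C}}^{d+1}$ is a set $L\cap\partial\mathbf{H}_{\mathbf{C}}^{d+1}$, where $L\subset\mathbf{P}_{\mathbf{C}}^{d+1}$ is a complex projective line meeting $\mathbf{H}_{\mathbf{C}}^{d+1}$. Through two distinct points of the boundary there passes exactly one chain, so the chains through $\xi$ (with $\xi$ removed) foliate $\partial\mathbf{H}_{\mathbf{C}}^{d+1}\setminus\{\xi\}$. Radial projections. For a nonzero vector $x$ let $x^\dagger$ be the orthogonal of $\mathbf{C}x$ for $\langle\cdot,\cdot\rangle$. Fix $\xi=[x]\in\partial\mathbf{H}_{\mathbf{C}}^{d+1}$; then $x\in x^\dagger$. Let $\Lambda^d(x^\dagger)$ be the space of $d$-vectors of the $(d+1)$-dimensional space $x^\dagger$, with the Hermitian inner product (linear in the second variable) induced from the standard one of $\mathbf{C}^{d+2}$; let $\mathcal{A}(\xi)=\{\mathbf{u}\in\Lambda^d(x^\dagger): x\vee\mathbf{u}=0\}$ ($\vee$ is the exterior product), a complex hyperplane isomorphic to $\mathbf{C}^d$, and let $\hat{\mathbf{x}}$ be a unit vector of $\Lambda^d(x^\dagger)$ orthogonal to $\mathcal{A}(\xi)$. For $\eta=[y]\in\partial\mathbf{H}_{\mathbf{C}}^{d+1}$, $\eta\neq\xi$, let $\mathbf{u}(x,y)=v_1\vee\dots\vee v_d$, where $(v_1,\dots,v_d)$ is any basis of $x^\dagger\cap y^\dagger$ (defined up to a nonzero scalar). Define $$\pi_\xi:\partial\mathbf{H}_{\mathbf{C}}^{d+1}\setminus\{\xi\}\to\mathcal{A}(\xi)\simeq\mathbf{C}^d,\qquad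 \pi_\xi(\eta)=\frac{\mathbf{u}(x,y)}{\hat{\mathbf{x}}\cdot\mathbf{u}(x,y)}-\hat{\mathbf{x}} .$$ It is locally Lipschitz, and its fibres are the chains through $\xi$ (with $\xi$ removed). The dimension of a Borel set $A$ transverse to the foliation by chains through $\xi$ is the Hausdorff dimension of $\pi_\xi(A\setminus\{\xi\})$ (Euclidean metric on the target). Groups. The Poincaré exponent of a discrete subgroup $\Gamma$ is $\delta_\Gamma=\inf\{s>0:\sum_{\gamma\in\Gamma}e^{-s\,d_{hyp}(O,\gamma O)}<\infty\}$, $O\in\mathbf{H}_{\mathbf{C}}^{d+1}$; the limit set $\Lambda_\Gamma$ is the set of accumulation points in $\partial\mathbf{H}_{\mathbf{C}}^{d+1}$ of the orbit $\Gamma O$. A subgroup $\Gamma$ of $\mathbf{PU}(1,d+1)$ is a Schottky group if it is generated by elements $g_1,\dots,g_k$ ($k\ge2$) for which, with $W=\{g_1^{\pm1},\dots,g_k^{\pm1}\}$ ($2k$ distinct elements), there are pairwise disjoint compact sets $B(w)\subset\partial\mathbf{H}_{\mathbf{C}}^{d+1}$, $w\in W$, with nonempty interior, such that $w\big(\partial\mathbf{H}_{\mathbf{C}}^{d+1}\setminus B(w^{-1})\big)\subset B(w)$ for all $w\in W$. It is in good position if the generators and the sets $B(w)$ can be chosen such that, moreover, for pairwise distinct $w_1,w_2,w_3\in W$ no chain meets all three sets $B(w_1),B(w_2),B(w_3)$. *)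

(* Defs.v *)
From HB Require Import structures.
From mathcomp Require Import all_boot all_order all_algebra.
From mathcomp Require Import all_classical all_reals all_analysis.
From mathcomp Require Import complex.

Set Implicit Arguments.
Unset Strict Implicit.
Unset Printing Implicit Defensive.

Import Order.TTheory GRing.Theory Num.Theory.
Import numFieldNormedType.Exports.

Local Open Scope classical_set_scope.
Local Open Scope ring_scope.

(* The library instances for abstract numeric fields do not apply to the
   concrete type R[i]. *)
HB.instance Definition _ (R : realType) := NormedModule.copy R[i] R[i]^o.

Section form.
Variables (R : realType) (d : nat).
Local Notation V := 'rV[R[i]]_d.+2.
Implicit Types x y : V.

Definition hform x y : R[i] :=
  (x 0 ord0)^* * y 0 ord_max + (x 0 ord_max)^* * y 0 ord0
  - \sum_(k < d.+2 | (0 < k < d.+1)%N) (x 0 k)^* * y 0 k.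

Lemma hform_linear x : linear (hform x : V -> R[i]^o).
Proof.
move=> a y z.
suff : hform x (a *: y + z) = a * hform x y + hform x z by [].
rewrite /hform !mxE; under eq_bigr do rewrite !mxE mulrDr mulrCA.
rewrite big_split /= -mulr_sumr mulrBr !mulrDr ![_^* * (a * _)]mulrCA.
by rewrite [X in X - _]addrACA opprD [LHS]addrACA.
Qed.

Lemma hform_nondegenerate x : (forall y, hform x y = 0) -> x = 0.
Proof.
move=> h; apply/rowP => j; rewrite mxE.
have {}h (i : 'I_d.+2) : hform x (delta_mx 0 i) = 0 by apply: h.
have E (i k : 'I_d.+2) (a : R[i]) :
    a * (delta_mx 0 i : V) 0 k = a *+ (k == i).
  by rewrite mxE eqxx /= mulr_natr.
have conj0 (z : R[i]) : z^* = 0 -> z = 0.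
  by move/(congr1 Num.conj); rewrite conjCK rmorph0.
have sum0 (i : 'I_d.+2) : ~~ (0 < i < d.+1)%N ->
    \sum_(k < d.+2 | (0 < k < d.+1)%N) (x 0 k)^* * (delta_mx 0 i : V) 0 k = 0.
  move=> hi; apply: big1 => k hk; rewrite E.
  by case: eqP => // ki; rewrite -ki hk in hi.
have [j0|jgt0] := posnP j.
  have {j0}-> : j = ord0 by apply/val_inj.
  have := h ord_max; rewrite /hform sum0 ?ltnn ?andbF// !E eqxx/= mulr0n addr0 subr0.
  exact: conj0.
have [jd|dj] := ltnP j d.+1.
  apply: conj0; have := h j; rewrite /hform !E (bigD1 j) /=; last by rewrite jgt0.
  rewrite big1 => [|k /andP[_ /negbTE kj]]; last by rewrite E kj.
  rewrite E eqxx addr0.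
  have -> : (ord_max == j) = false by apply/negbTE; rewrite -val_eqE/= gtn_eqF.
  have -> : (ord0 == j) = false by apply/negbTE; rewrite -val_eqE/= ltn_eqF.
  by rewrite !mulr0n addr0 sub0r mulr1n => /eqP; rewrite oppr_eq0 => /eqP.
have {dj}-> : j = ord_max.
  by apply/val_inj/eqP; rewrite /= eqn_leq dj -ltnS ltn_ord.
apply: conj0; have := h ord0; rewrite /hform sum0// !E eqxx/= mulr0n add0r.
by rewrite subr0.
Qed.

Definition dagger x : {vspace V} := lker (linfun (hform x : V -> R[i]^o)).

Lemma mem_dagger x y : (y \in dagger x) = (hform x y == 0).
Proof.
pose f := GRing.isLinear.Build _ _ _ _ _ (hform_linear x).
pose F : {linear V -> R[i]^o} := HB.pack (hform x : V -> R[i]^o) f.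
by rewrite memv_ker (lfunE F).
Qed.

End form.

Section projective_space.
Variables (R : realType) (d : nat).
Local Notation V := 'rV[R[i]]_d.+2.

Definition cproj := {L : {vspace V} | \dim L == 1%N}.

HB.instance Definition _ := Choice.on cproj.

Definition rep (p : cproj) : V := vpick (val p).

Definition cone (A : set cproj) : set V :=
  [set x | exists2 p, A p & val p = <[x]>%VS].

Lemma cone_setT : cone setT = [set x | x != 0].
Proof.
apply/seteqP; split => x /=.
  case=> p _ px; apply/eqP => x0; have := valP p.
  by rewrite px x0 dim_vline eqxx.
move=> x0; have h : \dim <[x]>%VS == 1%N by rewrite dim_vline x0.
by exists (exist (fun L : {vspace V} => \dim L == 1%N) _ h).
Qed.

Lemma cone_setI A B : cone (A `&` B) = cone A `&` cone B.
Proof.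
apply/seteqP; split => x /=; first by case=> p [Ap Bp] px; split; exists p.
by move=> [[p Ap px] [q Bq qx]]; exists p => //; split=> //;
  rewrite (val_inj (etrans px (esym qx))).
Qed.

Lemma cone_bigcup I (f : I -> set cproj) :
  cone (\bigcup_i f i) = \bigcup_i cone (f i).
Proof.
apply/seteqP; split => x /=; first by case=> p [i _ fp] px; exists i => //; exists p.
by case=> i _ [p fp px]; exists p => //; exists i.
Qed.

(* The quotient topology of V \ {0}; since V \ {0} is open in V, openness of
   the preimage may be tested in V. *)
Definition proj_open : set_system cproj := [set A | open (cone A)].

Lemma proj_openT : proj_open setT.
Proof.
rewrite /proj_open /= cone_setT.
have -> : [set x : V | x != 0] = ~` [set 0].
  by apply/seteqP; split => x /eqP.
apply: closed_openC; apply: accessible_closed_set1.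
exact/hausdorff_accessible/norm_hausdorff.
Qed.

Lemma proj_openI : setI_closed proj_open.
Proof. by move=> A B oA oB; rewrite /proj_open /= cone_setI; exact: openI. Qed.

Lemma proj_open_bigU (I : Type) (f : I -> set cproj) :
  (forall i, proj_open (f i)) -> proj_open (\bigcup_i f i).
Proof.
by move=> of_; rewrite /proj_open /= cone_bigcup; apply: bigcup_open => i _; exact: of_.
Qed.

HB.instance Definition _ :=
  isOpenTopological.Build cproj proj_openT proj_openI proj_open_bigU.

Definition hyp_space : set cproj := [set p | 0 < hform (rep p) (rep p)].

Definition hyp_boundary : set cproj := [set p | hform (rep p) (rep p) = 0].

Definition cosh (t : R) : R := (expR t + expR (- t)) / 2.

Definition hyp_dist (p q : cproj) : R :=
  let x := rep p in let y := rep q in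
  xget 0 [set t | 0 <= t /\
    cosh t = Normc.normc (hform x y) /
             Num.sqrt (complex.Re (hform x x) * complex.Re (hform y y))].

Definition chain (C : set cproj) : Prop :=
  exists L : {vspace V},
    [/\ \dim L = 2%N, exists2 p, hyp_space p & (val p <= L)%VS
      & C = hyp_boundary `&` [set p | (val p <= L)%VS]].

End projective_space.

Section projective_unitary_group.
Variables (R : realType) (d : nat).
Local Notation V := 'rV[R[i]]_d.+2.
Local Notation P := (cproj R d).

Definition preserves_hform (f : 'End(V)) : Prop :=
  forall x y, hform (f x) (f y) = hform x y.

Definition projective_unitary (g : P -> P) : Prop :=
  exists2 f : 'End(V), preserves_hform f & forall p, val (g p) = (f @: val p)%VS.

Lemma preserves_hform_lker0 f : preserves_hform f -> lker f == 0%VS.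
Proof.
move=> uf; apply/eqP/vspaceP => x; rewrite memv_ker memv0.
apply/eqP/eqP => [fx0|->]; last by rewrite linear0.
apply: hform_nondegenerate => y; rewrite -uf fx0 -uf.
have -> : f 0 = (0 : V) by rewrite linear0.
rewrite /hform !mxE rmorph0 !mul0r add0r big1 ?subr0// => k _.
by rewrite mxE rmorph0 mul0r.
Qed.

Lemma projective_unitary_id : projective_unitary id.
Proof.
exists \1%VF; first by move=> x y; rewrite !id_lfunE.
by move=> p; rewrite lim1g.
Qed.

Lemma projective_unitary_comp g h : projective_unitary g ->
  projective_unitary h -> projective_unitary (g \o h).
Proof.
move=> [f uf fg] [f' uf' fh]; exists (f \o f')%VF.
  by move=> x y; rewrite !comp_lfunE uf uf'.
by move=> p; rewrite /= fg fh limg_comp.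
Qed.

Lemma projective_unitary_inv g : projective_unitary g ->
  exists h, [/\ projective_unitary h, cancel g h & cancel h g].
Proof.
move=> [f uf fg]; have k0 := preserves_hform_lker0 uf.
have ufV : preserves_hform f^-1%VF.
  by move=> x y; rewrite -[LHS]uf !lker0_lfunVK.
have k0V := preserves_hform_lker0 ufV.
have dimV (p : P) : \dim (f^-1 @: val p)%VS == 1%N.
  by rewrite limg_dim_eq ?(eqP k0V) ?capv0// (valP p).
pose h p : P := exist (fun L : {vspace V} => \dim L == 1%N) _ (dimV p).
exists h; split.
- by exists f^-1%VF.
- by move=> p; apply/val_inj; rewrite /= fg -limg_comp lker0_compVf// lim1g.
- by move=> p; apply/val_inj; rewrite fg /= -limg_comp lker0_compfV// lim1g.
Qed.

(* U(1,d+1) modulo scalars, realised as its faithful image in the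
   transformations of the projective space. *)
Definition is_PU (g : P -> P) : bool := `[< projective_unitary g >].

Definition PU := {g : P -> P | is_PU g}.

HB.instance Definition _ := Choice.on PU.

Implicit Types g h : PU.

Lemma PU_projective_unitary g : projective_unitary (val g).
Proof. exact/asboolP/(valP g). Qed.

Definition PU_one : PU := exist is_PU _ (asboolT projective_unitary_id).

Definition PU_mul g h : PU :=
  exist is_PU _ (asboolT (projective_unitary_comp
    (PU_projective_unitary g) (PU_projective_unitary h))).

Definition PU_inv_sig g :=
  cid (projective_unitary_inv (PU_projective_unitary g)).

Definition PU_inv g : PU :=
  exist is_PU _ (asboolT (let: And3 u _ _ := projT2 (PU_inv_sig g) in u)).

Lemma PU_mulA : associative PU_mul.
Proof. by move=> g h k; exact/val_inj. Qed.

Lemma PU_mul1g : left_id PU_one PU_mul.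
Proof. by move=> g; exact/val_inj. Qed.

Lemma PU_mulg1 : right_id PU_one PU_mul.
Proof. by move=> g; exact/val_inj. Qed.

Lemma PU_mulVg : left_inverse PU_one PU_inv PU_mul.
Proof.
move=> g; apply/val_inj/funext => p /=.
by case: (projT2 (PU_inv_sig g)) => _ + _; apply.
Qed.

Lemma PU_mulgV : right_inverse PU_one PU_inv PU_mul.
Proof.
move=> g; apply/val_inj/funext => p /=.
by case: (projT2 (PU_inv_sig g)) => _ _; apply.
Qed.

HB.instance Definition _ :=
  isGroup.Build PU PU_mulA PU_mul1g PU_mulg1 PU_mulVg PU_mulgV.

Definition is_subgroup (H : set PU) : Prop := group_closed [in H].

Definition generated (S : set PU) : set PU := smallest is_subgroup S.

Definition limit_set (G : set PU) (o : P) : set P :=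
  hyp_boundary (d := d) `&` limit_point [set val g o | g in G].

(* +oo if no exponent s makes the series converge. *)
Definition poincare_exponent (G : set PU) (o : P) : \bar R :=
  ereal_inf [set s%:E | s in [set s : R | 0 < s /\
    (\esum_(g in G) (expR (- s * hyp_dist o (val g o)))%:E < +oo)%E]].

Definition letter k (g : 'I_k -> PU) (ib : 'I_k * bool) : PU :=
  if ib.2 then g ib.1 else ((g ib.1)^-1)%g.

Definition schottky_system k (g : 'I_k -> PU) (B : PU -> set P) : Prop :=
  let W := range (letter g) in
  [/\ injective (letter g),
      trivIset W B,
      forall w, W w -> compact (B w) /\ B w `<=` hyp_boundary (d := d),
      forall w, W w -> exists2 p, hyp_boundary p &
        \forall q \near within (hyp_boundary (d := d)) (nbhs p), B w q
    & forall w, W w ->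
        val w @` (hyp_boundary (d := d) `\` B (w^-1)%g) `<=` B w].

Definition good_position k (g : 'I_k -> PU) (B : PU -> set P) : Prop :=
  let W := range (letter g) in
  forall w1 w2 w3, W w1 -> W w2 -> W w3 ->
    w1 != w2 -> w1 != w3 -> w2 != w3 ->
  ~ exists C, [/\ chain C, C `&` B w1 !=set0, C `&` B w2 !=set0
                & C `&` B w3 !=set0].

Definition schottky_in_good_position (G : set PU) : Prop :=
  exists k (g : 'I_k -> PU) (B : PU -> set P),
    [/\ (2 <= k)%N, G = generated (range g), schottky_system g B
      & good_position g B].

End projective_unitary_group.

Section exterior_algebra.
Variables (R : realType) (n : nat).
Local Notation V := 'rV[R[i]]_n.

(* The exterior algebra of C^n: u S is the coordinate of u on e_S, the exterior
   product of the canonical basis vectors of index in S in increasing order. *)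
Definition ext := {ffun {set 'I_n} -> R[i]^o}.

Definition inversions (S T : {set 'I_n}) : nat :=
  #|[set ij : 'I_n * 'I_n | [&& ij.1 \in S, ij.2 \in T & (ij.2 < ij.1)%N]]%SET|.

Definition wedge (u v : ext) : ext :=
  [ffun T : {set 'I_n} => \sum_(S : {set 'I_n} | S \subset T)
    (-1) ^+ inversions S (T :\: S) * (u S * v (T :\: S))].

Definition evec (x : V) : ext := [ffun T : {set 'I_n} => \sum_(i | T == [set i]%SET) x 0 i].

Definition ewedge (s : seq V) : ext :=
  foldr (fun x u => wedge (evec x) u) [ffun T : {set 'I_n} => (T == finset.set0)%:R] s.

Definition multivectors k (U : {vspace V}) : set ext :=
  [set u | exists m (c : 'I_m -> R[i]) (v : 'I_m -> k.-tuple V),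
     (forall i, all [in U] (v i)) /\ u = \sum_(i < m) c i *: ewedge (v i)].

(* The canonical basis (e_S) is orthonormal for the inner product induced on
   the exterior powers by the standard one. *)
Definition eip (u v : ext) : R[i] := \sum_S (u S)^* * v S.

Definition ext_dist (u v : ext) : R :=
  Num.sqrt (complex.Re (eip (u - v) (u - v))).

End exterior_algebra.

Section hausdorff_dimension.
Variables (R : realType) (T : Type) (dist : T -> T -> R).
Local Open Scope ereal_scope.

(* 0 is added so that the empty set has diameter 0 and not -oo. *)
Definition diam (A : set T) : \bar R :=
  ereal_sup (0 |` [set (dist p.1 p.2)%:E | p in A `*` A]).

Definition hausdorff_premeasure (s e : R) (A : set T) : \bar R :=
  ereal_inf [set \sum_(0 <= i <oo) (diam (U i) `^ s) | U in
    [set U : nat -> set T | A `<=` \bigcup_i U i /\ forall i, diam (U i) <= e%:E]].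

Definition hausdorff_measure (s : R) (A : set T) : \bar R :=
  ereal_sup [set hausdorff_premeasure s e A | e in [set e : R | (0 < e)%R]].

Definition hausdorff_dim (A : set T) : \bar R :=
  ereal_inf [set s%:E | s in [set s : R | (0 < s)%R /\ hausdorff_measure s A = 0]].

End hausdorff_dimension.

Section radial_projection.
Variables (R : realType) (d : nat).
Local Notation P := (cproj R d).

Definition radial_target (xi : P) : set (ext R d.+2) :=
  [set u | multivectors d (dagger (rep xi)) u /\ wedge (evec (rep xi)) u = 0].

Definition unit_normal (xi : P) (h : ext R d.+2) : Prop :=
  [/\ multivectors d (dagger (rep xi)) h, eip h h = 1
    & forall u, radial_target xi u -> eip h u = 0].

(* The basis is the one chosen by the library; another one multiplies u by a
   nonzero scalar, which cancels in the quotient. *)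
Definition radial_proj (xi : P) (h : ext R d.+2) (eta : P) : ext R d.+2 :=
  let u := ewedge (vbasis (dagger (rep xi) :&: dagger (rep eta))) in
  (eip h u)^-1 *: u - h.

Definition transverse_dim (xi : P) (h : ext R d.+2) (A : set P) : \bar R :=
  hausdorff_dim (@ext_dist R d.+2) (radial_proj xi h @` (A `\ xi)).

End radial_projection.

(* Main.v *)
Require Import Defs.
From mathcomp Require Import all_boot all_order all_algebra.
From mathcomp Require Import all_classical all_reals all_analysis.
From mathcomp Require Import complex.
From mathcomp Require Import ring lra.

(* The Hermitian form is |ell|^2 minus the standard inner product for one linear
   functional ell. Rescaling lifts so that ell = 1, the form becomes a kernel
   kap on the closed ball, multiplied under g by a conformal factor jac g, and
   the squared distance between the projections of y and z from x is comparable
   to crs x y z = 2 Re (<y, z> / (<y, x> <x, z>)).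

   This quantity is always at most 2 kap y z / (kap y x * kap x z), and it is
   positive unless x, y, z lie on a chain; in good position it is therefore
   bounded below on triples of points of distinct balls B(w), and by invariance
   comparable to kap y z for limit points y, z whose words separate from the
   one of x. So projected cylinders of reduced words have diameter comparable to
   exp (- d (o, w o)).

   Covering by the cylinders of one length shows that the projected limit set is
   null in dimension s as soon as the Poincare series converges at s.
   Conversely, a cover of small s-weight yields a finite family of words of
   small weight such that every long word has a prefix in it, and by almost
   multiplicativity of the weights the Poincare series converges at s. No
   measure on the limit set is needed. *)

Set Implicit Arguments.
Unset Strict Implicit.
Unset Printing Implicit Defensive.

Import Order.TTheory GRing.Theory Num.Theory.
Import numFieldNormedType.Exports.

Local Open Scope classical_set_scope.
Local Open Scope ring_scope.

(** The point [xi] is arbitrary and may itself be a limit point, and the upper bound on the size of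
    projected cylinders degenerates near it. For the upper bound on the dimension, the rest of the
    limit set is exhausted by the countably many sets on which [kap xi y] is at least the inverse of
    [k.+1]. For the lower bound, only words whose first ball misses [xi] are estimated. Since [xi]
    lies in at most one ball, two such letters exist, and every reduced word can be preceded by one
    of them at the cost of a bounded factor; this is why the renewal inequality closes up on the sum
    over all words.

    Compactness is applied to the real part [tri] of the Hermitian triple product: it has the sign
    of [crs] but no denominator. The separation of the balls follows from the same bound.

    The dynamical part is axiomatic. It knows only transformation rules and a few inequalities for
    [kap], [jac] and [crs], and of the hyperbolic metric only that [lam g * jac g o] is bounded
    above and below. Both [kap] and [crs] are of the order of squared sizes, which explains the
    squares of [lam]. *)

Local Notation nc := Normc.normc.
Local Notation Re := complex.Re.

(** * Exterior products *)

Section exterior.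
Variables (R : realType) (n : nat).
Local Notation V := 'rV[R[i]]_n.
Local Notation ext := (ext R n).
Implicit Types (x y : V) (u v : ext) (T : {set 'I_n}).

Lemma extN u T : (- u) T = - u T. Proof. by rewrite ffunE. Qed.

Lemma ext0 T : (0 : ext) T = 0. Proof. by rewrite ffunE. Qed.

Lemma extD u v T : (u + v) T = u T + v T. Proof. by rewrite ffunE. Qed.

Lemma extZ (a : R[i]) u T : (a *: u) T = a * u T. Proof. by rewrite ffunE. Qed.

Definition vwedge x u : ext := wedge (evec x) u.

Lemma ewedge_cons x (s : seq V) : ewedge (x :: s) = vwedge x (ewedge s).
Proof. by []. Qed.

Definition lower (i : 'I_n) T : nat := #|[set j in T | (j < i)%N]%SET|.

Lemma inversions1 i T : inversions [set i]%SET T = lower i T.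
Proof.
have pi_inj : injective (pair i : 'I_n -> 'I_n * 'I_n) by move=> a b [].
rewrite /inversions /lower -(card_imset _ pi_inj).
apply: eq_card => -[a b]; rewrite !inE /=.
apply/and3P/imsetP => [[/eqP-> bT bi]|[j]]; last first.
  by rewrite inE => /andP[jT ji] [-> ->]; rewrite eqxx.
by exists b => //; rewrite inE bT.
Qed.

Lemma vwedgeE x u T : vwedge x u T =
  \sum_(i in T) (-1) ^+ lower i (T :\ i) * (x 0 i * u (T :\ i)).
Proof.
rewrite /vwedge ffunE.
under eq_bigr => S _.
  rewrite ffunE mulr_suml mulr_sumr.
  over.
rewrite /= (exchange_big_dep predT) //= [RHS]big_mkcond /=; apply: eq_bigr => i _.
case: ifPn => iT.
  rewrite (big_pred1 [set i]%SET); first by rewrite inversions1.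
  move=> S /=; rewrite andbC; case: eqP => // ->; rewrite /= finset.sub1set //.
rewrite big_pred0 // => S; rewrite andbC; case: eqP => // ->.
by rewrite finset.sub1set (negbTE iT).
Qed.

Lemma vwedgeDr x u v a : vwedge x (a *: u + v) = a *: vwedge x u + vwedge x v.
Proof.
apply/ffunP => T; rewrite !(vwedgeE, extD, extZ) mulr_sumr -big_split /=.
apply: eq_bigr => i _; rewrite extD extZ !mulrDr; congr (_ + _).
rewrite [x 0 i * _]mulrCA [LHS]mulrCA.
done.
Qed.

Lemma vwedge0r x : vwedge x 0 = 0.
Proof.
apply/ffunP => T; rewrite vwedgeE big1 ?ffunE// => i _.
by rewrite ffunE !mulr0.
Qed.

Lemma vwedgeZr x u a : vwedge x (a *: u) = a *: vwedge x u.
Proof. by have := vwedgeDr x u 0 a; rewrite vwedge0r !addr0. Qed.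

Lemma vwedge_addr x u v : vwedge x (u + v) = vwedge x u + vwedge x v.
Proof. by have := vwedgeDr x u v 1; rewrite !scale1r. Qed.

Lemma vwedgeNr x u : vwedge x (- u) = - vwedge x u.
Proof. by rewrite -(scaleN1r u) vwedgeZr (scaleN1r (vwedge x u)). Qed.

Lemma vwedge_sumr x I r (P : pred I) (F : I -> ext) :
  vwedge x (\sum_(i <- r | P i) F i) = \sum_(i <- r | P i) vwedge x (F i).
Proof.
apply: (big_morph (vwedge x)) => [u v|]; [exact: vwedge_addr|exact: vwedge0r].
Qed.

Lemma vwedgeDl x y u a : vwedge (a *: x + y) u = a *: vwedge x u + vwedge y u.
Proof.
apply/ffunP => T; rewrite !(vwedgeE, extD, extZ) mulr_sumr -big_split /=.
apply: eq_bigr => i _; rewrite !mxE !(mulrDl, mulrDr); congr (_ + _).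
by rewrite !mulrA; congr (_ * _ * _); rewrite mulrC.
Qed.

Lemma vwedge0l u : vwedge 0 u = 0.
Proof.
apply/ffunP => T; rewrite vwedgeE big1 ?ffunE// => i _.
by rewrite mxE mul0r mulr0.
Qed.

Lemma lower_setD1 i j T : j \in T -> j != i ->
  lower i (T :\ i) = (lower i (T :\ i :\ j) + (j < i))%N.
Proof.
move=> jT ji; rewrite /lower (cardsD1 j) !inE jT ji /= addnC; congr (_ + _)%N.
by apply: eq_card => k; rewrite !inE andbA.
Qed.

(** Both sides are sums over ordered pairs of distinct indices of [T]. Exchanging the two indices
    changes the sign, because exactly one of [i < j] and [j < i] holds. *)
Lemma vwedge_anti x y u : vwedge x (vwedge y u) = - vwedge y (vwedge x u).
Proof.
have E (a b : V) T : vwedge a (vwedge b u) T = \sum_(i in T) \sum_(j in T :\ i)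
    (-1) ^+ lower i (T :\ i) * (-1) ^+ lower j (T :\ i :\ j) *
    (a 0 i * b 0 j * u (T :\ i :\ j)).
  rewrite vwedgeE; apply: eq_bigr => i iT; rewrite vwedgeE !mulr_sumr.
  by apply: eq_bigr => j _; rewrite -!mulrA; congr (_ * _); rewrite mulrCA.
apply/ffunP => T; rewrite extN !E.
rewrite (exchange_big_dep [in T]) /=; last by move=> i j _; rewrite !inE => /andP[].
rewrite -sumrN; apply: eq_bigr => j jT.
rewrite -sumrN; apply: eq_big => [i|i /andP[iT]].
  by rewrite !inE jT andbT eq_sym andbC.
rewrite !inE => /andP[ji _].
have DE : (T :\ i :\ j = T :\ j :\ i)%SET by rewrite !finset.setDDl finset.setUC.
rewrite (lower_setD1 jT ji) (lower_setD1 iT); last by rewrite eq_sym.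
rewrite -DE !exprD [x 0 i * _]mulrC.
have -> : (-1) ^+ (i < j)%N = - (-1) ^+ (j < i)%N :> R[i].
  have : (i : nat) != j by rewrite eq_sym.
  by case: ltngtP => //=; rewrite ?expr0 ?expr1 ?opprK.
rewrite !(mulrN, mulNr) opprK; congr (_ * _).
by rewrite mulrAC [RHS]mulrAC; congr (_ * _); exact: mulrC.
Qed.

Lemma vwedgexx x u : vwedge x (vwedge x u) = 0.
Proof.
have /eqP := vwedge_anti x x u; rewrite -addr_eq0 => /eqP /ffunP E.
apply/ffunP => T; have := E T; rewrite extD ext0 => /eqP.
by rewrite -mulr2n mulrn_eq0 => /eqP.
Qed.

Lemma vwedge_mem x (s : seq V) : x \in s -> vwedge x (ewedge s) = 0.
Proof.
elim: s => //= y s IH; rewrite inE -/(vwedge y _) => /orP[/eqP ->|/IH E].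
  exact: vwedgexx.
by rewrite vwedge_anti E vwedge0r oppr0.
Qed.

Lemma ewedge_catE (s t : seq V) : ewedge t = 0 -> ewedge (s ++ t) = 0.
Proof. by move=> t0; elim: s => //= x s ->; exact: vwedge0r. Qed.

(* The span of a family is encoded impredicatively: a vector is in it when it
   satisfies every linearly closed P that holds on the family. *)
Definition lin_closed (P : ext -> Prop) :=
  P 0 /\ forall a u v, P u -> P v -> P (a *: u + v).

Lemma lin_closed_scale P a u : lin_closed P -> P u -> P (a *: u).
Proof. by move=> [P0 PD] Pu; rewrite -[_ *: _]addr0; apply: PD. Qed.

Lemma lin_closed_vwedge P x : lin_closed P -> lin_closed (fun u => P (vwedge x u)).
Proof.
move=> [P0 PD]; split; first by rewrite vwedge0r.
by move=> a u v Pu Pv; rewrite vwedgeDr; exact: PD.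
Qed.

Lemma lin_closed_sum P I (r : seq I) (c : I -> R[i]) (F : I -> ext) :
  lin_closed P -> (forall i, P (F i)) -> P (\sum_(i <- r) c i *: F i).
Proof.
move=> [P0 PD] PF; elim/big_rec: _ => // i u _ Pu.
exact: PD.
Qed.

(** Subfamilies of [b] are encoded by bit masks. A product with a member of [b] vanishes or, up to
    sign, adds one bit to the mask; since [P] is general, the induction can absorb the head of [b]
    into it. *)
Lemma vwedge_mask_ind (b : seq V) x (m : bitseq) k (P : ext -> Prop) :
  lin_closed P ->
  (forall m, size m = size b -> count id m = k.+1 -> P (ewedge (mask m b))) ->
  x \in b -> size m = size b -> count id m = k -> P (vwedge x (ewedge (mask m b))).
Proof.
elim: b m k P => // y b IH [//|[] m] k P lP Pm; rewrite inE /= => xyb [sm] cm.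
  rewrite -/(vwedge y _); case/orP: xyb => [/eqP ->|xb].
    by rewrite vwedgexx; case: lP.
  rewrite vwedge_anti -(scaleN1r (vwedge y _)); apply: lin_closed_scale => //.
  apply: (IH m (count id m) (fun u => P (vwedge y u))) => //.
    exact: lin_closed_vwedge.
  move=> m' sm' cm'; apply: (Pm (true :: m')) => /=; first by rewrite sm'.
  by rewrite cm' -cm.
case/orP: xyb => [/eqP ->|xb].
  apply: (Pm (true :: m)); first by rewrite /= sm.
  by rewrite /= -cm.
apply: (IH m k P) => // m' sm' cm'; apply: (Pm (false :: m')) => //=.
by rewrite sm'.
Qed.

Lemma ewedge_span_ind (b s : seq V) (P : ext -> Prop) :
  lin_closed P ->
  (forall m, size m = size b -> count id m = size s -> P (ewedge (mask m b))) ->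
  all [in <<b>>%VS] s -> P (ewedge s).
Proof.
elim: s P => [|x s IH] P lP Pm.
  move=> _; have := Pm (nseq (size b) false); rewrite mask_false; apply.
    by rewrite size_nseq.
  by rewrite count_nseq mul0n.
case/andP=> xb sb; rewrite ewedge_cons.
apply: (IH (fun u => P (vwedge x u))) => //; first exact: lin_closed_vwedge.
move=> m sm cm.
have -> : x = \sum_(i < size b) coord (in_tuple b) i x *: b`_i.
  by apply: coord_span.
elim/big_rec: _ => [|i y _ Py]; first by rewrite vwedge0l; case: lP.
rewrite vwedgeDl; case: (lP) => _; apply => //.
exact: (vwedge_mask_ind lP Pm (mem_nth 0 (ltn_ord i)) sm cm).
Qed.

Lemma mask_full (T : Type) (b : seq T) m :
  count id m = size b -> size m = size b -> mask m b = b.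
Proof.
elim: b m => [|y b IH] [|[] m] //= cm [sm].
  by rewrite IH//; case: cm.
by have := count_size id m; rewrite sm -ltnS -cm add0n ltnn.
Qed.

Lemma mask_del1 (T : Type) (b : seq T) m :
  (count id m).+1 = size b -> size m = size b ->
  exists2 i, (i < size b)%N & mask m b = take i b ++ drop i.+1 b.
Proof.
elim: b m => [|y b IH] [|[] m] //= [cm] [sm].
  by have [i ib ->] := IH m cm sm; exists i.+1.
by exists 0%N; rewrite ?take0 ?drop0 ?mask_full// -cm.
Qed.

Lemma ewedge_top (b s : seq V) : all [in <<b>>%VS] s -> size s = size b ->
  exists c, ewedge s = c *: ewedge b.
Proof.
move=> sb ss; apply: (ewedge_span_ind (P := fun u => exists c, u = c *: ewedge b)) sb.
  split; first by exists 0; rewrite scale0r.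
  by move=> a u v [c ->] [e ->]; exists (a * c + e); rewrite scalerDl scalerA.
move=> m sm cm; exists 1; rewrite scale1r mask_full//.
by rewrite cm.
Qed.

(** A mask of [x :: v] with [size v] bits omits a single vector, either [x] or one member of [v].
    The terms that keep [x] are those that a further product with [x] kills. *)
Lemma ewedge_codim1 x (v s : seq V) :
  all [in <<x :: v>>%VS] s -> size s = size v ->
  exists a (c : 'I_(size v) -> R[i]), ewedge s = a *: ewedge v +
    \sum_(i < size v) c i *: ewedge (x :: take i v ++ drop i.+1 v).
Proof.
pose t (i : 'I_(size v)) := ewedge (x :: take i v ++ drop i.+1 v).
move=> sv ss.
pose P u := exists a (c : 'I_(size v) -> R[i]),
  u = a *: ewedge v + \sum_i c i *: t i.
apply: (ewedge_span_ind (P := P)) sv.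
  split.
    exists 0, (fun=> 0); rewrite scale0r add0r big1// => i _.
    by rewrite scale0r.
  move=> a u w [a1 [c1 ->]] [a2 [c2 ->]].
  exists (a * a1 + a2), (fun i => a * c1 i + c2 i).
  rewrite scalerDr scalerDl scalerA addrACA; congr (_ + _).
  rewrite scaler_sumr -big_split /=; apply: eq_bigr => i _.
  by rewrite scalerDl scalerA.
rewrite ss; case=> [//|[] m] /= [sm] cm.
  have [i iv E] := mask_del1 cm sm.
  exists 0, (fun j => (j == Ordinal iv)%:R); rewrite scale0r add0r.
  rewrite (bigD1 (Ordinal iv))//= eqxx scale1r big1 ?addr0 ?/t /= ?E//.
  by move=> j /negbTE ->; rewrite scale0r.
exists 1, (fun=> 0); rewrite scale1r mask_full// big1 ?addr0// => i _.
by rewrite scale0r.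
Qed.

Lemma vwedge_del (v : seq V) i : (i < size v)%N ->
  vwedge v`_i (ewedge (take i v ++ drop i.+1 v)) = (-1) ^+ i *: ewedge v.
Proof.
elim: v i => [//|y v IH] [|i] /=; first by rewrite drop0 expr0 scale1r.
rewrite ltnS => iv; rewrite -/(vwedge y _) vwedge_anti IH//.
by rewrite vwedgeZr exprS mulN1r scaleNr.
Qed.

Lemma vwedge_cons_del x (v : seq V) i : (i < size v)%N ->
  vwedge v`_i (ewedge (x :: take i v ++ drop i.+1 v)) =
  (-1) ^+ i.+1 *: ewedge (x :: v).
Proof.
move=> iv; rewrite [in LHS]ewedge_cons vwedge_anti vwedge_del// vwedgeZr.
by rewrite exprS mulN1r scaleNr.
Qed.

Lemma ewedge_std_neq0 (l : seq 'I_n) : uniq l ->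
  ewedge [seq (delta_mx 0 i : V) | i <- l] [set i in l]%SET != 0.
Proof.
elim: l => [_|i l IH /andP[il /IH lN0]] /=.
  have -> : [set i in [::]]%SET = finset.set0 :> {set 'I_n}.
    by apply/finset.setP => i; rewrite !inE.
  by rewrite ffunE eqxx oner_eq0.
rewrite -/(vwedge _ _) vwedgeE (bigD1 i) /=; last by rewrite !inE eqxx.
rewrite big1 ?addr0 => [|j /andP[_ /negbTE ji]]; last first.
  by rewrite mxE eqxx ji mul0r mulr0.
rewrite mxE !eqxx mul1r mulf_neq0 ?signr_eq0//.
rewrite (_ : _ :\ _ = [set j in l])%SET//; apply/finset.setP => j; rewrite !inE.
by case: eqP => //= ->; rewrite (negbTE il).
Qed.

(** Completing [s] to a basis would make the product over a basis vanish, hence by [ewedge_top] also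
    the product of the standard basis. *)
Lemma ewedge_neq0 (s : seq V) : free s -> ewedge s != 0.
Proof.
move=> fs; apply/eqP => s0.
pose b := vbasis (<< s >>^C)%VS ++ s.
have b0 : ewedge b = 0 by exact: ewedge_catE.
have bV : <<b>>%VS = fullv.
  by rewrite span_cat (span_basis (vbasisP _)) addvC addv_complf.
have sb : size b = n.
  rewrite size_cat size_tuple dimv_compl (eqP fs) dimvf /dim /= mul1n subnK//.
  by rewrite -(eqP fs) (leq_trans (dimvS (subvf _)))// dimvf /dim /= mul1n.
have [||c] := @ewedge_top b [seq (delta_mx 0 i : V) | i <- enum 'I_n].
- by apply/allP => x _; rewrite /= bV memvf.
- by rewrite size_map size_enum_ord sb.
move=> E; have := @ewedge_std_neq0 (enum 'I_n) (enum_uniq _).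
by rewrite E b0 scaler0 ext0 eqxx.
Qed.

End exterior.

(** * The Hermitian form *)

Section complex_modulus.
Variable R : realType.
Implicit Types (z w : R[i]) (a : R).

Lemma ReD z w : Re (z + w) = Re z + Re w. Proof. by case: z; case: w. Qed.

Lemma ReN z : Re (- z) = - Re z. Proof. by case: z. Qed.

Lemma nc_ge0 z : 0 <= nc z. Proof. by case: z => a b; exact: sqrtr_ge0. Qed.

Lemma nc_eq0 z : (nc z == 0) = (z == 0).
Proof.
by apply/eqP/eqP => [/Normc.eq0_normc|->] //; rewrite Normc.normc0.
Qed.

Lemma nc_gt0 z : (0 < nc z) = (z != 0).
Proof. by rewrite lt_neqAle nc_ge0 andbT eq_sym nc_eq0. Qed.

Lemma nc_conj z : nc (z^*) = nc z.
Proof. by case: z => a b /=; rewrite sqrrN. Qed.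

Lemma nc_real a : nc a%:C%C = `|a|.
Proof. by rewrite /= expr0n addr0 sqrtr_sqr. Qed.

Lemma nc_add z w : nc (z + w) <= nc z + nc w.
Proof. exact: (@le_normcD R). Qed.

Lemma ncN z : nc (- z) = nc z. Proof. exact: (@normcN R). Qed.

Lemma nc_sub z w : nc (z - w) <= nc z + nc w.
Proof. by rewrite (le_trans (nc_add _ _))// ncN. Qed.

Lemma nc_sum I r (P : pred I) (F : I -> R[i]) :
  nc (\sum_(i <- r | P i) F i) <= \sum_(i <- r | P i) nc (F i).
Proof.
elim/big_rec2: _ => [|i u v _ uv]; first by rewrite Normc.normc0.
by rewrite (le_trans (nc_add _ _))// lerD2l.
Qed.

Lemma conjM_nc z : z^* * z = (nc z ^+ 2)%:C%C.
Proof.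
case: z => a b; rewrite /= sqr_sqrtr ?addr_ge0 ?sqr_ge0//.
by apply/eqP; rewrite eq_complex /=; apply/andP; split; apply/eqP; ring.
Qed.

Lemma Re_le_nc z : Re z <= nc z.
Proof.
case: z => a b /=; rewrite (le_trans (ler_norm a))// -sqrtr_sqr ler_wsqrtr//.
by rewrite lerDl sqr_ge0.
Qed.

Lemma Re_conj z : Re (z^*) = Re z. Proof. by case: z. Qed.

Lemma ReMr a z : Re (a%:C%C * z) = a * Re z.
Proof. by case: z => u v /=; rewrite mul0r subr0. Qed.

Lemma divc_nc z w : w != 0 -> z / w = ((nc w ^+ 2)^-1)%:C%C * (z * w^*).
Proof.
move=> w0; have w2 : (nc w ^+ 2)%:C%C != 0 :> R[i].
  by rewrite -conjM_nc mulf_neq0// conjC_eq0.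
apply: (mulIf w0); rewrite divfK// -!mulrA conjM_nc mulrCA -rmorphM /=.
by rewrite mulVf ?rmorph1 ?mulr1// expf_neq0// nc_eq0.
Qed.

End complex_modulus.

(** * Standard inner product and norm of row vectors *)

Section standard_norm.
Variables (R : realType) (n : nat).
Local Notation V := 'rV[R[i]]_n.
Implicit Types (x y z : V) (a : R[i]).

Definition sp x y : R[i] := \sum_k (x 0 k)^* * y 0 k.

Definition nm x : R := Num.sqrt (\sum_k nc (x 0 k) ^+ 2).

Lemma nm_ge0 x : 0 <= nm x. Proof. exact: sqrtr_ge0. Qed.

Lemma nmE x : nm x ^+ 2 = \sum_k nc (x 0 k) ^+ 2.
Proof. by rewrite sqr_sqrtr// sumr_ge0// => k _; exact: sqr_ge0. Qed.

Lemma spxx x : sp x x = (nm x ^+ 2)%:C%C.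
Proof.
by rewrite nmE rmorph_sum; apply: eq_bigr => k _; exact: conjM_nc.
Qed.

Lemma nc_le_nm x k : nc (x 0 k) <= nm x.
Proof.
rewrite -(@ler_pXn2r _ 2%N)// ?nnegrE ?nc_ge0 ?nm_ge0// nmE (bigD1 k)//=.
by rewrite lerDl sumr_ge0// => j _; exact: sqr_ge0.
Qed.

Lemma nm_eq0 x : (nm x == 0) = (x == 0).
Proof.
apply/eqP/eqP => [x0|->]; last first.
  rewrite /nm big1 ?sqrtr0// => k _.
  by rewrite mxE Normc.normc0 expr0n.
apply/rowP => k; rewrite mxE; apply/eqP; rewrite -nc_eq0 eq_le nc_ge0 andbT.
by rewrite -x0 nc_le_nm.
Qed.

Lemma sp_conj x y : sp y x = (sp x y)^*.
Proof.
rewrite /sp rmorph_sum; apply: eq_bigr => k _.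
by rewrite rmorphM /= conjCK mulrC.
Qed.

Lemma spDr x y z : sp x (y + z) = sp x y + sp x z.
Proof. by rewrite -big_split; apply: eq_bigr => k _; rewrite mxE mulrDr. Qed.

Lemma spZr x a y : sp x (a *: y) = a * sp x y.
Proof. by rewrite mulr_sumr; apply: eq_bigr => k _; rewrite mxE mulrCA. Qed.

Lemma spDl x y z : sp (x + y) z = sp x z + sp y z.
Proof. by rewrite sp_conj spDr rmorphD /= -!sp_conj. Qed.

Lemma spNr x y : sp x (- y) = - sp x y.
Proof. by rewrite -(scaleN1r y) spZr mulN1r. Qed.

Lemma cauchy_schwarz x y : nc (sp x y) <= nm x * nm y.
Proof.
have [->|x0] := eqVneq x 0.
  rewrite /sp big1 ?Normc.normc0 ?mulr_ge0 ?nm_ge0// => k _.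
  by rewrite mxE rmorph0 mul0r.
have [->|y0] := eqVneq y 0.
  rewrite /sp big1 ?Normc.normc0 ?mulr_ge0 ?nm_ge0// => k _.
  by rewrite mxE mulr0.
have xp : 0 < nm x by rewrite lt_neqAle nm_ge0 eq_sym nm_eq0 x0.
have yp : 0 < nm y by rewrite lt_neqAle nm_ge0 eq_sym nm_eq0 y0.
apply: (le_trans (nc_sum _ _ _)).
(* Inequality of means in each coordinate, with the weights for which the two sums add up to the
   product of the norms. *)
have -> : nm x * nm y = \sum_k
    (nm y / nm x * nc (x 0 k) ^+ 2 + nm x / nm y * nc (y 0 k) ^+ 2) / 2.
  rewrite -mulr_suml big_split /= -!mulr_sumr -!nmE.
  by field; rewrite !gt_eqF.
apply: ler_sum => k _; rewrite Normc.normcM nc_conj.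
set a := nc _; set b := nc _; set A := nm x; set B := nm y.
rewrite -subr_ge0 (_ : _ - _ = (B * a - A * b) ^+ 2 / (2 * A * B)); last first.
  by field; rewrite !gt_eqF.
by rewrite divr_ge0 ?sqr_ge0// !mulr_ge0// ltW.
Qed.

Lemma nm2D x y : nm (x + y) ^+ 2 = nm x ^+ 2 + nm y ^+ 2 + 2 * Re (sp x y).
Proof.
have E u : nm u ^+ 2 = Re (sp u u) by rewrite spxx.
by rewrite !E spDl !spDr !ReD [sp y x]sp_conj Re_conj; ring.
Qed.

Lemma nmN x : nm (- x) = nm x.
Proof.
by congr (Num.sqrt _); apply: eq_bigr => k _; rewrite mxE ncN.
Qed.

Lemma nmZ a x : nm (a *: x) = nc a * nm x.
Proof.
apply/eqP; rewrite -(@eqrXn2 _ 2%N)// ?nm_ge0 ?mulr_ge0 ?nc_ge0 ?nm_ge0//.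
rewrite exprMn !nmE mulr_sumr; apply/eqP; apply: eq_bigr => k _.
by rewrite mxE Normc.normcM exprMn.
Qed.

Lemma nmD x y : nm (x + y) <= nm x + nm y.
Proof.
rewrite -(@ler_pXn2r _ 2%N)// ?nnegrE ?addr_ge0 ?nm_ge0//.
rewrite nm2D sqrrD addrAC lerD2r lerD2l -[leRHS]mulr_natl ler_pM2l//.
exact: le_trans (Re_le_nc _) (cauchy_schwarz _ _).
Qed.

Lemma nmB x y : nm (x - y) = nm (y - x). Proof. by rewrite -nmN opprB. Qed.

End standard_norm.

(** * The form of signature (1, d+1), its isotropic vectors and their invariants *)

Section hermitian_form.
Variables (R : realType) (d : nat).
Local Notation V := 'rV[R[i]]_d.+2.
Implicit Types (x y z u v : V) (a : R[i]).

Definition ell x : R[i] := x 0 ord0 + x 0 ord_max.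

Lemma ellD x y : ell (x + y) = ell x + ell y.
Proof. by rewrite /ell !mxE addrACA. Qed.

Lemma ellZ a x : ell (a *: x) = a * ell x.
Proof. by rewrite /ell !mxE mulrDr. Qed.

Lemma ellN x : ell (- x) = - ell x.
Proof. by rewrite /ell !mxE opprD. Qed.

(* Rotating the plane (x_0, x_{d+1}) diagonalises the form: it is the square of
   one linear functional minus the standard inner product. *)
Lemma hformE x y : hform x y = (ell x)^* * ell y - sp x y.
Proof.
rewrite /hform /ell /sp [in RHS](bigD1 ord0)//= [in RHS](bigD1 ord_max)//=.
rewrite [in RHS](eq_bigl (fun k : 'I_d.+2 => 0 < k < d.+1)%N); last first.
  move=> k; rewrite -!val_eqE /= lt0n; congr (_ && _).
  by rewrite ltn_neqAle -ltnS ltn_ord andbT.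
set S := \sum_(k < _ | _) _; rewrite rmorphD /=; ring.
Qed.

Lemma hform_conj x y : hform y x = (hform x y)^*.
Proof. by rewrite !hformE rmorphB rmorphM /= conjCK mulrC -sp_conj. Qed.

Lemma hformDr x y z : hform x (y + z) = hform x y + hform x z.
Proof. by rewrite !hformE ellD spDr; ring. Qed.

Lemma hformZr x a y : hform x (a *: y) = a * hform x y.
Proof. by rewrite !hformE ellZ spZr; ring. Qed.

Lemma hformDl x y z : hform (x + y) z = hform x z + hform y z.
Proof. by rewrite hform_conj hformDr rmorphD /= -!hform_conj. Qed.

Lemma hformZl x a y : hform (a *: x) y = a^* * hform x y.
Proof. by rewrite hform_conj hformZr rmorphM /= -!hform_conj. Qed.

Lemma hformNr x y : hform x (- y) = - hform x y.
Proof. by rewrite -(scaleN1r y) hformZr mulN1r. Qed.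

Lemma hformNl x y : hform (- x) y = - hform x y.
Proof. by rewrite hform_conj hformNr rmorphN /= -!hform_conj. Qed.

Lemma hform0r x : hform x 0 = 0.
Proof. by rewrite -(scale0r x) hformZr mul0r. Qed.

Lemma hform0l x : hform 0 x = 0.
Proof. by rewrite hform_conj hform0r rmorph0. Qed.

Lemma hformxx x : hform x x = (nc (ell x) ^+ 2 - nm x ^+ 2)%:C%C.
Proof. by rewrite hformE conjM_nc spxx rmorphB. Qed.

Lemma nc_hform_sym x y : nc (hform y x) = nc (hform x y).
Proof. by rewrite hform_conj nc_conj. Qed.

Lemma nc_ell x : nc (ell x) <= 2 * nm x.
Proof.
apply: (le_trans (nc_add _ _)); rewrite -[2]/(1 + 1) mulrDl mul1r.
by apply: lerD; exact: nc_le_nm.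
Qed.

Lemma isotropicE x : (hform x x == 0) = (nc (ell x) == nm x).
Proof.
rewrite hformxx -(rmorph0 (real_complex R)) (inj_eq (@complexI _)) subr_eq0.
by rewrite eqrXn2// ?nc_ge0 ?nm_ge0.
Qed.

Lemma positiveE x : (0 < hform x x) = (nm x < nc (ell x)).
Proof.
rewrite hformxx -(rmorph0 (real_complex R)) ltcR subr_gt0.
by rewrite ltr_pXn2r// nnegrE ?nc_ge0 ?nm_ge0.
Qed.

Lemma nonnegE x : (0 <= hform x x) = (nm x <= nc (ell x)).
Proof.
rewrite hformxx -(rmorph0 (real_complex R)) lecR subr_ge0.
by rewrite ler_pXn2r// nnegrE ?nc_ge0 ?nm_ge0.
Qed.

Lemma nc_hform_le x y : nc (hform x y) <= 5 * nm x * nm y.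
Proof.
rewrite hformE (le_trans (nc_sub _ _))// Normc.normcM nc_conj.
have := cauchy_schwarz x y; have := nc_ell x; have := nc_ell y.
have := nm_ge0 x; have := nm_ge0 y; have := nc_ge0 (ell x).
have := nc_ge0 (ell y); nra.
Qed.

(** For lifts with [ell] equal to 1 the form is [1 - sp x y], and twice its real part dominates the
    squared distance in the unit ball. *)
Lemma hform1_dist x y : ell x = 1 -> ell y = 1 -> nm x <= 1 -> nm y <= 1 ->
  nm (x - y) ^+ 2 <= 2 * nc (hform x y).
Proof.
move=> x1 y1 nx ny; rewrite nm2D nmN spNr ReN.
have := Re_le_nc (hform x y); rewrite hformE x1 y1 rmorph1 mul1r ReD ReN /=.
have := nm_ge0 x; have := nm_ge0 y; nra.
Qed.

Lemma hform1_le2 x y : ell x = 1 -> ell y = 1 -> nm x <= 1 -> nm y <= 1 ->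
  nc (hform x y) <= 2.
Proof.
move=> x1 y1 nx ny; rewrite hformE x1 y1 rmorph1 mul1r (le_trans (nc_sub _ _))//.
rewrite Normc.normc1; have := cauchy_schwarz x y.
have := nm_ge0 x; have := nm_ge0 y; nra.
Qed.

Lemma hform1_ge x y : ell x = 1 -> ell y = 1 -> nm y <= 1 ->
  1 - nm x <= nc (hform x y).
Proof.
move=> x1 y1 ny; rewrite hformE x1 y1 rmorph1 mul1r.
have := nc_add (1 - sp x y) (sp x y); rewrite subrK Normc.normc1.
have := cauchy_schwarz x y; have := nm_ge0 x; nra.
Qed.

Lemma hform1_lower x y : ell x = 1 -> ell y = 1 ->
  1 - nm x * nm y <= nc (hform x y).
Proof.
move=> x1 y1; rewrite hformE x1 y1 rmorph1 mul1r.
have := nc_add (1 - sp x y) (sp x y); rewrite subrK Normc.normc1.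
by have := cauchy_schwarz x y; lra.
Qed.

Lemma hform1_triangle x y : ell x = 1 -> ell y = 1 -> hform x x = 0 ->
  nc (hform x y) <= nm (x - y).
Proof.
move=> x1 y1 /eqP xx; have nx : nm x = 1.
  by move: xx; rewrite isotropicE x1 Normc.normc1 => /eqP.
have -> : hform x y = sp x (x - y).
  by rewrite hformE x1 y1 rmorph1 mul1r spDr spNr spxx nx expr1n.
by rewrite (le_trans (cauchy_schwarz _ _))// nx mul1r.
Qed.

(** The modulus of the form is at least half the squared distance and, from an isotropic vector, at
    most the distance. The lost square root is harmless: the inequality only serves to show that two
    points close to a third are close to each other. *)
Lemma hform1_quasi_triangle x y z : ell x = 1 -> ell y = 1 -> ell z = 1 ->
  hform x x = 0 -> nm y <= 1 -> nm z <= 1 ->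
  nc (hform x y) <=
    Num.sqrt (2 * nc (hform z x)) + Num.sqrt (2 * nc (hform z y)).
Proof.
move=> x1 y1 z1 xx ny nz; apply: (le_trans (hform1_triangle x1 y1 xx)).
have nx : nm x <= 1.
  by move/eqP: xx; rewrite isotropicE x1 Normc.normc1 => /eqP <-.
rewrite -[x - y](subrKA z) (le_trans (nmD _ _))// lerD//.
  rewrite nmB -[leLHS]ger0_norm ?nm_ge0// -sqrtr_sqr ler_wsqrtr//.
  exact: hform1_dist.
rewrite -[leLHS]ger0_norm ?nm_ge0// -sqrtr_sqr ler_wsqrtr//.
exact: hform1_dist.
Qed.

Lemma isotropic_ell_neq0 x : hform x x = 0 -> x != 0 -> ell x != 0.
Proof.
by move=> /eqP; rewrite isotropicE -nc_eq0 -nm_eq0 => /eqP ->.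
Qed.

(* A hyperplane tangent to the light cone at x carries a semidefinite form; it
   is definite, and equal to the standard one up to sign, on the standard
   orthogonal of x. *)
Lemma tangent_ell x z : hform x x = 0 -> x != 0 -> hform x z = 0 ->
  sp x z = 0 -> ell z = 0.
Proof.
move=> xx x0; rewrite hformE => + xz; rewrite xz subr0 => /eqP.
by rewrite mulf_eq0 conjC_eq0 (negbTE (isotropic_ell_neq0 xx x0)) => /eqP.
Qed.

Definition orth x z : V := z - (sp x z / sp x x) *: x.

Lemma sp_orth x z : x != 0 -> sp x (orth x z) = 0.
Proof.
move=> x0; rewrite spDr spNr spZr divfK ?subrr// spxx.
by rewrite -(rmorph0 (real_complex R)) (inj_eq (@complexI _)) expf_neq0// nm_eq0.
Qed.

Lemma hform_orth x z v : hform x x = 0 -> hform x v = 0 ->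
  hform (orth x z) v = hform z v.
Proof. by move=> xx xv; rewrite hformDl hformNl hformZl xv mulr0 oppr0 addr0. Qed.

Lemma hform_orthr x z v : hform x x = 0 -> hform v x = 0 ->
  hform v (orth x z) = hform v z.
Proof. by move=> xx xv; rewrite hformDr hformNr hformZr xv mulr0 oppr0 addr0. Qed.

Lemma ell_orth x z : hform x x = 0 -> x != 0 -> hform x z = 0 ->
  ell (orth x z) = 0.
Proof.
move=> xx x0 xz; apply: (tangent_ell xx x0); last exact: sp_orth.
by rewrite hform_orthr.
Qed.

Lemma nm_orth x z : hform x x = 0 -> x != 0 -> hform x z = 0 ->
  hform z (orth x z) = - (nm (orth x z) ^+ 2)%:C%C.
Proof.
move=> xx x0 xz; rewrite -(hform_orth z xx); last by rewrite hform_orthr.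
by rewrite hformE ell_orth// mulr0 sub0r spxx.
Qed.

Lemma nc_hform_orth x z v : hform x x = 0 -> x != 0 -> hform x z = 0 ->
  hform x v = 0 -> nc (hform z v) <= nm (orth x z) * nm v.
Proof.
move=> xx x0 xz xv; rewrite -(hform_orth z xx xv) hformE ell_orth//.
by rewrite rmorph0 mul0r sub0r ncN cauchy_schwarz.
Qed.

Definition cross x y z : R := 2 * Re (hform y z / (hform y x * hform x z)).

(** Difference of the multiples of [y] and [z] on which [hform x] is 1, hence a vector tangent to
    the light cone at [x]. *)
Definition chord x y z : V := (hform x y)^-1 *: y - (hform x z)^-1 *: z.

Lemma hform_chord x y z : hform x y != 0 -> hform x z != 0 ->
  hform x (chord x y z) = 0.
Proof. by move=> xy xz; rewrite hformDr hformNr !hformZr !mulVf// subrr. Qed.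

(** As [y] and [z] are isotropic, only the mixed terms of [hform c c] survive, and they add up to
    [- cross x y z]. On the tangent hyperplane the form is minus the squared standard norm modulo
    [x]; in particular [cross] is nonnegative. *)
Lemma crossE x y z : hform x x = 0 -> x != 0 -> hform y y = 0 -> hform z z = 0 ->
  hform x y != 0 -> hform x z != 0 ->
  cross x y z = nm (orth x (chord x y z)) ^+ 2.
Proof.
move=> xx x0 yy zz xy xz; set c := chord x y z.
have xc : hform x c = 0 by exact: hform_chord.
have : Re (hform c c) = - nm (orth x c) ^+ 2.
  rewrite -(hform_orthr c xx); last by rewrite hform_conj xc rmorph0.
  by rewrite nm_orth.
move=> /(congr1 -%R); rewrite opprK => <-.
rewrite /c /chord hformDl !hformDr !hformNl !hformNr !hformZl !hformZr yy zz.
rewrite !fmorphV /= -!hform_conj !mulr0 oppr0 add0r oppr0 addr0.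
rewrite [hform z x]hform_conj [hform z y]hform_conj [in X in _ + X]/=.
set t := hform y z / (hform y x * hform x z); rewrite ReD !ReN /cross -/t.
have -> : (hform y x)^-1 * ((hform x z)^-1 * hform y z) = t.
  by rewrite /t invfM mulrA mulrC.
have -> : ((hform x z)^*)^-1 * ((hform x y)^-1 * (hform y z)^*) = t^*.
  rewrite /t rmorphM fmorphV rmorphM /= -[(hform y x)^*]hform_conj invfM.
  by rewrite mulrA mulrC [_^-1 * _^-1]mulrC.
by rewrite Re_conj opprD !opprK mulr_natl.
Qed.

Lemma cross_scale x y z a b c : a != 0 -> b != 0 ->
  cross (c *: x) (a *: y) (b *: z) = (nc c ^+ 2)^-1 * cross x y z.
Proof.
move=> a0 b0; have [->|c0] := eqVneq c 0.
  by rewrite /cross scale0r !hform0l hform0r mul0r invr0 mulr0 Normc.normc0 expr0n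
    invr0 mul0r mulr0.
suff E : hform (a *: y) (b *: z) / (hform (a *: y) (c *: x) * hform (c *: x) (b *: z))
    = ((nc c ^+ 2)^-1)%:C%C * (hform y z / (hform y x * hform x z)).
  by rewrite /cross E ReMr mulrCA.
have -> : ((nc c ^+ 2)^-1)%:C%C = (c^* * c)^-1 by rewrite conjM_nc -fmorphV.
rewrite !hformZl !hformZr !invfM.
have : a^* != 0 by rewrite conjC_eq0.
have : c^* != 0 by rewrite conjC_eq0.
set a' := a^*; set c' := c^* => c'0 a'0.
set X := hform y z; set Y := (hform y x)^-1; set Z := (hform x z)^-1.
by field; rewrite a'0 c'0 b0 c0.
Qed.

Lemma cross_le x y z : hform y x != 0 -> hform x z != 0 ->
  cross x y z <= 2 * (nc (hform y z) / (nc (hform y x) * nc (hform x z))).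
Proof.
move=> yx xz; rewrite ler_pM2l// (le_trans (Re_le_nc _))//.
by rewrite Normc.normcM Normc.normcV Normc.normcM.
Qed.

(** Real part of the Hermitian triple product, whose argument is the Cartan angular invariant up to
    conventions. It is polynomial in the lifts and their conjugates, so it stays continuous where
    [cross] has a vanishing denominator. *)
Definition triple x y z : R := Re (hform x y * hform y z * hform z x).

Lemma cross_triple x y z : hform y x != 0 -> hform x z != 0 ->
  cross x y z =
  2 * triple x y z / (nc (hform y x) * nc (hform x z)) ^+ 2.
Proof.
move=> yx xz; rewrite /cross divc_nc ?mulf_neq0// ReMr Normc.normcM.
rewrite rmorphM /= -!hform_conj /triple [in RHS]mulrAC -!mulrA; congr (_ * _).
by rewrite [hform y z * _]mulrCA.
Qed.

End hermitian_form.

(** * Radial projections *)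

Section hermitian_exterior.
Variables (R : realType) (n : nat).
Local Notation ext := (ext R n).
Implicit Types u v w : ext.

Lemma eipDr w u v : eip w (u + v) = eip w u + eip w v.
Proof. by rewrite -big_split; apply: eq_bigr => S _; rewrite extD mulrDr. Qed.

Lemma eipZr w (a : R[i]) u : eip w (a *: u) = a * eip w u.
Proof. by rewrite mulr_sumr; apply: eq_bigr => S _; rewrite extZ mulrCA. Qed.

Lemma ext_neq0 u : u != 0 -> exists S, u S != 0.
Proof.
move=> /eqP u0; apply: contrapT => /forallNP uS; apply: u0.
by apply/ffunP => S; rewrite ext0; apply/eqP/negPn/negP; exact: uS.
Qed.

Lemma eip0r w : eip w 0 = 0.
Proof. by rewrite /eip big1// => S _; rewrite ext0 mulr0. Qed.

Lemma eip_sumr w I (r : seq I) (F : I -> ext) :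
  eip w (\sum_(i <- r) F i) = \sum_(i <- r) eip w (F i).
Proof. by apply: (big_morph (eip w)); [exact: eipDr|exact: eip0r]. Qed.

Lemma ext_dist_sqr u v : ext_dist u v ^+ 2 = \sum_S nc ((u - v) S) ^+ 2.
Proof.
have E : eip (u - v) (u - v) = (\sum_S nc ((u - v) S) ^+ 2)%:C%C.
  by rewrite rmorph_sum; apply: eq_bigr => S _; exact: conjM_nc.
by rewrite /ext_dist E /= sqr_sqrtr// sumr_ge0// => S _; exact: sqr_ge0.
Qed.

Lemma ext_dist_ge0 u v : 0 <= ext_dist u v.
Proof. exact: sqrtr_ge0. Qed.

Lemma nc_le_ext_dist u v S : nc ((u - v) S) <= ext_dist u v.
Proof.
rewrite -(@ler_pXn2r _ 2%N)// ?nnegrE ?nc_ge0 ?ext_dist_ge0// ext_dist_sqr.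
rewrite (bigD1 S)//=.
by rewrite lerDl sumr_ge0// => j _; exact: sqr_ge0.
Qed.

Lemma nc_vwedge_le (x : 'rV[R[i]]_n) u v S :
  nc (vwedge x (u - v) S) <= n%:R * nm x * ext_dist u v.
Proof.
rewrite vwedgeE (le_trans (nc_sum _ _ _))//.
rewrite (@le_trans _ _ (\sum_(i in S) nm x * ext_dist u v))//.
  apply: ler_sum => i _; rewrite !Normc.normcM.
  have -> : nc ((-1) ^+ lower i (S :\ i) : R[i]) = 1.
    by rewrite -signr_odd; case: odd; rewrite ?ncN Normc.normc1.
  by rewrite mul1r ler_pM ?nc_ge0 ?nc_le_nm ?nc_le_ext_dist.
rewrite sumr_const -[leLHS]mulr_natl -[leRHS]mulrA.
rewrite ler_wpM2r ?mulr_ge0 ?nm_ge0 ?ext_dist_ge0// ler_nat.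
by rewrite -[leqRHS]card_ord max_card.
Qed.

Lemma ewedge_multivectors k (W : {vspace 'rV[R[i]]_n}) (s : seq 'rV[R[i]]_n) :
  size s = k -> all [in W] s -> multivectors k W (ewedge s).
Proof.
move=> sk sW; exists 1%N, (fun=> 1), (fun=> tcast sk (in_tuple s)); split=> [i|].
  by rewrite val_tcast.
by rewrite big_ord1 scale1r val_tcast.
Qed.

End hermitian_exterior.

(** * Multivectors of the tangent hyperplane and the metric of the projection *)

Section tangent_space.
Variables (R : realType) (d : nat).
Local Notation V := 'rV[R[i]]_d.+2.
Local Notation ext := (ext R d.+2).
Implicit Types (x y z v : V) (w : ext) (W : {vspace V}).

Lemma dim_cap_dagger W x y : y \in W -> hform x y != 0 ->
  \dim W = (\dim (W :&: dagger x)).+1.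
Proof.
move=> yW xy; have y0 : y != 0 by apply: contraNneq xy => ->; rewrite hform0r.
have WE : (W :&: dagger x + <[y]>)%VS = W.
  apply/eqP; rewrite eqEsubv subv_add capvSl -memvE yW /=.
  apply/subvP => v vW; apply/memv_addP.
  exists (v - (hform x v / hform x y) *: y); last first.
    by exists ((hform x v / hform x y) *: y); rewrite ?memvZ ?memv_line ?subrK.
  rewrite memv_cap rpredB ?memvZ//= mem_dagger hformDr hformNr hformZr.
  by rewrite divfK ?subrr.
have /dimv_disjoint_sum : (W :&: dagger x :&: <[y]> = 0)%VS.
  apply/eqP; rewrite -subv0; apply/subvP => v /memv_capP[/memv_capP[_ vx] /vlineP[k vk]].
  move: vx; rewrite vk mem_dagger hformZr mulf_eq0 (negbTE xy) orbF => /eqP ->.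
  by rewrite scale0r mem0v.
by rewrite WE dim_vline y0 addn1.
Qed.

Lemma self_dagger x : hform x x = 0 -> x \in dagger x.
Proof. by rewrite mem_dagger => ->. Qed.

Lemma dagger_basis x y : hform x x = 0 -> hform x y != 0 ->
  let v := vbasis (dagger x :&: dagger y) in
  [/\ size v = d, all [in dagger x] v, free (x :: v)
    & dagger x = <<x :: v>>%VS].
Proof.
move=> xx xy v; have yx : hform y x != 0 by rewrite hform_conj conjC_eq0.
have xU := self_dagger xx.
have dimU : \dim (dagger x) = d.+1.
  have := dim_cap_dagger (memvf y) xy.
  by rewrite dimvf /dim /= mul1n capfv => -[].
have := dim_cap_dagger xU yx; rewrite dimU => -[dimI].
have sv : size v = d by rewrite size_tuple.
have vI u : u \in v -> u \in (dagger x :&: dagger y)%VS by exact: vbasis_mem.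
have spv : <<v>>%VS = (dagger x :&: dagger y)%VS by exact/span_basis/vbasisP.
have fv : free (x :: v).
  have xN : x \notin <<v>>%VS.
    by rewrite spv; apply/negP => /memv_capP[_]; rewrite mem_dagger (negbTE yx).
  by rewrite free_cons xN; exact: basis_free (vbasisP _).
split=> //; first by apply/allP => u /vI /memv_capP[].
apply/esym/eqP; rewrite eqEdim dimU (eqP fv) /= sv leqnn andbT.
rewrite span_cons spv subv_add -memvE xU; exact: capvSl.
Qed.

Variables (x : V) (h : ext).
Hypotheses (x0 : x != 0) (xx : hform x x = 0).
Hypotheses (hmul : multivectors d (dagger x) h) (h1 : eip h h = 1)
  (hA : forall u, multivectors d (dagger x) u -> vwedge x u = 0 -> eip h u = 0).

Definition pencil y : ext := ewedge (vbasis (dagger x :&: dagger y)).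

(** The radial projection before the translation by [- h], which does not change distances. *)
Definition npencil y : ext := (eip h (pencil y))^-1 *: pencil y.

Lemma multivectors_codim1 y w : hform x y != 0 -> multivectors d (dagger x) w ->
  let v := vbasis (dagger x :&: dagger y) in
  exists a (c : 'I_(size v) -> R[i]), w = a *: pencil y +
    \sum_(i < size v) c i *: ewedge (x :: take i v ++ drop i.+1 v).
Proof.
move=> xy [m [c [s [sU ->]]]] v.
pose P u := exists a (c : 'I_(size v) -> R[i]), u = a *: pencil y +
    \sum_(i < size v) c i *: ewedge (x :: take i v ++ drop i.+1 v).
have [sv vU fv Uv] := dagger_basis xx xy.
apply: (@lin_closed_sum _ _ P).
  split.
    exists 0, (fun=> 0); rewrite scale0r add0r big1// => i _.
    by rewrite scale0r.
  move=> a u u' [a1 [c1 ->]] [a2 [c2 ->]].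
  exists (a * a1 + a2), (fun i => a * c1 i + c2 i).
  rewrite scalerDr scalerDl scalerA addrACA; congr (_ + _).
  rewrite scaler_sumr -big_split /=; apply: eq_bigr => i _.
  by rewrite scalerDl scalerA.
move=> i; apply: ewedge_codim1; first by rewrite -Uv.
by rewrite size_tuple sv.
Qed.

Lemma del_multivectors y i : hform x y != 0 ->
  let v := vbasis (dagger x :&: dagger y) in
  (i < size v)%N -> multivectors d (dagger x) (ewedge (x :: take i v ++ drop i.+1 v)).
Proof.
move=> xy v iv; have [sv vU _ _] := dagger_basis xx xy.
apply: ewedge_multivectors.
  rewrite /= size_cat size_takel ?size_drop; last exact: ltnW.
  by rewrite -addnS subnSK// subnKC// ltnW.
apply/allP => u; rewrite inE mem_cat => /orP[/eqP ->|/orP[/mem_take|/mem_drop]].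
- exact: self_dagger.
- exact: (allP vU).
- exact: (allP vU).
Qed.

(** Modulo the products divisible by [x], the [d]-vectors of the tangent hyperplane form a line.
    Both [eip h] and the product with [x] annihilate those products, so they are proportional. *)
Lemma pencil_decomp y w : hform x y != 0 -> multivectors d (dagger x) w ->
  exists a, eip h w = a * eip h (pencil y) /\ vwedge x w = a *: vwedge x (pencil y).
Proof.
move=> xy /(multivectors_codim1 xy)[a [c ->]]; exists a; split.
  rewrite eipDr eipZr eip_sumr big1 ?addr0// => i _.
  rewrite eipZr hA ?mulr0//; first exact: del_multivectors.
  by rewrite ewedge_cons vwedgexx.
rewrite vwedgeDr vwedge_sumr big1 ?addr0// => i _.
by rewrite vwedgeZr ewedge_cons vwedgexx scaler0.
Qed.

Lemma npencil_top y : hform x y != 0 -> vwedge x (npencil y) = vwedge x h.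
Proof.
move=> xy; have [a []] := pencil_decomp xy hmul; rewrite h1 => ha ->.
by rewrite vwedgeZr; congr (_ *: _); apply: mulr1_eq; rewrite mulrC.
Qed.

Lemma vwedge_x_pencil y : hform x y != 0 -> vwedge x (pencil y) != 0.
Proof.
by move=> xy; have [_ _ fv _] := dagger_basis xx xy; exact: (ewedge_neq0 fv).
Qed.

Lemma top_neq0 y : hform x y != 0 -> vwedge x h != 0.
Proof.
move=> xy; have [a []] := pencil_decomp xy hmul; rewrite h1 => ha ->.
rewrite scaler_eq0 (negbTE (vwedge_x_pencil xy)) orbF; apply/eqP => a0.
by move: ha; rewrite a0 mul0r => /eqP; rewrite oner_eq0.
Qed.

(* Contracting with the (d+1)-vectors of the tangent space identifies the
   normalised d-vector of y with the linear form v |-> <y, v> / <y, x>. *)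
Lemma vwedge_npencil y v : hform x y != 0 -> v \in dagger x ->
  vwedge v (npencil y) = (hform y v / hform y x) *: vwedge x h.
Proof.
move=> xy vU; have yx : hform y x != 0 by rewrite hform_conj conjC_eq0.
set k := _ / _; have -> : v = k *: x + (v - k *: x) by rewrite addrC subrK.
rewrite vwedgeDl npencil_top// vwedgeZr -[RHS]addr0; congr (_ + _).
suff -> : vwedge (v - k *: x) (pencil y) = 0 by rewrite scaler0.
have : v - k *: x \in <<vbasis (dagger x :&: dagger y)>>%VS.
  rewrite (span_basis (vbasisP _)); apply/memv_capP; split.
    by apply: memvB => //; apply: memvZ; exact: self_dagger.
  by rewrite mem_dagger hformDr hformNr hformZr divfK ?subrr.
move=> /(@coord_span _ _ _ (vbasis _)) ->.
elim/big_rec: _ => [|i u _ IH]; first exact: vwedge0l.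
by rewrite vwedgeDl IH addr0 vwedge_mem ?scaler0 ?mem_nth ?size_tuple.
Qed.

Lemma npencil_multivectors y : hform x y != 0 -> multivectors d (dagger x) (npencil y).
Proof.
move=> xy; have [sv vU _ _] := dagger_basis xx xy.
exists 1%N, (fun=> (eip h (pencil y))^-1), (fun=> tcast sv (in_tuple _)).
by split=> [i|]; rewrite ?big_ord1 val_tcast.
Qed.

(** The difference of two projections is thus the linear form that [chord x y z] defines on the
    tangent hyperplane. *)
Lemma vwedge_npencilB y z v : hform x y != 0 -> hform x z != 0 -> v \in dagger x ->
  vwedge v (npencil y - npencil z) = hform (chord x y z) v *: vwedge x h.
Proof.
move=> xy xz vU.
have -> : hform (chord x y z) v = hform y v / hform y x - hform z v / hform z x.
  rewrite hformDl hformNl !hformZl !fmorphV /= -!hform_conj.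
  by congr (_ - _); rewrite mulrC.
move: (vwedge_npencil xy vU) (vwedge_npencil xz vU).
move: (npencil y) (npencil z) (_ / _) (_ / _) => a b k l ak bl.
by rewrite vwedge_addr vwedgeNr ak bl scalerBl.
Qed.

(** Test the difference against [o] itself: the linear form of the chord has modulus [nm o ^+ 2]
    there, while the product with [o] costs at most [d.+2] times [nm o], so one power of [nm o] is
    left. [S] is a fixed nonzero coordinate of the top vector. *)
Lemma npencil_lower : exists2 c, 0 < c & forall y z,
  hform y y = 0 -> hform z z = 0 -> hform x y != 0 -> hform x z != 0 ->
  c * cross x y z <= ext_dist (npencil y) (npencil z) ^+ 2.
Proof.
have [[y0 xy0]|none] := pselect (exists y, hform x y != 0); last first.
  by exists 1 => // y z _ _ xy; case: none; exists y.
have [S tS] := ext_neq0 (top_neq0 xy0).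
pose t := nc (vwedge x h S); have tp : 0 < t by rewrite nc_gt0.
exists ((t / d.+2%:R) ^+ 2); first by rewrite exprn_gt0// divr_gt0.
move=> y z yy zz xy xz; rewrite crossE//.
set o := orth _ _; set D := ext_dist _ _.
have D0 : 0 <= D by exact: ext_dist_ge0.
have xc := hform_chord xy xz.
have oU : o \in dagger x by rewrite mem_dagger hform_orthr// xc.
rewrite -exprMn ler_pXn2r ?nnegrE ?mulr_ge0 ?invr_ge0 ?nm_ge0 ?(ltW tp)//.
rewrite mulrAC ler_pdivrMr// [t * _]mulrC.
have [->|o0] := eqVneq (nm o) 0; first by rewrite mul0r mulr_ge0.
have op : 0 < nm o by rewrite lt_neqAle eq_sym o0 nm_ge0.
rewrite -(ler_pM2l op) mulrA.
have -> : nm o * nm o * t = nc (vwedge o (npencil y - npencil z) S).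
  rewrite vwedge_npencilB// extZ Normc.normcM -/t nm_orth// ncN nc_real.
  by rewrite ger0_norm ?sqr_ge0.
by rewrite (le_trans (nc_vwedge_le _ _ _ _))// -mulrA mulrCA [_ * D]mulrC.
Qed.

(** Expand the difference in the products attached to a fixed [y0]. The coefficient of [pencil y0]
    vanishes; each other one is read off by a product with one basis vector, where the linear form
    of the chord is at most a multiple of [nm o]. *)
Lemma npencil_upper : exists2 c, 0 < c & forall y z,
  hform y y = 0 -> hform z z = 0 -> hform x y != 0 -> hform x z != 0 ->
  ext_dist (npencil y) (npencil z) ^+ 2 <= c * cross x y z.
Proof.
have [[y0 xy0]|none] := pselect (exists y, hform x y != 0); last first.
  by exists 1 => // y z _ _ xy; case: none; exists y.
have [S tS] := ext_neq0 (vwedge_x_pencil xy0).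
pose t0 := nc (vwedge x (pencil y0) S); have t0p : 0 < t0 by rewrite nc_gt0.
pose t := nc (vwedge x h S); have tp : 0 <= t by rewrite nc_ge0.
pose v := vbasis (dagger x :&: dagger y0).
pose tau i := ewedge (x :: take i v ++ drop i.+1 v).
pose K (i : 'I_(size v)) := nm v`_i * t / t0.
have K0 i : 0 <= K i by rewrite !mulr_ge0 ?invr_ge0 ?nm_ge0// ltW.
pose M T := \sum_i K i * nc (tau i T).
have M0 T : 0 <= M T by rewrite sumr_ge0// => i _; rewrite mulr_ge0 ?nc_ge0.
exists (1 + \sum_T M T ^+ 2).
  by rewrite ltr_pwDl// sumr_ge0// => T _; exact: sqr_ge0.
move=> y z yy zz xy xz; rewrite crossE//.
set o := orth _ _; have xc := hform_chord xy xz.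
have [a [c Dc]] : exists a (c : 'I_(size v) -> R[i]),
    npencil y - npencil z = a *: pencil y0 + \sum_i c i *: tau i.
  have [a1 [c1 ->]] := multivectors_codim1 xy0 (npencil_multivectors xy).
  have [a2 [c2 ->]] := multivectors_codim1 xy0 (npencil_multivectors xz).
  exists (a1 - a2), (fun i => c1 i - c2 i); rewrite opprD addrACA scalerBl.
  by congr (_ + _); rewrite -sumrB; apply: eq_bigr => i _; rewrite scalerBl.
have a0 : a = 0.
  have : vwedge x (npencil y - npencil z) = 0.
    by rewrite vwedge_npencilB ?self_dagger// hform_conj xc rmorph0 scale0r.
  rewrite Dc vwedgeDr vwedge_sumr big1 ?addr0 => [/eqP|i _]; last first.
    by rewrite vwedgeZr /tau ewedge_cons vwedgexx scaler0.
  by rewrite scaler_eq0 (negbTE (vwedge_x_pencil xy0)) orbF => /eqP.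
have [sv vU _ _] := dagger_basis xx xy0.
have ci i : nc (c i) <= nm o * K i.
  have viU : v`_i \in dagger x by apply: (allP vU); exact: mem_nth.
  have := vwedge_npencilB xy xz viU.
  rewrite Dc a0 scale0r add0r vwedge_sumr (bigD1 i)//= big1 ?addr0; last first.
    move=> j ji; rewrite vwedgeZr vwedge_mem ?scaler0// inE mem_cat.
    apply/orP; right; have [ij|ij] := ltnP i j.
      by rewrite -(nth_take 0 ij) mem_nth// size_takel// ltnW.
    have {}ij : (j < i)%N by rewrite ltn_neqAle ij ji.
    by rewrite -(subnKC ij) -nth_drop mem_nth ?orbT// size_drop ltn_sub2r ?(leq_ltn_trans ij).
  rewrite vwedgeZr vwedge_cons_del// => /(congr1 (fun u : ext => nc (u S))).
  rewrite !extZ !Normc.normcM -/t -[ewedge _]/(vwedge x (pencil y0)) -/t0.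
  have -> : nc ((-1) ^+ i.+1 : R[i]) = 1.
    by rewrite -signr_odd; case: odd; rewrite ?ncN Normc.normc1.
  rewrite mul1r => E; rewrite -(ler_pM2r t0p) E /K mulrA divfK ?gt_eqF//.
  rewrite mulrA ler_wpM2r//; apply: nc_hform_orth => //.
  by apply/eqP; rewrite -mem_dagger.
rewrite ext_dist_sqr mulrDl mul1r ler_wpDl ?sqr_ge0//.
rewrite mulr_suml; apply: ler_sum => T _; rewrite -exprMn.
rewrite ler_pXn2r ?nnegrE ?nc_ge0 ?mulr_ge0 ?nm_ge0//.
rewrite Dc a0 scale0r add0r sum_ffunE (le_trans (nc_sum _ _ _))//.
rewrite /M mulr_suml; apply: ler_sum => i _.
by rewrite extZ Normc.normcM mulrAC ler_wpM2r ?nc_ge0// mulrC.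
Qed.

End tangent_space.

(** * Reduced words and Schottky dynamics *)

Section reduced_words.
Variables (L : finType) (iv : L -> L).
Hypotheses (ivK : involutive iv) (L4 : (3 < #|L|)%N).
Implicit Types (a b c : L) (s t w : seq L).

Definition step a b : bool := b != iv a.

Definition red w : bool := sorted step w.

Lemma step_iv a b : step (iv b) (iv a) = step a b.
Proof. by rewrite /step ivK eq_sym. Qed.

Definition winv w := rev (map iv w).

Lemma red_winv w : red (winv w) = red w.
Proof.
rewrite /red /winv rev_sorted sorted_map; apply: eq_sorted => a b /=.
by rewrite /relpre /= step_iv.
Qed.

Lemma avoid3 a b c : exists e, [/\ e != a, e != b & e != c].
Proof.
have : (#|[set a; b; c]%SET| < #|L|)%N.
  by rewrite (leq_trans _ L4)// ltnS (leq_trans (leq_card_setU _ _))// cards1 cards2; case: (a != b).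
move=> lt; suff /existsP[e] : [exists e, e \notin [set a; b; c]%SET].
  by rewrite !inE !negb_or -andbA => /and3P[]; exists e.
apply: contraLR lt; rewrite negb_exists => /forallP h.
rewrite -leqNgt subset_leq_card//; apply/fintype.subsetP => e _.
by have := h e; rewrite negbK.
Qed.

Lemma red_rcons c w b : red (c :: w) -> step (last c w) b -> red (rcons (c :: w) b).
Proof. by rewrite /red /= rcons_path => ->. Qed.

Lemma red_cat_head s t b : red (s ++ rcons t b) -> red (rcons s (head b t)).
Proof.
by case: t => [|c t]; rewrite /= -?cat_rcons => /cat_sorted2[].
Qed.

Lemma red_catl s t : red (s ++ t) -> red s.
Proof. by case/cat_sorted2. Qed.

Lemma red_catr s t : red (s ++ t) -> red t.
Proof. by case/cat_sorted2. Qed.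

Definition rword (om : nat -> L) := forall n, step (om n) (om n.+1).

Definition pre (om : nat -> L) n := mkseq om n.

Lemma pre_rcons om n : pre om n.+1 = rcons (pre om n) (om n).
Proof. exact: mkseqS. Qed.

Lemma size_pre om n : size (pre om n) = n. Proof. exact: size_mkseq. Qed.

Definition shift n (om : nat -> L) := fun k => om (n + k)%N.

Lemma pre_add om n k : pre om (n + k) = pre om n ++ pre (shift n om) k.
Proof.
rewrite /pre /mkseq iotaD map_cat add0n; congr (_ ++ _).
by rewrite -[in LHS](addn0 n) iotaDl -map_comp.
Qed.

Lemma rword_shift n om : rword om -> rword (shift n om).
Proof. by move=> r k; rewrite /shift addnS; exact: r. Qed.

Lemma red_pre om n : rword om -> red (pre om n).
Proof.
move=> r; apply/(sortedP (om 0%N)) => i; rewrite size_pre => lt.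
by rewrite !nth_mkseq//; exact: ltnW.
Qed.

Definition words n : seq (seq L) := [seq tval u | u <- enum [pred u : n.-tuple L | red u]].

Lemma mem_words n w : (w \in words n) = red w && (size w == n).
Proof.
apply/mapP/andP => [[t]|[rw /eqP sw]].
  by rewrite mem_enum => rt ->; rewrite size_tuple.
by exists (tcast sw (in_tuple w)); rewrite ?mem_enum ?inE val_tcast.
Qed.

Lemma words_uniq n : uniq (words n).
Proof. by rewrite map_inj_uniq ?enum_uniq//; exact: val_inj. Qed.

Fixpoint words_upto n : seq (seq L) :=
  if n is n'.+1 then words_upto n' ++ words n else words 0.

Lemma mem_words_upto n w : (w \in words_upto n) = red w && (size w <= n)%N.
Proof.
elim: n => [|n IH]; first by rewrite mem_words leqn0.
by rewrite mem_cat IH mem_words -andb_orr [(size w <= n.+1)%N]leq_eqVlt ltnS orbC.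
Qed.

Lemma words_upto_uniq n : uniq (words_upto n).
Proof.
elim: n => [|n IH]; first exact: words_uniq.
rewrite cat_uniq IH words_uniq andbT /=; apply/hasPn => w.
by rewrite mem_words mem_words_upto => /andP[-> /eqP ->]; rewrite ltnn.
Qed.

(** The words without a prefix in [F] form a finitely branching tree. If it were infinitely deep,
    always moving to a letter with arbitrarily long continuations would give an infinite reduced
    word avoiding [F]. This is the compactness that makes a countable cover finite. *)
Lemma koenig a (F : set (seq L)) :
  (forall om, rword om -> om 0%N = a -> exists n, F (pre om n.+1)) ->
  exists N, forall w, size w = N -> red (a :: w) ->
    exists2 k, (k <= N)%N & F (a :: take k w).
Proof.
move=> Fom; pose tree w := red (a :: w) /\ forall k, (k <= size w)%N -> ~ F (a :: take k w).
have tree_cat w u : tree (w ++ u) -> tree w.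
  move=> [r h]; split; first by move: r; rewrite -cat_cons => /red_catl.
  move=> k kw; have := h k; rewrite size_cat takel_cat//; apply.
  by rewrite (leq_trans kw)// leq_addr.
apply: contrapT => none.
have tree_all N : exists2 w, size w = N & tree w.
  apply: contrapT => notree; apply: none; exists N => w sw rw.
  apply: contrapT => nok; apply: notree; exists w => //; split=> // k kw Fk.
  by apply: nok; exists k => //; rewrite -sw.
pose ext w := forall N, exists2 u, size u = N & tree (w ++ u).
have /choice[nx hnx] w : exists b, ext w -> ext (rcons w b).
  apply: contrapT => /forallNP nob.
  have ew : ext w by apply: contrapT => new; apply: (nob a).
  have /choice[f hf] b : exists N, forall u, size u = N -> ~ tree (rcons w b ++ u).
    apply: contrapT => /forallNP h; apply: (nob b) => _ N.
    apply: contrapT => h'; apply: (h N) => u su tu; apply: h'; by exists u.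
  (* One letter more than every failing length: after the first letter [b], at least [f b] letters
     remain. *)
  have [[//|b u] [su] tu] := ew (\max_b f b).+1.
  have fb : (f b <= size u)%N by rewrite su; exact: leq_bigmax.
  apply: (hf b (take (f b) u)); first exact: size_takel.
  apply: (@tree_cat _ (drop (f b) u)).
  by rewrite -catA cat_take_drop cat_rcons.
pose W := fix W n := if n is n'.+1 then rcons (W n') (nx (W n')) else [::].
have extW n : ext (W n).
  by elim: n => [N|n IH] /=; [exact: tree_all|exact: hnx].
have treeW n : tree (W n) by have [u _ /tree_cat] := extW n 0%N.
pose om n := if n is n'.+1 then nx (W n') else a.
have preE n : pre om n.+1 = a :: W n.
  by elim: n => [//|n IH]; rewrite pre_rcons IH.
have sW n : size (W n) = n by elim: n => //= n IH; rewrite size_rcons IH.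
have rom : rword om.
  move=> n; have [r _] := treeW n.+1; move: r; rewrite -preE pre_rcons preE.
  rewrite /red /= rcons_path => /andP[_].
  by case: n => [//|n]; rewrite /= last_rcons.
have [n] := Fom om rom erefl; rewrite preE.
by have [_ /(_ n)] := treeW n; rewrite sW => /(_ (leqnn n)); rewrite take_oversize ?sW.
Qed.

End reduced_words.

(** * Elementary inequalities and finite sums *)

Lemma powR_mono (R : realType) (s a b : R) : 0 <= s -> 0 <= a -> a <= b ->
  a `^ s <= b `^ s.
Proof.
by move=> s0 a0 ab; apply: ge0_ler_powR => //; rewrite nnegrE// (le_trans a0).
Qed.

Lemma sqrt_small (R : realType) (e : R) : 0 < e ->
  exists2 d, 0 < d & forall a b : R, 0 <= a -> a < d ->
  0 <= b -> b < d -> Num.sqrt (2 * a) + Num.sqrt (2 * b) < e.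
Proof.
move=> e0; exists (e ^+ 2 / 8); first by rewrite divr_gt0 ?exprn_gt0.
have h a : 0 <= a -> a < e ^+ 2 / 8 -> Num.sqrt (2 * a) < e / 2.
  move=> a0 ae; rewrite -(ger0_norm (ltW (divr_gt0 e0 (ltr0n R 2)))) -sqrtr_sqr.
  by rewrite ltr_sqrt ?exprn_gt0 ?divr_gt0//; lra.
move=> a b a0 ae b0 be; have := h a a0 ae; have := h b b0 be; lra.
Qed.

Lemma inv_small (R : realType) (e : R) : 0 < e -> exists n, forall m, (n <= m)%N -> m.+1%:R^-1 < e.
Proof.
move=> e0; exists (Num.bound e^-1) => m nm.
rewrite -[e]invrK ltf_pV2 ?posrE ?invr_gt0//.
have := archi_boundP (ltW (etrans (invr_gt0 e) e0)).
by move/lt_trans; apply; rewrite ltr_nat ltnS.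
Qed.

Lemma positive_lower_bound (R : realType) (I : finType) (f : I -> R) :
  (forall i, 0 < f i) -> exists2 e, 0 < e & forall i, e <= f i.
Proof.
move=> f0; have s0 (P : pred I) : 0 <= \sum_(j | P j) (f j)^-1.
  by rewrite sumr_ge0// => j _; rewrite invr_ge0 ltW.
exists (1 + \sum_j (f j)^-1)^-1; first by rewrite invr_gt0 ltr_pwDl// (s0 xpredT).
move=> i; rewrite -[leRHS]invrK lef_pV2 ?posrE ?invr_gt0 ?ltr_pwDl//.
rewrite (bigD1 i)//= addrCA lerDl addr_ge0//.
Qed.

(** A finite list becomes a family indexed by all integers, padded with zeros; covers have this
    form. *)
Lemma sum_onth (R : realType) T (l : seq T) (G : T -> R) N : (forall v, 0 <= G v) ->
  \sum_(i < N) odflt 0 (omap G (onth l i)) <= \sum_(v <- l) G v.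
Proof.
move=> G0; elim: l N => [|v l IH] N.
  by rewrite big_nil big1// => -[[|i] ?] _.
case: N => [|N]; first by rewrite big_ord0 sumr_ge0.
by rewrite big_ord_recl big_cons; apply: lerD => //; exact: IH.
Qed.

Lemma ler_sum_inj (R : realType) (I J : eqType) (r : seq I) (s : seq J)
    (h : I -> J) (F : I -> R) (G : J -> R) :
  uniq r -> uniq s -> {in r &, injective h} -> (forall i, i \in r -> h i \in s) ->
  (forall j, 0 <= G j) -> (forall i, i \in r -> F i <= G (h i)) ->
  \sum_(i <- r) F i <= \sum_(j <- s) G j.
Proof.
move=> ur us hinj hs G0 FG.
rewrite (@le_trans _ _ (\sum_(i <- r) G (h i)))//.
  by rewrite big_seq [leRHS]big_seq; apply: ler_sum.
rewrite -(big_map h xpredT G); set r' := map h r.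
have ur' : uniq r' by rewrite map_inj_in_uniq.
have p : perm_eq r' [seq j <- s | j \in r'].
  apply: uniq_perm => //; first by rewrite filter_uniq.
  move=> j; rewrite mem_filter; case: (boolP (j \in r')) => //= /mapP[i ir ->].
  by rewrite hs.
rewrite (perm_big _ p) big_filter big_mkcond /=; apply: ler_sum => j _.
by case: ifP.
Qed.

Lemma sum_pmap (R : realType) (I T : Type) (r : seq I) (f : I -> option T) (G : T -> R) :
  \sum_(v <- pmap f r) G v = \sum_(i <- r) odflt 0 (omap G (f i)).
Proof.
elim: r => [|i r IH] /=; first by rewrite !big_nil.
by rewrite big_cons -IH; case: (f i) => [v|] /=; rewrite ?big_cons// add0r.
Qed.

Lemma sum_half (R : realType) (e : R) n : 0 <= e -> \sum_(i < n) e / 2 ^+ i.+1 <= e.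
Proof.
move=> e0; suff -> : \sum_(i < n) e / 2 ^+ i.+1 = e - e / 2 ^+ n.
  by rewrite gerBl divr_ge0// exprn_ge0.
elim: n => [|n IH]; first by rewrite big_ord0 expr0 divr1 subrr.
rewrite big_ord_recr /= IH exprS; field.
by rewrite expf_neq0.
Qed.

(** * Schottky dynamics from axioms on [kap], [jac], [crs] and [lam] *)

Section schottky_dynamics.
Variables (R : realType) (X : Type) (Gp : groupType) (act : Gp -> X -> X).
Hypotheses (act1 : forall x, act 1%g x = x)
  (actM : forall g h x, act (g * h)%g x = act g (act h x)).
Variables (bd dom : set X) (o : X).
Hypotheses (bd_dom : bd `<=` dom) (dom_o : dom o)
  (act_bd : forall g x, bd x -> bd (act g x))
  (act_dom : forall g x, dom x -> dom (act g x)).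
Variables (kap : X -> X -> R) (jac : Gp -> X -> R) (crs : X -> X -> X -> R).
Hypotheses (kapC : forall x y, kap x y = kap y x)
  (kap_ge0 : forall x y, 0 <= kap x y)
  (kap_le2 : forall x y, dom x -> dom y -> kap x y <= 2)
  (kap_eq0 : forall x y, bd x -> bd y -> kap x y = 0 -> x = y)
  (kap_qt : forall x y z, bd x -> dom y -> dom z ->
     kap x y <= Num.sqrt (2 * kap z x) + Num.sqrt (2 * kap z y)).
Hypotheses (jac_gt0 : forall g x, dom x -> 0 < jac g x)
  (jacM : forall g h x, dom x -> jac (g * h)%g x = jac g (act h x) * jac h x)
  (kap_act : forall g x y, dom x -> dom y ->
     kap (act g x) (act g y) * (jac g x * jac g y) = kap x y)
  (crs_act : forall g x y z, bd x -> bd y -> bd z ->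
     crs (act g x) (act g y) (act g z) = jac g x ^+ 2 * crs x y z)
  (crs_le : forall x y z, bd x -> bd y -> bd z -> x <> y -> x <> z ->
     crs x y z <= 2 * (kap y z / (kap y x * kap x z))).
Variables (co : R) (lam : Gp -> R) (cl : R).
Hypotheses (co_gt0 : 0 < co) (kap_o : forall x, dom x -> co <= kap o x)
  (lam_gt0 : forall g, 0 < lam g) (cl_gt0 : 0 < cl)
  (lam_le : forall g, lam g * jac g o <= cl)
  (lam_ge : forall g, 1 <= cl * (lam g * jac g o)).
Variables (L : finType) (iv : L -> L) (gen : L -> Gp) (ball : L -> set X).
Hypotheses (ivK : involutive iv) (L4 : (3 < #|L|)%N)
  (gen_iv : forall a, gen (iv a) = (gen a)^-1%g)
  (ball_bd : forall a, ball a `<=` bd)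
  (ball_ex : forall a, exists x, ball a x)
  (ball_disj : forall a b x, ball a x -> ball b x -> a = b)
  (ball_act : forall a x, bd x -> ~ ball (iv a) x -> ball a (act (gen a) x)).
Variables (cb ct : R).
Hypotheses (cb_gt0 : 0 < cb) (ct_gt0 : 0 < ct)
  (kap_ball : forall a b x y, a <> b -> ball a x -> ball b y -> cb <= kap x y)
  (crs_ball : forall a b c x y z, a <> b -> a <> c -> b <> c ->
     ball a x -> ball b y -> ball c z -> ct <= crs x y z)
  (ball_cluster : forall a (u : nat -> X), (forall n, ball a (u n)) ->
     exists2 p, ball a p &
       forall e n, 0 < e -> exists2 m, (n <= m)%N & kap p (u m) < e).

Local Notation step := (step iv).
Local Notation red := (red iv).
Local Notation winv := (winv iv).
Local Notation rword := (rword iv).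
Implicit Types (a b c : L) (s t w : seq L) (g h : Gp) (x y z p q : X).

Definition ev w : Gp := foldr (fun a g => gen a * g)%g 1%g w.

Lemma ev_cat s t : ev (s ++ t) = (ev s * ev t)%g.
Proof. by elim: s => [|a s IH] /=; rewrite ?mul1g// IH mulgA. Qed.

Lemma ev_rcons s a : ev (rcons s a) = (ev s * gen a)%g.
Proof. by rewrite -cats1 ev_cat /= mulg1. Qed.

Lemma ev_winv w : ev (winv w) = (ev w)^-1%g.
Proof.
rewrite /winv; elim: w => [|a w IH] /=; first by rewrite invg1.
by rewrite rev_cons ev_rcons IH gen_iv invgM.
Qed.

Lemma ball_dom a : ball a `<=` dom.
Proof. by move=> x /ball_bd /bd_dom. Qed.

Lemma actK g : cancel (act g) (act g^-1%g).
Proof. by move=> x; rewrite -actM mulVg act1. Qed.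

Lemma actKV g : cancel (act g^-1%g) (act g).
Proof. by move=> x; rewrite -actM mulgV act1. Qed.

(** Ping-pong: the shorter word sends [x] into the ball of its first letter [b], which is disjoint
    from [ball (iv a)] because the word is reduced. *)
Lemma ball_word_bd a w x : red (a :: w) -> bd x -> ~ ball (iv (last a w)) x ->
  ball a (act (ev (a :: w)) x).
Proof.
elim: w a => [|b w IH] a /=; first by rewrite mulg1 => _; exact: ball_act.
move=> /andP[ab wred] xbd xN; rewrite actM; apply: ball_act.
  exact: act_bd.
move=> /ball_disj /(_ (IH b wred xbd xN)) E.
by move: ab; rewrite /step -E eqxx.
Qed.

Lemma ball_word w b p : red (rcons w b) -> ball b p -> ball (head b w) (act (ev w) p).
Proof.
case: w => [|a w] /=; first by rewrite act1.
rewrite rcons_path => /andP[wred wb] bp.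
apply: ball_word_bd => //; first exact: ball_bd bp.
by move/ball_disj/(_ bp) => E; move: wb; rewrite /step -E eqxx.
Qed.

Lemma ball_word_inv c w x : red (c :: w) -> bd x -> ~ ball c x ->
  ball (iv (last c w)) (act (ev (c :: w))^-1%g x).
Proof.
move=> rw xbd xN; rewrite -ev_winv; move: rw; rewrite -red_winv// /winv.
rewrite lastI map_rcons rev_rcons => rw; apply: ball_word_bd => //.
by case: w {rw} => [|e w] /=; rewrite ?rev_cons ?last_rcons ivK.
Qed.

Lemma jac1 x : dom x -> jac 1%g x = 1.
Proof.
move=> xd; have := jacM 1%g 1%g xd; rewrite mulg1 act1 => /esym E.
by apply: (mulIf (lt0r_neq0 (jac_gt0 1%g xd))); rewrite mul1r.
Qed.

Lemma jacV g x : dom x -> jac g^-1%g (act g x) * jac g x = 1.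
Proof. by move=> xd; rewrite -jacM// mulVg jac1. Qed.

Lemma kap_jac g x : dom x -> kap (act g x) o * jac g x = kap x (act g^-1%g o) * jac g^-1%g o.
Proof.
move=> xd; have od := act_dom g^-1%g dom_o.
have := kap_act g xd od; rewrite actKV => <-.
have := jacV g^-1%g dom_o; rewrite invgK => E.
by rewrite -!mulrA E mulr1.
Qed.

Lemma jacV_o g : kap (act g o) o * jac g o = kap o (act g^-1%g o) * jac g^-1%g o.
Proof. exact: kap_jac. Qed.

(** By [kap_jac], both [jac g x] and [jac g o] are compared with [jac g^-1 o]; each comparison loses
    a factor [2 / co]. *)
Lemma jac_upper g x : dom x -> jac g x <= 4 / co ^+ 2 * jac g o.
Proof.
move=> xd; have E := kap_jac g xd; have Eo := jacV_o g.
have gd := act_dom g xd; have vd := act_dom g^-1%g dom_o; have od := act_dom g dom_o.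
have k1 := kap_le2 xd vd; have k2 := kap_o gd; have k3 := kap_le2 od dom_o.
have k4 := kap_o vd; rewrite kapC in k2.
have j1 := jac_gt0 g^-1%g dom_o; have j2 := jac_gt0 g xd; have j3 := jac_gt0 g dom_o.
rewrite mulrAC ler_pdivlMr ?exprn_gt0//.
have h1 : co * jac g x <= 2 * jac g^-1%g o.
  by rewrite (le_trans (y := kap (act g x) o * jac g x)) ?ler_pM2r// E ler_pM2r.
have h2 : co * jac g^-1%g o <= 2 * jac g o.
  by rewrite (le_trans (y := kap o (act g^-1%g o) * jac g^-1%g o)) ?ler_pM2r// -Eo ler_pM2r.
have := co_gt0; nra.
Qed.

(** The factor at [x] can be much smaller than the factor at [o] only if [x] is close to
    [act g^-1 o]. *)
Lemma jac_lower_kap g x : dom x ->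
  co / 4 * kap x (act g^-1%g o) * jac g o <= jac g x.
Proof.
move=> xd; have E := kap_jac g xd; have Eo := jacV_o g.
have gd := act_dom g xd; have vd := act_dom g^-1%g dom_o; have od := act_dom g dom_o.
have k1 := kap_le2 gd dom_o; have k2 := kap_o od; have k3 := kap_le2 dom_o vd.
rewrite kapC in k2.
have j1 := jac_gt0 g^-1%g dom_o; have j2 := jac_gt0 g xd; have j3 := jac_gt0 g dom_o.
have k4 := kap_ge0 x (act g^-1%g o).
have h1 : kap x (act g^-1%g o) * jac g^-1%g o <= 2 * jac g x.
  by rewrite -E ler_pM2r.
have h2 : co * jac g o <= 2 * jac g^-1%g o.
  by rewrite (le_trans (y := kap (act g o) o * jac g o)) ?ler_pM2r// Eo ler_pM2r.
rewrite -[_ * kap _ _ * _]mulrA -mulrA mulrCA.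
have h3 : kap x (act g^-1%g o) * (co * jac g o) <= kap x (act g^-1%g o) * (2 * jac g^-1%g o).
  exact: ler_wpM2l.
nra.
Qed.

Lemma jac_lower g : exists2 c, 0 < c & forall x, dom x -> c <= jac g x.
Proof.
have j := jac_gt0 g^-1%g dom_o; have co2 : 0 < co ^+ 2 by rewrite exprn_gt0.
exists ((4 / co ^+ 2 * jac g^-1%g o)^-1); first by rewrite invr_gt0 !mulr_gt0 ?invr_gt0.
move=> x xd; have E := jacV g xd; have gd := act_dom g xd.
have jx := jac_gt0 g xd; have jg := jac_gt0 g^-1%g gd.
rewrite -[leRHS]invrK lef_pV2 ?posrE ?invr_gt0 ?mulr_gt0 ?invr_gt0//.
have -> : (jac g x)^-1 = jac g^-1%g (act g x).
  by apply: (mulIf (lt0r_neq0 jx)); rewrite mulVf ?gt_eqF.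
exact: jac_upper.
Qed.

Lemma red_two_letters w : exists b0 b1,
  [/\ b0 <> b1, red w -> red (rcons w b0) & red w -> red (rcons w b1)].
Proof.
have [e] : exists e : L, True.
  by have /card_gt0P[e _] : (0 < #|L|)%N; [exact: leq_trans L4|exists e].
move=> _; pose f := if w is c :: w' then iv (last c w') else e.
have [b0 [b0f _ _]] := avoid3 L4 f f f.
have [b1 [b1f b10 _]] := avoid3 L4 f b0 b0.
exists b0, b1; split; first by move/esym/eqP; rewrite (negbTE b10).
- by rewrite {}/f in b0f b1f *; case: w b0f {b1f} => // c w b0f rw; exact: red_rcons.
- by rewrite {}/f in b0f b1f *; case: w b1f {b0f} => // c w b1f rw; exact: red_rcons.
Qed.

Lemma jac_comparable w b b' p p' : red (rcons w b) -> red (rcons w b') ->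
  ball b p -> ball b' p' -> cb ^+ 2 * jac (ev w) p <= 4 * jac (ev w) p'.
Proof.
have cb2 : cb <= 2.
  have [e1 [e2 [E _ _]]] := red_two_letters [::].
  have [x1 b1] := ball_ex e1; have [x2 b2] := ball_ex e2.
  exact: le_trans (kap_ball E b1 b2) (kap_le2 (ball_dom b1) (ball_dom b2)).
have cb4 : cb ^+ 2 <= 4 by have := cb_gt0; nra.
case: w => [|c w] rb rb' bp bp'.
  by rewrite /= !jac1 ?mulr1//; apply: ball_dom; eassumption.
(* A point [z] outside [ball c] is pulled back into the repelling ball of [g]; so [cb] bounds from
   below both [kap q Z] and [kap (act g q) z] for every [q] in a good ball. *)
set g := ev _; have [v [vc _ _]] := avoid3 L4 c c c.
have [z bz] := ball_ex v; have zd := ball_dom bz.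
set Z := act g^-1%g z; have Zd : dom Z := act_dom g^-1%g zd.
have bZ : ball (iv (last c w)) Z.
  apply: ball_word_inv; first by move: rb; rewrite -cats1 => /red_catl.
    exact: ball_bd bz.
  by move/ball_disj/(_ bz) => E; rewrite E eqxx in vc.
have key e q : red (rcons (c :: w) e) -> ball e q ->
    cb <= 2 * (jac g q * jac g Z) /\ cb * (jac g q * jac g Z) <= 2.
  move=> re be; have qd := ball_dom be.
  have bgq : ball c (act g q) by exact: (ball_word re be).
  have E := kap_act g qd Zd; rewrite /Z actKV in E.
  have k1 : cb <= kap (act g q) z.
    by apply: kap_ball bgq bz => cv; rewrite cv eqxx in vc.
  have k2 := kap_le2 (act_dom g qd) zd.
  have k3 : cb <= kap q Z.
    apply: kap_ball be bZ => E'; move: re; rewrite E' /= /red /= rcons_path.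
    by rewrite /step eqxx andbF.
  have k4 := kap_le2 qd Zd.
  have jj : 0 < jac g q * jac g Z by rewrite mulr_gt0 ?jac_gt0.
  rewrite -/Z in E; split; first by rewrite (le_trans k3)// -E ler_pM2r.
  by rewrite (le_trans _ k4)// -E ler_pM2r.
have [_ h1] := key _ _ rb bp; have [h2 _] := key _ _ rb' bp'.
have jZ := jac_gt0 g Zd; have jp := jac_gt0 g (ball_dom bp).
have jp' := jac_gt0 g (ball_dom bp').
rewrite -(ler_pM2r jZ); have := cb_gt0; nra.
Qed.

(* The factors of g = ev w at all points of good balls are comparable, because
   jac g p * jac g Z = kap p Z / kap (g p) (g Z) where Z stays in the repelling
   ball; and g^-1 o cannot be close to points of two different good balls. *)
Lemma distortion : exists2 K, 1 <= K & forall w b p, red (rcons w b) -> ball b p ->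
  lam (ev w) * jac (ev w) p <= K /\ 1 <= K * (lam (ev w) * jac (ev w) p).
Proof.
pose K1 := 4 / co ^+ 2 * cl; pose k2 := cb ^+ 2 / 4 * (co / 4 * (cb ^+ 2 / 8)).
have k20 : 0 < k2 by rewrite !mulr_gt0 ?invr_gt0 ?exprn_gt0.
have K10 : 0 < K1 by rewrite !mulr_gt0 ?invr_gt0 ?exprn_gt0.
have K20 : 0 < cl / k2 by rewrite divr_gt0.
exists (1 + K1 + cl / k2) => [|w b p rw bp]; first by rewrite -addrA lerDl addr_ge0 ?ltW.
have pd := ball_dom bp; have jp := jac_gt0 (ev w) pd; have lw := lam_gt0 (ev w).
have jo := jac_gt0 (ev w) dom_o.
set g := ev w in jp lw jo *; have ll := lam_le g; have lg := lam_ge g.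
split.
  have h := jac_upper g pd.
  have h1 : lam g * jac g p <= K1.
    have := ler_wpM2l (ltW lw) h; rewrite /K1.
    move/le_trans; apply; rewrite mulrCA ler_pM2l ?divr_gt0 ?exprn_gt0//.
  lra.
have rw' : red w by move: rw; rewrite -cats1 => /red_catl.
have [b0 [b1 [b01 /(_ rw') r0 /(_ rw') r1]]] := red_two_letters w.
have [p0 bp0] := ball_ex b0; have [p1 bp1] := ball_ex b1.
have vd := act_dom g^-1%g dom_o; set v := act g^-1%g o in vd.
(* Below the threshold [cb ^+ 2 / 8] the square roots in [kap_qt] are less than [cb / 2] each, and
   together less than the separation [cb] of the two balls. *)
have [e [q [re be kq]]] : exists e q, [/\ red (rcons w e), ball e q & cb ^+ 2 / 8 <= kap q v].
  have [h|h] := lerP (cb ^+ 2 / 8) (kap p0 v); first by exists b0, p0.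
  exists b1, p1; split=> //; rewrite leNgt; apply/negP => h'.
  have := kap_qt (ball_bd bp0) (ball_dom bp1) vd; apply/negP; rewrite -ltNge.
  apply: lt_le_trans (kap_ball b01 bp0 bp1).
  have s0 : Num.sqrt (2 * kap v p0) < cb / 2.
    rewrite -(ger0_norm (ltW (divr_gt0 cb_gt0 (ltr0n R 2)))) -sqrtr_sqr ltr_sqrt.
      by rewrite [kap v p0]kapC; lra.
    by rewrite exprn_gt0 ?divr_gt0.
  have s1 : Num.sqrt (2 * kap v p1) < cb / 2.
    rewrite -(ger0_norm (ltW (divr_gt0 cb_gt0 (ltr0n R 2)))) -sqrtr_sqr ltr_sqrt.
      by rewrite [kap v p1]kapC; lra.
    by rewrite exprn_gt0 ?divr_gt0.
  lra.
have h1 := jac_lower_kap g (ball_dom be).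
have h2 := jac_comparable re rw be bp.
have jq := jac_gt0 g (ball_dom be); rewrite -/g in h2.
have h3 : co / 4 * (cb ^+ 2 / 8) * jac g o <= jac g q.
  by rewrite (le_trans _ h1)// ler_pM2r// ler_pM2l ?divr_gt0.
have h4 : k2 * jac g o <= jac g p.
  rewrite /k2 -mulrA (le_trans (ler_wpM2l _ h3))//.
    by rewrite divr_ge0 ?sqr_ge0.
  by rewrite mulrAC ler_pdivrMr// [leRHS]mulrC.
have h5 : k2 * (lam g * jac g o) <= lam g * jac g p by rewrite mulrCA ler_pM2l.
have h6 : 1 <= cl / k2 * (lam g * jac g p).
  rewrite (le_trans lg)// -mulrA ler_pM2l// ler_pdivlMl//.
have lj : 0 < lam g * jac g p by rewrite mulr_gt0.
rewrite (le_trans h6)// ler_pM2r// lerDr; lra.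
Qed.

Lemma ev_lower b s t : red (rcons (s ++ t) b) -> red (rcons t b).
Proof. by rewrite rcons_cat => /red_catr. Qed.

(** Chain rule for [jac] at a point [p] of a good ball: [act (ev t) p] is in a good ball for [s], so
    by [distortion] each of the three values of [lam] is the inverse of a value of [jac] up to a
    factor [K]. *)
Lemma lam_mul : exists2 K, 1 <= K & forall s t, red (s ++ t) ->
  lam (ev (s ++ t)) <= K * (lam (ev s) * lam (ev t)) /\
  lam (ev s) * lam (ev t) <= K * lam (ev (s ++ t)).
Proof.
have [K K1 HK] := distortion; have K0 : 0 < K by lra.
exists (K ^+ 3) => [|s t rst]; first by rewrite exprn_ege1.
have [b [_ [_ /(_ rst) rb _]]] := red_two_letters (s ++ t).
have [p bp] := ball_ex b; have pd := ball_dom bp.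
have rt := ev_lower rb; have rs : red (rcons s (head b t)).
  by move: rb; rewrite rcons_cat => /red_cat_head.
have [h1 h2] := HK _ _ _ rb bp; have [h3 h4] := HK _ _ _ rt bp.
have [h5 h6] := HK _ _ _ rs (ball_word rt bp).
move: h1 h2 h3 h4 h5 h6; rewrite ev_cat jacM//.
have := lam_gt0 (ev s); have := lam_gt0 (ev t).
have := lam_gt0 (ev s * ev t)%g; have := jac_gt0 (ev t) pd.
have := jac_gt0 (ev s) (act_dom (ev t) pd).
move: (jac _ _) (jac _ _) (lam _) (lam _) (lam _) => j2 j1 l1 l2 l12.
move=> j10 j20 l120 l20 l10 h1 h2 h3 h4 h5 h6.
have j12 : 0 < j1 * j2 by rewrite mulr_gt0.
have K3 : K ^+ 3 = K * (K * K) by rewrite !exprS expr0 mulr1.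
split; rewrite -(ler_pM2r j12).
  rewrite (le_trans h1)// K3.
  have : 1 <= K * (l1 * j1) * (K * (l2 * j2)) by rewrite mulr_ege1.
  have -> : K * (K * K) * (l1 * l2) * (j1 * j2) =
    K * (K * (l1 * j1) * (K * (l2 * j2))) by ring.
  by move=> h; rewrite ler_peMr ?(ltW K0).
have -> : l1 * l2 * (j1 * j2) = (l1 * j1) * (l2 * j2) by ring.
have lj1 : 0 <= l1 * j1 by rewrite mulr_ge0 ?ltW.
have lj2 : 0 <= l2 * j2 by rewrite mulr_ge0 ?ltW.
rewrite (le_trans (ler_pM lj1 lj2 h5 h3))// K3.
have -> : K * (K * K) * l12 * (j1 * j2) = K * K * (K * (l12 * (j1 * j2))) by ring.
by rewrite ler_peMr// mulr_ge0 ?ltW.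
Qed.

Lemma kap_small g x y : dom x -> dom y ->
  kap x y <= 2 -> 0 < jac g x * jac g y ->
  kap (act g x) (act g y) <= 2 / (jac g x * jac g y).
Proof. by move=> xd yd k jj; rewrite ler_pdivlMr// kap_act. Qed.

Lemma ball_closed a x : bd x ->
  (forall e, 0 < e -> exists2 y, ball a y & kap x y < e) -> ball a x.
Proof.
move=> xbd H.
have /choice[u hu] : forall n, exists y, ball a y /\ kap x y < n.+1%:R^-1.
  by move=> n; have [|y] := H n.+1%:R^-1; [rewrite invr_gt0|exists y].
have [p bp hp] := ball_cluster (fun n => (hu n).1).
suff -> : x = p by [].
apply: kap_eq0 => //; first exact: ball_bd bp.
apply/eqP; rewrite eq_le kap_ge0 andbT leNgt; apply/negP => k0.
have [d d0 hd] := sqrt_small k0; have [n hn] := inv_small d0.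
have [m nm pm] := hp d n d0; have [bm xm] := hu m.
have := kap_qt xbd (ball_dom bp) (ball_dom bm).
apply/negP; rewrite -ltNge; apply: hd; rewrite ?kap_ge0//.
  by rewrite kapC (lt_trans xm)// hn.
by rewrite kapC.
Qed.

Lemma cylinder_closed w b x : bd x ->
  (forall e, 0 < e -> exists2 q, ball b q & kap x (act (ev w) q) < e) ->
  ball b (act (ev w)^-1%g x).
Proof.
move=> xbd H; apply: ball_closed; first exact: act_bd.
move=> e e0; have [c c0 hc] := jac_lower (ev w)^-1%g.
have [|q bq hq] := H (e * c ^+ 2); first by rewrite mulr_gt0 ?exprn_gt0.
exists q => //; have qd := act_dom (ev w) (ball_dom bq); have xd := bd_dom xbd.
have := kap_act (ev w)^-1%g xd qd; rewrite actK => E.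
rewrite -(ltr_pM2r (exprn_gt0 2 c0)) (le_lt_trans _ hq)// -E ler_wpM2l//.
by rewrite expr2 ler_pM ?hc// ltW.
Qed.

Lemma kap_act_lower K w a b p q : 1 <= K ->
  (forall w b p, red (rcons w b) -> ball b p ->
    lam (ev w) * jac (ev w) p <= K /\ 1 <= K * (lam (ev w) * jac (ev w) p)) ->
  red (rcons w a) -> red (rcons w b) -> a <> b -> ball a p -> ball b q ->
  cb * lam (ev w) ^+ 2 <= K ^+ 2 * kap (act (ev w) p) (act (ev w) q).
Proof.
move=> K1 HK ra rb ab bp bq.
have [h1 _] := HK _ _ _ ra bp; have [h2 _] := HK _ _ _ rb bq.
have k := kap_ball ab bp bq.
have := kap_act (ev w) (ball_dom bp) (ball_dom bq).
have j1 := jac_gt0 (ev w) (ball_dom bp); have j2 := jac_gt0 (ev w) (ball_dom bq).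
have l0 := lam_gt0 (ev w); have K0 : 0 < K by lra.
set k' := kap (act _ _) _ => E; rewrite -E in k.
have -> : cb * lam (ev w) ^+ 2 = lam (ev w) ^+ 2 * cb by rewrite mulrC.
apply: (le_trans (ler_wpM2l (sqr_ge0 _) k)).
have k'0 : 0 <= k' by exact: kap_ge0.
have -> : lam (ev w) ^+ 2 * (k' * (jac (ev w) p * jac (ev w) q)) =
  k' * ((lam (ev w) * jac (ev w) p) * (lam (ev w) * jac (ev w) q)) by ring.
rewrite [leRHS]mulrC ler_wpM2l// expr2.
by rewrite ler_pM ?mulr_ge0 ?(ltW l0) ?(ltW j1) ?(ltW j2).
Qed.

(* Otherwise the points branching off om after n letters would be uniformly
   separated in a compact ball. *)
Lemma lam_decay om e : rword om -> 0 < e ->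
  exists2 n, (0 < n)%N & lam (ev (pre om n)) < e.
Proof.
move=> rom e0; apply: contrapT => none.
have big n : (0 < n)%N -> e <= lam (ev (pre om n)).
  by move=> n0; rewrite leNgt; apply/negP => le; apply: none; exists n.
have [K K1 HK] := distortion; have K0 : 0 < K by lra.
have /choice[f hf] : forall n, exists vq : L * X, [/\ vq.1 != om n.+1,
    ball vq.1 vq.2 & red (rcons (pre om n.+1) vq.1)].
  move=> n; have [v [v1 v2 _]] := avoid3 L4 (om n.+1) (iv (om n)) (iv (om n)).
  have [q bq] := ball_ex v; exists (v, q); split=> //.
  have := red_pre n.+1 rom; rewrite pre_rcons.
  case: (pre om n) => [|c w] r /=.
    by rewrite andbT.
  by rewrite /red /= rcons_path last_rcons /step v2 andbT.
pose x n := act (ev (pre om n.+1)) (f n).2.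
have tail n m : (n < m)%N -> ball (om n.+1) (act (ev (pre (shift n.+1 om) (m - n))) (f m).2).
  move=> nm; have [_ bm rm] := hf m.
  have E : pre om m.+1 = pre om n.+1 ++ pre (shift n.+1 om) (m - n).
    by rewrite -pre_add addSn subnKC// ltnW.
  have r' : red (rcons (pre (shift n.+1 om) (m - n)) (f m).1).
    by move: rm; rewrite E => /ev_lower.
  have := ball_word r' bm; have : (0 < m - n)%N by rewrite subn_gt0.
  by case: (m - n)%N => // k _; rewrite /pre /= /shift addn0.
have xE n m : (n < m)%N -> x m = act (ev (pre om n.+1))
    (act (ev (pre (shift n.+1 om) (m - n))) (f m).2).
  move=> nm; rewrite -actM -ev_cat -pre_add addSn subnKC//; exact: ltnW.
have x0 n : ball (om 0%N) (x n).
  have [_ bn rn] := hf n; have := ball_word rn bn.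
  by rewrite /pre /=.
have [p bp hp] := ball_cluster x0.
have c0 : 0 < cb * e ^+ 2 / K ^+ 2 by rewrite divr_gt0 ?mulr_gt0 ?exprn_gt0.
have [d d0 hd] := sqrt_small c0.
have [n _ pn] := hp d 0%N d0; have [m nm pm] := hp d n.+1 d0.
have := kap_qt (ball_bd (x0 n)) (ball_dom (x0 m)) (ball_dom bp).
have [vn bn rn] := hf n.
have rn' : red (rcons (pre om n.+1) (om n.+1)) by rewrite -pre_rcons red_pre.
have := kap_act_lower K1 HK rn rn' (fun E => negP vn (introT eqP E)) bn (tail n m nm).
rewrite -/(x n) -xE// => h1 h2; have h3 : cb * e ^+ 2 / K ^+ 2 <= kap (x n) (x m).
  rewrite ler_pdivrMr ?exprn_gt0// [leRHS]mulrC (le_trans _ h1)//.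
  by rewrite ler_pM2l// lerXn2r ?nnegrE ?(ltW e0) ?(ltW (lam_gt0 _)) ?big.
have := le_trans h3 h2; apply/negP; rewrite -ltNge; apply: hd => //.
Qed.

(** A cluster point of the points [x n] lies in every cylinder of [om], because the cylinders are
    nested and closed. *)
Lemma limit_point_word om : rword om ->
  exists p, forall n, ball (om n) (act (ev (pre om n))^-1%g p).
Proof.
move=> rom; have /choice[q hq] := fun n => ball_ex (om n).
pose x n := act (ev (pre om n)) (q n).
have tail n k : ball (om n) (act (ev (pre (shift n om) k)) (q (n + k)%N)).
  have r : red (rcons (pre (shift n om) k) (om (n + k)%N)).
    by rewrite -[om _]/(shift n om k) -pre_rcons red_pre//; exact: rword_shift.
  by have := ball_word r (hq _); case: k {r} => [|k] //=; rewrite ?addn0// /shift addn0.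
have x0 n : ball (om 0%N) (x n) by have := tail 0%N n; rewrite add0n.
have [p bp hp] := ball_cluster x0.
exists p => n; apply: cylinder_closed; first exact: ball_bd bp.
move=> e e0; have [m nm pm] := hp e n e0.
exists (act (ev (pre (shift n om) (m - n))) (q m)).
  by have := tail n (m - n)%N; rewrite subnKC.
by rewrite -actM -ev_cat -pre_add subnKC.
Qed.

Definition limset : set X :=
  [set p | bd p /\ forall e, 0 < e -> exists2 w, red w & kap p (act (ev w) o) < e].

Lemma limit_point_limset om p : rword om ->
  (forall n, ball (om n) (act (ev (pre om n))^-1%g p)) -> limset p.
Proof.
move=> rom hp; have [K K1 HK] := distortion; have K0 : 0 < K by lra.
split; first by have := ball_bd (hp 0%N); rewrite /= invg1 act1.
(* By [kap_small] the orbit point is within [2 / (jac q * jac o)] of [p], and each of the two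
   factors is at least of order the inverse of [lam]; so the bound is [c * lam ^+ 2]. *)
move=> e e0; pose c := 2 * K * cl; have c0 : 0 < c by rewrite !mulr_gt0.
have [|n _ ln] := @lam_decay om (Num.sqrt (e / c)) rom.
  by rewrite sqrtr_gt0 divr_gt0.
exists (pre om n); first exact: red_pre.
have rn : red (rcons (pre om n) (om n)) by rewrite -pre_rcons red_pre.
set w := pre om n in ln rn *; set q := act (ev w)^-1%g p.
have bq : ball (om n) q by exact: hp.
have [_ h1] := HK _ _ _ rn bq; have h2 := lam_ge (ev w).
have j1 := jac_gt0 (ev w) (ball_dom bq); have j2 := jac_gt0 (ev w) dom_o.
have l0 := lam_gt0 (ev w).
have := kap_small (ball_dom bq) dom_o (kap_le2 (ball_dom bq) dom_o) (mulr_gt0 j1 j2).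
rewrite /q actKV => /le_lt_trans; apply.
rewrite ltr_pdivrMr ?mulr_gt0//.
have l2 : lam (ev w) ^+ 2 < e / c.
  rewrite -[ltRHS]sqr_sqrtr ?divr_ge0 ?(ltW e0) ?(ltW c0)//.
  by rewrite ltr_pXn2r ?nnegrE ?sqrtr_ge0 ?(ltW l0).
have : 1 <= K * (lam (ev w) * jac (ev w) q) * (cl * (lam (ev w) * jac (ev w) o)).
  by rewrite mulr_ege1.
have -> : K * (lam (ev w) * jac (ev w) q) * (cl * (lam (ev w) * jac (ev w) o)) =
  lam (ev w) ^+ 2 * (K * cl * (jac (ev w) q * jac (ev w) o)) by ring.
have jj : 0 < K * cl * (jac (ev w) q * jac (ev w) o) by rewrite !mulr_gt0.
move=> h; have l3 : lam (ev w) ^+ 2 * (K * cl * (jac (ev w) q * jac (ev w) o)) <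
  e / c * (K * cl * (jac (ev w) q * jac (ev w) o)) by rewrite ltr_pM2r.
have := le_lt_trans h l3.
have -> : e / c * (K * cl * (jac (ev w) q * jac (ev w) o)) =
  e * (jac (ev w) q * jac (ev w) o) / 2 by rewrite /c; field; rewrite !gt_eqF.
by rewrite ltr_pdivlMr// mul1r.
Qed.

Lemma lam_words_bound n : exists2 e, 0 < e & forall w, (size w <= n)%N -> e <= lam (ev w).
Proof.
elim: n => [|n [e e0 he]].
  by exists (lam 1%g) => // w; rewrite leqn0 size_eq0 => /eqP ->.
have [c c0 hc] := @positive_lower_bound R {: n.+1.-tuple L} (fun u => lam (ev u))
  (fun u => lam_gt0 _).
exists (Num.min e c) => [|w]; first by rewrite lt_min e0 c0.
rewrite leq_eqVlt => /orP[/eqP sw|/he h]; rewrite ge_min; last by rewrite h.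
by have := hc (tcast sw (in_tuple w)); rewrite val_tcast => ->; rewrite orbT.
Qed.

(** Otherwise [p] keeps a distance [e] from the finitely many cylinders of length [n], all closed.
    An orbit point [act g o] close to [p] has a small [lam g], hence a long word, and is then close
    to some [act g q] inside one of these cylinders. *)
Lemma limset_cylinder p n : limset p ->
  exists w b, [/\ size w = n, red (rcons w b) & ball b (act (ev w)^-1%g p)].
Proof.
move=> [pbd hp]; apply: contrapT => none.
have [K K1 HK] := distortion; have K0 : 0 < K by lra.
have /choice[f hf] (i : n.-tuple L * L) : exists e, 0 < e /\
    (red (rcons i.1 i.2) -> forall q, ball i.2 q -> e <= kap p (act (ev i.1) q)).
  apply: contrapT => /forallNP h; apply: none; exists i.1, i.2.
  have ri : red (rcons i.1 i.2).
    apply: contrapT => nr; apply: (h 1); split=> // r; by case: nr.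
  split=> //; first exact: size_tuple.
  apply: cylinder_closed => // e e0; apply: contrapT => nq; apply: (h e); split=> // _ q bq.
  by rewrite leNgt; apply/negP => lq; apply: nq; exists q.
have [e e0 he] := positive_lower_bound (fun i => (hf i).1).
have [d d0 hd] := sqrt_small e0.
have [l l0 hl] := lam_words_bound n.
(* The constant of [cF * lam g ^+ 2 <= kap p (act g o)], obtained from [kap_act] at [act g^-1 p] and
   [o] with [jac_upper] and [lam_le]. *)
pose cF := co ^+ 3 / (4 * cl ^+ 2).
have cF0 : 0 < cF by rewrite divr_gt0 ?mulr_gt0 ?exprn_gt0.
pose M := 2 * K * cl / cF; have M0 : 0 < M by rewrite divr_gt0// !mulr_gt0.
pose dl := Num.min d (Num.min (d / M) (cF * l ^+ 2)).
have dl0 : 0 < dl by rewrite !lt_min d0 divr_gt0// mulr_gt0// exprn_gt0.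
have [w rw] := hp dl dl0; rewrite !lt_min => /and3P[kd kM kl].
have pd := bd_dom pbd; set g := ev w in kd kM kl.
have gl := lam_gt0 g; have jo := jac_gt0 g dom_o; have ll := lam_le g; have lg := lam_ge g.
have vd := act_dom g^-1%g pd.
have kF : cF * lam g ^+ 2 <= kap p (act g o).
  have := kap_act g vd dom_o; rewrite actKV => E.
  have := kap_o vd; rewrite kapC -E => h.
  have ju := jac_upper g vd; have jv := jac_gt0 g vd.
  rewrite /cF mulrAC ler_pdivrMr ?mulr_gt0 ?exprn_gt0//.
  have k0 := kap_ge0 p (act g o); set k := kap p (act g o) in h k0 *.
  have h1 : co <= k * (4 / co ^+ 2 * jac g o * jac g o).
    by rewrite (le_trans h)// ler_wpM2l// ler_wpM2r// ltW.
  have h2 : co ^+ 3 <= k * (4 * (jac g o) ^+ 2).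
    have := ler_wpM2r (ltW (exprn_gt0 2 co_gt0)) h1; rewrite -exprS.
    move/le_trans; apply; rewrite le_eqVlt; apply/orP; left; apply/eqP; field.
    by rewrite gt_eqF.
  apply: (le_trans (ler_wpM2r (sqr_ge0 _) h2)).
  rewrite -mulrA ler_wpM2l// -mulrA ler_pM2l// -exprMn mulrC lerXn2r ?nnegrE//.
  - by rewrite mulr_ge0 ?(ltW gl) ?(ltW jo).
  - exact: ltW.
have nw : (n < size w)%N.
  rewrite ltnNge; apply/negP => /hl; apply/negP; rewrite -ltNge -/g.
  have := le_lt_trans kF kl; rewrite ltr_pM2l// ltr_pXn2r ?nnegrE//; exact: ltW.
have [b [_ [_ /(_ rw) rb _]]] := red_two_letters w.
have [q bq] := ball_ex b; have qd := ball_dom bq; have jq := jac_gt0 g qd.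
have [_ h1] := HK _ _ _ rb bq; rewrite -/g in h1.
have kq : kap (act g o) (act g q) < d.
  have := kap_small dom_o qd (kap_le2 dom_o qd) (mulr_gt0 jo jq).
  move/le_lt_trans; apply; rewrite ltr_pdivrMr ?mulr_gt0//.
  have h2 : cF * lam g ^+ 2 * M < d by rewrite -ltr_pdivlMr// (le_lt_trans kF).
  have h3 : 1 <= cl * (lam g * jac g o) * (K * (lam g * jac g q)) by rewrite mulr_ege1.
  have h4 : lam g ^+ 2 * (2 * K * cl) < d.
    suff <- : cF * lam g ^+ 2 * M = lam g ^+ 2 * (2 * K * cl) by [].
    by rewrite /M; field; rewrite gt_eqF.
  have jj : 0 < jac g o * jac g q by rewrite mulr_gt0.
  have := h4; rewrite -(ltr_pM2r jj); apply: le_lt_trans.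
  have -> : lam g ^+ 2 * (2 * K * cl) * (jac g o * jac g q) =
    2 * (cl * (lam g * jac g o) * (K * (lam g * jac g q))) by ring.
  by rewrite ler_peMr.
have gd := act_dom g dom_o; have gqd := act_dom g qd.
have := kap_qt pbd gqd gd; rewrite [kap _ p]kapC => h.
have st : size (take n w) == n by rewrite size_takel// ltnW.
have rt : red (rcons (drop n w) b) by move: rb; rewrite -{1}(cat_take_drop n w) => /ev_lower.
have rh : red (rcons (take n w) (head b (drop n w))).
  by move: rb; rewrite -{1}(cat_take_drop n w) rcons_cat => /red_cat_head.
have [_ /(_ rh _ (ball_word rt bq))] := hf (Tuple st, head b (drop n w)).
rewrite /= -actM -ev_cat cat_take_drop -/g => h'.
have := le_trans (he (Tuple st, head b (drop n w))) (le_trans h' h).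
apply/negP; rewrite -ltNge; apply: hd => //.
Qed.

(** In the bound [crs_le] the numerator is at most of order [lam ^+ 2] and the denominator at least
    [m ^+ 2]. *)
Lemma crs_upper : exists2 C, 0 < C & forall w b p q x m, red (rcons w b) ->
  ball b p -> ball b q -> bd x -> x <> act (ev w) p -> x <> act (ev w) q -> 0 < m ->
  m <= kap x (act (ev w) p) -> m <= kap x (act (ev w) q) ->
  crs x (act (ev w) p) (act (ev w) q) <= (C / m * lam (ev w)) ^+ 2.
Proof.
have [K K1 HK] := distortion; have K0 : 0 < K by lra.
exists (2 * K); first by rewrite mulr_gt0.
move=> w b p q x m rw bp bq xbd xp xq m0 mp mq.
have [_ h1] := HK _ _ _ rw bp; have [_ h2] := HK _ _ _ rw bq.
have pd := ball_dom bp; have qd := ball_dom bq; set g := ev w in h1 h2 mp mq xp xq *.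
have jp := jac_gt0 g pd; have jq := jac_gt0 g qd; have l0 := lam_gt0 g.
have jj : 0 < jac g p * jac g q by rewrite mulr_gt0.
have := kap_small pd qd (kap_le2 pd qd) jj; rewrite ler_pdivlMr// => k.
have := crs_le xbd (act_bd g (ball_bd bp)) (act_bd g (ball_bd bq)) xp xq.
move/le_trans; apply; rewrite [kap _ x]kapC.
have kp : 0 < kap x (act g p) * kap x (act g q) by rewrite mulr_gt0 ?(lt_le_trans m0).
rewrite mulrA ler_pdivrMr//.
have h3 : m ^+ 2 <= kap x (act g p) * kap x (act g q) by rewrite expr2 ler_pM ?(ltW m0).
have h4 : 1 <= K * (lam g * jac g p) * (K * (lam g * jac g q)) by rewrite mulr_ege1.
have k0 := kap_ge0 (act g p) (act g q).
have h5 : kap (act g p) (act g q) <= 2 * K ^+ 2 * lam g ^+ 2.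
  rewrite -(ler_pM2r jj) (le_trans k)//.
  have -> : 2 * K ^+ 2 * lam g ^+ 2 * (jac g p * jac g q) =
    2 * (K * (lam g * jac g p) * (K * (lam g * jac g q))) by ring.
  by rewrite ler_peMr.
rewrite (le_trans (ler_wpM2l _ h5))//.
rewrite (le_trans _ (ler_wpM2l (sqr_ge0 _) h3))//.
rewrite le_eqVlt; apply/orP; left; apply/eqP; field.
by rewrite gt_eqF.
Qed.

(** Pull back by [g]: as [x] is outside [ball c], the point [x'] falls into the repelling ball, so
    [x'], [p] and [q] lie in three distinct balls and [crs_ball] applies. The scaling factor
    [jac g x'] is at least of order [lam g], by [kap_act] at [x'] and [p]. *)
Lemma crs_lower : exists2 C, 0 < C & forall c w a b p q x,
  red (rcons (c :: w) a) -> red (rcons (c :: w) b) -> a <> b ->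
  ball a p -> ball b q -> bd x -> ~ ball c x ->
  (C * lam (ev (c :: w))) ^+ 2 <=
    crs x (act (ev (c :: w)) p) (act (ev (c :: w)) q).
Proof.
have [K K1 HK] := distortion; have K0 : 0 < K by lra.
have C0 : 0 < cb / (2 * K) * Num.sqrt ct.
  by rewrite !mulr_gt0 ?invr_gt0 ?sqrtr_gt0 ?mulr_gt0.
exists (cb / (2 * K) * Num.sqrt ct) => // c w a b p q x ra rb ab bp bq xbd xN.
have [h1 _] := HK _ _ _ ra bp.
set g := ev _ in h1 *; have l0 := lam_gt0 g; have pd := ball_dom bp.
set x' := act g^-1%g x; have x'bd : bd x' by exact: act_bd.
have bx' : ball (iv (last c w)) x'.
  apply: ball_word_inv => //.
  by move: ra; rewrite -cats1 => /red_catl.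
have stp e : red (rcons (c :: w) e) -> iv (last c w) <> e.
  by move=> re E; move: re; rewrite -E /red /= rcons_path /step eqxx andbF.
have k1 := kap_ball (stp _ ra) bx' bp.
have c1 := crs_ball (stp _ ra) (stp _ rb) ab bx' bp bq.
have x'd := bd_dom x'bd.
have E := kap_act g x'd pd; have Ec := crs_act g x'bd (ball_bd bp) (ball_bd bq).
have xE : act g x' = x by exact: actKV.
rewrite xE in E Ec; rewrite Ec.
have k2 := kap_le2 (bd_dom xbd) (act_dom g pd).
have jx := jac_gt0 g x'd; have jp := jac_gt0 g pd.
have h2 : cb / (2 * K) * lam g <= jac g x'.
  rewrite mulrAC ler_pdivrMr ?mulr_gt0//.
  have h3 : cb <= 2 * (jac g x' * jac g p).
    by rewrite (le_trans k1)// -E ler_pM2r// mulr_gt0.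
  rewrite (le_trans (ler_wpM2r (ltW l0) h3))//.
  have -> : 2 * (jac g x' * jac g p) * lam g = jac g x' * (2 * (lam g * jac g p)) by ring.
  by rewrite ler_pM2l// ler_pM2l.
have -> : (cb / (2 * K) * Num.sqrt ct * lam g) ^+ 2 = (cb / (2 * K) * lam g) ^+ 2 * ct.
  by rewrite mulrAC exprMn sqr_sqrtr// ltW.
have cl0 : 0 <= cb / (2 * K) * lam g.
  by rewrite mulr_ge0 ?(ltW l0)// divr_ge0 ?(ltW cb_gt0)// mulr_ge0// ltW.
by apply: ler_pM => //; rewrite ?sqr_ge0 ?(ltW ct_gt0) ?lerXn2r ?nnegrE ?(ltW jx).
Qed.

(** Freeness by ping-pong: take a point in a ball other than [ball a] and the repelling balls of the
    two words. One word sends it into [ball a]; the other sends it into a different ball or, if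
    empty, leaves it where it is. *)
Lemma ev_inj s t : red s -> red t -> ev s = ev t -> s = t.
Proof.
have head_neq a w t' : red (a :: w) -> red t' -> ohead t' != Some a ->
    ev (a :: w) <> ev t'.
  move=> ra rt at' E; pose l2 := if t' is c :: t'' then iv (last c t'') else iv (last a w).
  have [v [v1 v2 v3]] := avoid3 L4 a (iv (last a w)) l2; have [p bp] := ball_ex v.
  have pN e : v != e -> ~ ball e p by move=> /eqP ve /(ball_disj bp).
  have b1 := ball_word_bd ra (ball_bd bp) (pN _ v2); rewrite E in b1.
  case: t' rt at' @l2 v3 {E} b1 => [|c t''] rt at' l2 v3 b1.
    by move: b1; rewrite /= act1; exact: pN.
  have b2 := ball_word_bd rt (ball_bd bp) (pN _ v3).
  by have := ball_disj b2 b1; move/eqP: at' => /[swap] ->.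
elim: s t => [|a s IH] [|b t] // rs rt E.
- by case: (head_neq b t [::] rt isT isT (esym E)).
- by case: (head_neq a s [::] rs isT isT E).
have [ab|ab] := eqVneq b a; last first.
  by case: (head_neq a s (b :: t) rs rt _ E); apply: contraNneq ab => -[->].
rewrite ab in E rt *; congr (_ :: _); apply: IH.
- exact: (@red_catr _ _ [:: a]).
- exact: (@red_catr _ _ [:: a]).
- exact: mulgI E.
Qed.

Lemma ev_mul s w : red w -> exists2 w', red w' & ev w' = (ev s * ev w)%g.
Proof.
move=> rw; elim: s => [|a s [w' rw' E]]; first by exists w; rewrite //= mul1g.
rewrite /= -mulgA -E; case: w' rw' {E} => [_|c w' rw']; first by exists [:: a].
have [ca|ca] := eqVneq c (iv a).
  exists w'; first exact: (@red_catr _ _ [:: c]).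
  by rewrite /= ca gen_iv mulgA mulgV mul1g.
by exists (a :: c :: w') => //; rewrite /red /= in rw' *; rewrite /step ca.
Qed.

(** * Weights of words and nullity in dimension [s] *)

Variable s : R.
Hypothesis s_gt0 : 0 < s.

Definition weight w : R := lam (ev w) `^ s.

Lemma weight_ge0 w : 0 <= weight w. Proof. exact: powR_ge0. Qed.

Definition level_sum n : R := \sum_(w <- words iv n) weight w.

Lemma level_sum_upto n :
  \sum_(w <- words_upto iv n) weight w = \sum_(k < n.+1) level_sum k.
Proof.
elim: n => [|n IH]; first by rewrite big_ord1.
by rewrite /= big_cat IH [RHS]big_ord_recr.
Qed.

(** Hausdorff nullity of the projection of [A] from [x], with [crs x] as squared distance. The mesh
    is not restricted: as [s] is positive, a small sum already makes every [D i] small. *)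
Definition null_cover (A : set X) x : Prop := forall e, 0 < e ->
  exists (U : nat -> set X) (D : nat -> R),
    [/\ forall y, A y -> exists i, U i y,
        forall i, 0 <= D i,
        forall i y z, A y -> A z -> U i y -> U i z -> crs x y z <= D i ^+ 2
      & forall n, \sum_(i < n) D i `^ s <= e].

Lemma small_level S e :
  (forall l, uniq l -> all red l -> \sum_(w <- l) weight w <= S) ->
  0 < e -> exists n, level_sum n <= e.
Proof.
move=> HS e0; apply: contrapT => /forallNP none.
have := HS _ (words_upto_uniq iv (Num.bound (S / e))).
rewrite level_sum_upto => h.
have S0 : 0 <= S by have := HS [::] isT isT; rewrite big_nil.
have := archi_boundP (divr_ge0 S0 (ltW e0)); rewrite ltr_pdivrMr//.
apply/negP; rewrite -leNgt; apply: le_trans (h _).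
  rewrite (@le_trans _ _ (\sum_(k < (Num.bound (S / e)).+1) e))//.
    by rewrite sumr_const card_ord -[leRHS]mulr_natl ler_pM2r// ler_nat.
  by apply: ler_sum => k _; rewrite ltW// ltNge; apply/negP; exact: none.
by apply/allP => w; rewrite mem_words_upto => /andP[].
Qed.

(** The bound [m] keeps the factor [C / m] of [crs_upper] uniform over the cylinders; a countable
    union removes it later. *)
Lemma null_of_sum S x m :
  (forall l, uniq l -> all red l -> \sum_(w <- l) weight w <= S) ->
  bd x -> 0 < m -> null_cover [set y | limset y /\ x <> y /\ m <= kap x y] x.
Proof.
move=> HS xbd m0 e e0; have [C C0 HC] := crs_upper.
have Cm : 0 < C / m by rewrite divr_gt0.
(* Every word of the level enters the cover once for each next letter, whence the factor [#|L|]. *)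
have N0 : 0 < #|L|%:R * (C / m) `^ s.
  by rewrite mulr_gt0 ?powR_gt0// ltr0n (leq_trans _ L4).
have [n hn] := small_level HS (divr_gt0 e0 N0).
pose l := [seq (w, b) | w <- words iv n, b <- enum L].
pose G (v : seq L * L) := C / m * lam (ev v.1).
have G0 v : 0 <= G v by rewrite mulr_ge0 ?(ltW Cm) ?(ltW (lam_gt0 _)).
pose D i := odflt 0 (omap G (onth l i)).
exists (fun i => [set y | exists v, [/\ onth l i = Some v,
  red (rcons v.1 v.2) & ball v.2 (act (ev v.1)^-1%g y)]]), D; split.
- move=> y [ly _]; have [w [b [sw rw bw]]] := limset_cylinder n ly.
  have vl : (w, b) \in l.
    apply: allpairs_f; last by rewrite mem_enum.
    rewrite mem_words sw eqxx andbT; by move: rw; rewrite -cats1 => /red_catl.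
  exists (index (w, b) l), (w, b); split=> //.
  by rewrite onthE (nth_map (w, b)) ?index_mem// nth_index.
- by move=> i; rewrite /D; case: onth => //= v.
- move=> i y z [ly [xy my]] [lz [xz mz]] [v [vi rv bv]] [v' [v'i _ bv']].
  move: v'i; rewrite vi => -[E]; rewrite -{}E {v'} in bv'.
  have := HC _ _ _ _ x m rv bv bv' xbd; rewrite !actKV /D vi; exact.
- move=> N; have E v : G v `^ s = (C / m) `^ s * weight v.1.
    by rewrite powRM ?(ltW Cm) ?(ltW (lam_gt0 _)).
  rewrite (eq_bigr (fun i : 'I_N => odflt 0 (omap (fun v => G v `^ s) (onth l i)))).
    rewrite (le_trans (sum_onth _ _ _))//; first by move=> v; exact: powR_ge0.
    rewrite big_allpairs /=.
    under eq_bigr do under eq_bigr do rewrite E /=.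
    under eq_bigr do rewrite big_enum sumr_const -mulr_natl.
    rewrite -mulr_sumr -mulr_sumr mulrA -ler_pdivlMl// mulrC.
    exact: hn.
  by move=> i _; rewrite /D; case: onth => //=; rewrite powR0// gt_eqF.
Qed.

Lemma lam_decay_weight om e : rword om -> 0 < e ->
  exists2 n, (0 < n)%N & weight (pre om n) <= e.
Proof.
move=> rom e0; have [|n n0 ln] := @lam_decay om (e `^ s^-1) rom; first exact: powR_gt0.
exists n => //; rewrite /weight (le_trans (powR_mono (ltW s_gt0) _ (ltW ln)))//.
  exact: ltW.
by rewrite -powRrM mulVf ?gt_eqF// powRr1// ltW.
Qed.

(* The set U of words is contained in the cylinder of its longest common prefix
   v; when v is finite, two words of U branch off at v and the size of U is
   bounded below by the size of that cylinder. *)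
Lemma common_prefix (lp : (nat -> L) -> X) x a (U : set X) D e :
  (forall om, rword om -> forall n, ball (om n) (act (ev (pre om n))^-1%g (lp om))) ->
  0 < e -> bd x -> ~ ball a x -> 0 <= D ->
  (forall y z, limset y -> limset z -> x <> y -> x <> z -> U y -> U z ->
     crs x y z <= D ^+ 2) ->
  forall C, 0 < C -> (forall c w a b p q x,
    red (rcons (c :: w) a) -> red (rcons (c :: w) b) -> a <> b ->
    ball a p -> ball b q -> bd x -> ~ ball c x ->
    (C * lam (ev (c :: w))) ^+ 2 <=
      crs x (act (ev (c :: w)) p) (act (ev (c :: w)) q)) ->
  exists ov : option (seq L),
    (forall om, rword om -> om 0%N = a -> U (lp om) ->
       exists2 v, ov = Some v & pre om (size v) = v) /\
    (forall v, ov = Some v -> [/\ red v, exists v', v = a :: v'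
       & weight v <= C^-1 `^ s * D `^ s + e]).
Proof.
move=> hlp e0 xbd xN D0 hU C C0 HC.
pose Om := [set om | [/\ rword om, om 0%N = a & U (lp om)]].
have [[om Omom]|none] := pselect (exists om, Om om); last first.
  by exists None; split=> // om r oma Uom; case: none; exists om.
have [rom oma Uom] := Omom.
have lpx om' : rword om' -> om' 0%N = a -> limset (lp om') /\ x <> lp om'.
  move=> r E; split; first exact: limit_point_limset r (hlp _ r).
  by have := hlp _ r 0%N; rewrite /= invg1 act1 E => b xE; apply: xN; rewrite xE.
have DC0 : 0 <= C^-1 `^ s * D `^ s by rewrite mulr_ge0 ?powR_ge0.
pose differ n := `[< exists2 om', Om om' & pre om' n <> pre om n >].
have [same|[n0 dn0]] : (forall n, ~~ differ n) \/ exists n, differ n.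
  by apply: contrapT => /not_orP[/existsNP[n /negP/negPn h] h']; apply: h'; exists n.
(* All words of [Om] share every prefix, so a prefix long enough to weigh at most [e] will do. *)
- have [n n0 wn] := lam_decay_weight rom e0.
  exists (Some (pre om n)); split=> [om' r' E' U'|v [<-]].
    exists (pre om n) => //; rewrite size_pre; apply: contrapT => h.
    by have /negP := same n; apply; apply/asboolP; exists om'.
  split; first exact: red_pre.
    by case: n n0 {wn} => // n _; exists (behead (pre om n.+1)); rewrite /= -oma.
  by rewrite (le_trans wn)// lerDr.
(* The words agree up to length 1, since all start with [a]. The first disagreement is therefore at
   a length [m.+2], and the common prefix of length [m.+1] is not empty. *)
- case: (ex_minnP (ex_intro (fun n => differ n) n0 dn0)) => -[|[|m]].
  + by move=> /asboolP[om' _ []].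
  + by move=> /asboolP[om' [_ oma' _] []]; rewrite /pre /mkseq /= oma oma'.
  move=> /asboolP[om' [r' oma' U'] ne] mn.
  have eq om'' : Om om'' -> pre om'' m.+1 = pre om m.+1.
    move=> O''; apply: contrapT => h.
    by have := mn m.+1 (asboolT (ex_intro2 _ _ _ O'' h)); rewrite ltnn.
  have preE : pre om m.+1 = a :: behead (pre om m.+1) by rewrite /= -oma.
  exists (Some (pre om m.+1)); split=> [om'' r'' E'' U''|v [<-]].
    by exists (pre om m.+1) => //; rewrite size_pre; exact: eq.
  split; first exact: red_pre.
    by exists (behead (pre om m.+1)).
  have E' : pre om' m.+1 = pre om m.+1 by exact: eq.
  have omn : om m.+1 <> om' m.+1.
    by move=> h; apply: ne; rewrite pre_rcons E' -h -pre_rcons.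
  have r1 : red (rcons (pre om m.+1) (om m.+1)) by rewrite -pre_rcons red_pre.
  have r2 : red (rcons (pre om m.+1) (om' m.+1)) by rewrite -E' -pre_rcons red_pre.
  have b1 := hlp _ rom m.+1; have b2 := hlp _ r' m.+1; rewrite E' in b2.
  rewrite preE in r1 r2 b1 b2.
  have := HC _ _ _ _ _ _ x r1 r2 omn b1 b2 xbd xN; rewrite !actKV -preE => h.
  have [l1 x1] := lpx _ rom oma; have [l2 x2] := lpx _ r' oma'.
  have := le_trans h (hU _ _ l1 l2 x1 x2 Uom U').
  have lw := lam_gt0 (ev (pre om m.+1)).
  rewrite ler_pXn2r ?nnegrE ?mulr_ge0 ?(ltW C0) ?(ltW lw)// => CD.
  have h2 : weight (pre om m.+1) <= (C^-1 * D) `^ s.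
    by apply: powR_mono; rewrite ?(ltW s_gt0) ?(ltW lw)// ler_pdivlMl.
  rewrite (le_trans h2)// powRM ?invr_ge0 ?(ltW C0)// lerDl ltW//.
Qed.

(** Each set of a cheap cover is replaced by the prefix from [common_prefix]. Half of [e] pays for
    the cover, the other half is shared among the sets as their error terms. By [koenig] the
    prefixes occur within a bounded length, so finitely many sets suffice. *)
Lemma prefix_family x a e : bd x -> ~ ball a x -> 0 < e ->
  null_cover [set y | limset y /\ x <> y] x ->
  exists N (F : seq (seq L)),
    [/\ forall v, v \in F -> red v /\ v != [::],
        \sum_(v <- F) weight v <= e
      & forall w, red (a :: w) -> (N <= size w)%N ->
          exists2 v, v \in F & prefix v (a :: w)].
Proof.
move=> xbd xN e0 hnull; have [C C0 HC] := crs_lower.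
(* The point [o] is a default value for sequences that are not reduced. *)
have /choice[lp hlp] om : exists p, rword om ->
    forall n, ball (om n) (act (ev (pre om n))^-1%g p).
  have [r|nr] := pselect (rword om); last by exists o.
  by have [p hp] := limit_point_word r; exists p.
have Cs0 : 0 < C^-1 `^ s by rewrite powR_gt0 ?invr_gt0.
have [|U [D [Ucov D0 UD Dsum]]] := hnull (e / 2 / C^-1 `^ s); first by rewrite !divr_gt0.
have e2 i : 0 < e / 2 / 2 ^+ i.+1 by rewrite !divr_gt0// exprn_gt0.
have /choice[ov hov] i := common_prefix hlp (e2 i) xbd xN (D0 i)
  (fun y z ly lz xy xz => UD i y z (conj ly xy) (conj lz xz)) C0 HC.
have lpx om : rword om -> om 0%N = a -> limset (lp om) /\ x <> lp om.
  move=> r E; split; first exact: limit_point_limset r (hlp _ r).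
  by have := hlp _ r 0%N; rewrite /= invg1 act1 E => b xE; apply: xN; rewrite xE.
have [N hN] : exists N, forall w, size w = N -> red (a :: w) ->
    exists2 k, (k <= N)%N & exists i, ov i = Some (a :: take k w).
  apply: (@koenig _ iv a (fun v => exists i, ov i = Some v)) => om r oma.
  have [i Ui] := Ucov _ (lpx om r oma).
  have [h1 h2] := hov i; have [v vi vE] := h1 om r oma Ui.
  have [_ [v' v'E] _] := h2 v vi.
  by exists (size v'), i; rewrite vi -vE v'E.
have /choice[g hg] (u : N.-tuple L) : exists i, red (a :: u) ->
    exists2 k, (k <= N)%N & ov i = Some (a :: take k u).
  have [r|nr] := boolP (red (a :: u)); last by exists 0%N.
  by have [k kN [i hi]] := hN u (size_tuple u) r; exists i => _; exists k.
pose M := (\max_u g u).+1.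
exists N, (pmap ov (iota 0 M)); split.
- move=> v; rewrite mem_pmap => /mapP[i _ vi].
  by have [_ h] := hov i; have [rv [v' vE] _] := h v (esym vi); split; rewrite ?vE// -vE.
- rewrite sum_pmap -[iota 0 M]/(index_iota 0 M) big_mkord.
  rewrite (@le_trans _ _ (\sum_(i < M) (C^-1 `^ s * D i `^ s + e / 2 / 2 ^+ i.+1)))//.
    apply: ler_sum => i _; have [_ h] := hov i.
    case E : (ov i) => [v|] /=; first by have [_ _] := h v E.
    by apply: addr_ge0; [rewrite mulr_ge0 ?powR_ge0|exact: ltW (e2 i)].
  rewrite big_split /= -mulr_sumr [leRHS]splitr; apply: lerD.
    by rewrite -ler_pdivlMl// mulrC; exact: Dsum.
  by apply: sum_half; rewrite divr_ge0// ltW.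
- move=> w rw Nw; have st : size (take N w) == N by rewrite size_takel.
  have [|k kN Ek] := hg (Tuple st).
    by move: rw; rewrite -{1}(cat_take_drop N w) -cat_cons => /red_catl.
  exists (a :: take k w); last first.
    by rewrite /= eqxx -{2}(cat_take_drop k w) prefix_prefix.
  rewrite mem_pmap; apply/mapP; exists (g (Tuple st)).
    by rewrite mem_iota /= add0n ltnS leq_bigmax.
  by rewrite Ek /= take_takel.
Qed.

Lemma weight_cons : exists2 A, 0 < A & forall a w, red (a :: w) ->
  weight w <= A * weight (a :: w).
Proof.
have [K K1 HK] := lam_mul; have K0 : 0 < K by lra.
have [c c0 hc] := @positive_lower_bound R L (fun a => lam (ev [:: a]))
  (fun a => lam_gt0 _).
exists ((K / c) `^ s); first by rewrite powR_gt0// divr_gt0.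
move=> a w r; have [_ h] := HK [:: a] w r.
rewrite /weight -powRM ?divr_ge0 ?(ltW K0) ?(ltW c0) ?(ltW (lam_gt0 _))//.
apply: powR_mono; rewrite ?(ltW s_gt0) ?(ltW (lam_gt0 _))//.
rewrite mulrAC ler_pdivlMr// mulrC (le_trans _ h)//.
by rewrite ler_pM2r ?hc ?lam_gt0.
Qed.

Lemma weight_cat : exists2 B, 0 < B & forall v w, red (v ++ w) ->
  weight (v ++ w) <= B * weight v * weight w.
Proof.
have [K K1 HK] := lam_mul; have K0 : 0 < K by lra.
exists (K `^ s); first exact: powR_gt0.
move=> v w r; have [h _] := HK v w r.
rewrite /weight -mulrA -!powRM ?mulr_ge0 ?(ltW K0) ?(ltW (lam_gt0 _))//.
by apply: powR_mono; rewrite ?(ltW s_gt0) ?(ltW (lam_gt0 _)).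
Qed.

Lemma sum_prefix B v n : (forall w, red (v ++ w) ->
    weight (v ++ w) <= B * weight v * weight w) -> 0 <= B -> v != [::] ->
  \sum_(w <- words_upto iv n.+1 | prefix v w) weight w <=
    B * weight v * \sum_(w <- words_upto iv n) weight w.
Proof.
move=> hB B0 v0; rewrite -big_filter mulr_sumr.
have dropE w : prefix v w -> w = v ++ drop (size v) w.
  by move=> /prefixP[u ->]; rewrite drop_size_cat.
apply: (@ler_sum_inj _ _ _ _ _ (drop (size v))).
- by rewrite filter_uniq// words_upto_uniq.
- exact: words_upto_uniq.
- move=> w w'; rewrite !mem_filter => /andP[/dropE wE _] /andP[/dropE w'E _] E.
  by rewrite wE w'E E.
- move=> w; rewrite mem_filter !mem_words_upto => /and3P[/dropE wE rw sw].
  apply/andP; split; first by move: rw; rewrite wE drop_size_cat// => /red_catr.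
  (* Removing the nonempty [v] brings the length from at most [n.+1] to at most [n]. *)
  rewrite size_drop leq_subLR (leq_trans sw)// -add1n leq_add2r.
  by case: (v) v0.
- by move=> w; rewrite !mulr_ge0 ?weight_ge0.
- move=> w; rewrite mem_filter mem_words_upto => /and3P[/dropE wE rw _].
  by rewrite {1}wE; apply: hB; rewrite -wE.
Qed.

Lemma two_good_letters x : exists a b, [/\ a <> b, ~ ball a x & ~ ball b x].
Proof.
have [c hc] : exists c, forall a, ball a x -> a = c.
  have [[c bc]|none] := pselect (exists c, ball c x).
    by exists c => a ba; exact: ball_disj ba bc.
  have [e _] : exists e : L, True.
    by have /card_gt0P[e _] : (0 < #|L|)%N; [exact: leq_trans L4|exists e].
  by exists e => a ba; case: none; exists a.
have [a [ac _ _]] := avoid3 L4 c c c; have [b [bc ba _]] := avoid3 L4 c a a.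
exists a, b; split; first by move/esym/eqP; rewrite (negbTE ba).
- by move/hc/eqP; rewrite (negbTE ac).
- by move/hc/eqP; rewrite (negbTE bc).
Qed.

(* Renewal argument: every long word starting with a or b has a prefix in a
   family of small total weight, so the partial sums S satisfy
   S n <= A (S N + S n / (2 A)). *)
Lemma sum_of_null x : bd x -> null_cover [set y | limset y /\ x <> y] x ->
  exists S, forall l, uniq l -> all red l -> \sum_(w <- l) weight w <= S.
Proof.
move=> xbd hnull; have [a [b [ab xa xb]]] := two_good_letters x.
have [A A0 hA] := weight_cons; have [B B0 hB] := weight_cat.
(* The two families together weigh at most [2 * e], and [A * B * (2 * e)] is one half. *)
pose e := (4 * (A * B))^-1; have e0 : 0 < e by rewrite invr_gt0 !mulr_gt0.
have [Na [Fa [Fa0 Fae hFa]]] := prefix_family xbd xa e0 hnull.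
have [Nb [Fb [Fb0 Fbe hFb]]] := prefix_family xbd xb e0 hnull.
pose F := Fa ++ Fb; pose N := maxn Na Nb.
have F0 v : v \in F -> red v /\ v != [::].
  by rewrite mem_cat => /orP[/Fa0|/Fb0].
have Fe : \sum_(v <- F) weight v <= 2 * e.
  by rewrite big_cat /=; have := lerD Fae Fbe; rewrite mulr_natl mulr2n.
pose good w := if w is c :: _ then (c == a) || (c == b) else false.
have hF w : red w -> good w -> (N < size w)%N -> exists2 v, v \in F & prefix v w.
  case: w => //= c w rw /orP[]/eqP cE; rewrite ltnS geq_max => /andP[h1 h2].
    rewrite cE in rw *; have [v vF pv] := hFa w rw h1.
    by exists v; rewrite ?mem_cat ?vF.
  rewrite cE in rw *; have [v vF pv] := hFb w rw h2.
  by exists v; rewrite ?mem_cat ?vF ?orbT.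
pose S n := \sum_(w <- words_upto iv n) weight w.
have S0 n : 0 <= S n by apply: sumr_ge0 => w _; exact: weight_ge0.
(* The first letter of [w] is inverse to at most one of [a] and [b], so one of the two can be put in
   front. *)
pose h w := (if red (a :: w) then a else b) :: w.
have red_h w : red w -> red (h w).
  rewrite /h; case: ifP => // /negbT; case: w => // c w ac rw.
  have E e' : red (e' :: c :: w) = step e' c.
    by rewrite -[LHS]/(step e' c && red (c :: w)) rw andbT.
  move: ac; rewrite !E /step negbK => /eqP ->.
  by apply/eqP => /(can_inj ivK).
have step1 n : S n <= A * \sum_(w <- words_upto iv n.+1 | good w) weight w.
  rewrite mulr_sumr -big_filter.
  apply: (@ler_sum_inj _ _ _ _ _ h).
  - exact: words_upto_uniq.
  - by rewrite filter_uniq// words_upto_uniq.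
  - by move=> w w' _ _ [].
  - move=> w; rewrite mem_filter !mem_words_upto => /andP[rw sw].
    apply/and3P; split=> //; first by rewrite /h /=; case: ifP; rewrite eqxx ?orbT.
    exact: red_h.
  - by move=> w; rewrite mulr_ge0 ?weight_ge0 ?ltW.
  - move=> w; rewrite mem_words_upto => /andP[rw _].
    by apply: hA; exact: red_h.
have step2 n : \sum_(w <- words_upto iv n.+1 | good w) weight w <=
    S N + \sum_(v <- F) B * weight v * S n.
  rewrite (@le_trans _ _ (\sum_(w <- words_upto iv n.+1 | (size w <= N)%N) weight w +
    \sum_(v <- F) \sum_(w <- words_upto iv n.+1 | prefix v w) weight w))//.
    rewrite (exchange_big_dep xpredT) //= [X in X + _]big_mkcond -big_split /= big_mkcond /=.
    rewrite big_seq [leRHS]big_seq; apply: ler_sum => w.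
    rewrite -[_ ++ _]/(words_upto iv n.+1) mem_words_upto => /andP[rw _].
    have W0 : 0 <= \sum_(v <- F | prefix v w) weight w.
      by apply: sumr_ge0 => v _; exact: weight_ge0.
    have w0 := weight_ge0 w.
    case: ifP => gw; last by rewrite addr_ge0//; case: ifP.
    case: ifPn => [_|]; first by rewrite lerDl.
    rewrite -ltnNge add0r => Nw; have [v vF pv] := hF w rw gw Nw.
    rewrite (big_rem v vF) /= pv lerDl; apply: sumr_ge0 => u _; exact: weight_ge0.
  apply: lerD.
    rewrite -big_filter; apply: (@ler_sum_inj _ _ _ _ _ id) => //.
    - by rewrite filter_uniq// words_upto_uniq.
    - exact: words_upto_uniq.
    - by move=> w; rewrite mem_filter !mem_words_upto => /and3P[-> -> _].
    - exact: weight_ge0.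
  rewrite big_seq [leRHS]big_seq; apply: ler_sum => v vF.
  apply: sum_prefix; last exact: (F0 v vF).2.
    by move=> w r; exact: hB.
  exact: ltW.
have bound n : S n <= 2 * A * S N.
  have := le_trans (step1 n) (ler_wpM2l (ltW A0) (step2 n)).
  rewrite -mulr_suml -mulr_sumr.
  have small : B * (\sum_(v <- F) weight v) <= (2 * A)^-1.
    rewrite (le_trans (ler_wpM2l (ltW B0) Fe))// /e.
    rewrite le_eqVlt; apply/orP; left; apply/eqP; field.
    by rewrite !gt_eqF.
  have h' : A * (B * (\sum_(v <- F) weight v) * S n) <= S n / 2.
    rewrite (le_trans (ler_wpM2l (ltW A0) (ler_wpM2r (S0 n) small)))//.
    rewrite le_eqVlt; apply/orP; left; apply/eqP; field.
    by rewrite !gt_eqF.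
  by rewrite mulrDr => h2; have := S0 n; have := S0 N; lra.
exists (2 * A * S N) => l ul rl.
apply: (le_trans _ (bound (\max_(w <- l) size w))).
apply: (@ler_sum_inj _ _ _ _ _ id) => //.
- exact: words_upto_uniq.
- move=> w wl; rewrite mem_words_upto (allP rl _ wl) /=.
  by rewrite (big_rem w wl) /= leq_maxl.
- exact: weight_ge0.
Qed.

Lemma null_bigcup (A : nat -> set X) x :
  (forall k, null_cover (A k) x) -> null_cover (\bigcup_k A k) x.
Proof.
move=> hA e e0.
have ek k : 0 < e / 2 ^+ k.+1 by rewrite divr_gt0// exprn_gt0.
have /choice[UD hUD] k : exists UD : (nat -> set X) * (nat -> R),
    [/\ forall y, A k y -> exists i, UD.1 i y,
        forall i, 0 <= UD.2 i,
        forall i y z, A k y -> A k z -> UD.1 i y -> UD.1 i z -> crs x y z <= UD.2 i ^+ 2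
      & forall n, \sum_(i < n) UD.2 i `^ s <= e / 2 ^+ k.+1].
  by have [U [D h]] := hA k _ (ek k); exists (U, D).
pose pd (v : nat * nat) := (UD v.1).2 v.2.
pose G v := pd v `^ s; have G0 v : 0 <= G v by exact: powR_ge0.
(* Integers that code no pair get the empty set and the bound 0, whose power vanishes because [s] is
   positive. *)
pose D i := odflt 0 (omap pd (pickle_inv i)).
exists (fun i => [set y | exists2 v, pickle_inv i = Some v & A v.1 y /\ (UD v.1).1 v.2 y]), D.
split.
- move=> y [k _ Ay]; have [Uc _ _ _] := hUD k; have [i Ui] := Uc y Ay.
  by exists (pickle (k, i)), (k, i) => //; exact: pickleK_inv.
- move=> i; rewrite /D; case: (pickle_inv i) => [v|] /=; last exact: lexx.
  by have [_ h _ _] := hUD v.1; exact: h.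
- move=> i y z _ _ [v vi [Ay Uy]] [v' + [Az Uz]]; rewrite vi => -[E].
  rewrite -{}E {v'} in Az Uz; rewrite /D vi /=.
  by have [_ _ h _] := hUD v.1; exact: h.
- move=> n; rewrite (eq_bigr (fun i : 'I_n => odflt 0 (omap G (pickle_inv i)))); last first.
    by move=> i _; rewrite /D; case: pickle_inv => //=; rewrite powR0// gt_eqF.
  rewrite -(big_mkord xpredT (fun i => odflt 0 (omap G (pickle_inv i)))) -sum_pmap.
  set l := pmap _ _; pose M := (\max_(v <- l) (v.1 + v.2)).+1.
  rewrite (@le_trans _ _ (\sum_(v <- [seq (k, i) | k <- index_iota 0 M, i <- index_iota 0 M]) G v))//.
    apply: (@ler_sum_inj _ _ _ _ _ id) => //.
    + by apply: (pmap_uniq (@pickle_invK _)); exact: iota_uniq.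
    + by apply: allpairs_uniq; rewrite ?iota_uniq// => -[a b] [c e'] _ _ [-> ->].
    + case=> k i kl; have : (k + i < M)%N by rewrite ltnS (big_rem (k, i) kl) /= leq_maxl.
      move=> kiM; apply: allpairs_f; rewrite mem_index_iota /= (leq_ltn_trans _ kiM)//.
        exact: leq_addr.
      exact: leq_addl.
  rewrite big_allpairs.
  rewrite (@le_trans _ _ (\sum_(k <- index_iota 0 M) e / 2 ^+ k.+1))//.
    by apply: ler_sum => k _; have [_ _ _ h] := hUD k; rewrite big_mkord; exact: h.
  by rewrite big_mkord; apply: sum_half; exact: ltW.
Qed.

Lemma null_coverS (A B : set X) x : A `<=` B -> null_cover B x -> null_cover A x.
Proof.
move=> AB hB e e0; have [U [D [h1 h2 h3 h4]]] := hB e e0; exists U, D; split=> //.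
- by move=> y /AB; exact: h1.
- by move=> i y z /AB Ay /AB Az; exact: h3.
Qed.

Theorem null_iff_sum x : bd x -> null_cover [set y | limset y /\ x <> y] x <->
  exists S, forall l, uniq l -> all red l -> \sum_(w <- l) weight w <= S.
Proof.
move=> xbd; split; first exact: sum_of_null.
move=> [S HS].
apply: (@null_coverS _ (\bigcup_k [set y | limset y /\ x <> y /\ k.+1%:R^-1 <= kap x y])).
  move=> y [ly xy]; have k0 : 0 < kap x y.
    rewrite lt_neqAle kap_ge0 andbT eq_sym; apply/eqP => E.
    by apply: xy; apply: kap_eq0 => //; case: ly.
  have [n hn] := inv_small k0; exists n => //; split=> //; split=> //.
  exact: ltW (hn n (leqnn n)).
by apply: null_bigcup => k; apply: (null_of_sum HS) => //; rewrite invr_gt0.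
Qed.

End schottky_dynamics.

(** * Points of the closed ball *)

Section points.
Variables (R : realType) (d : nat).
Local Notation V := 'rV[R[i]]_d.+2.
Local Notation P := (cproj R d).
Implicit Types (p q r : P) (x y z : V) (g h : PU R d).

Lemma rep_neq0 p : rep p != 0.
Proof.
rewrite /rep vpick0; apply/eqP => p0; have := valP p.
by rewrite p0 dimv0.
Qed.

Lemma val_rep p : val p = <[rep p]>%VS.
Proof.
apply/esym/eqP; rewrite eqEdim -memvE memv_pick dim_vline rep_neq0.
by rewrite (eqP (valP p)).
Qed.

Lemma val_line p x : x \in val p -> x != 0 -> val p = <[x]>%VS.
Proof.
move=> xp x0; apply/esym/eqP; rewrite eqEdim -memvE xp dim_vline x0.
by rewrite (eqP (valP p)).
Qed.

Lemma point_of x : x != 0 -> exists p, val p = <[x]>%VS.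
Proof.
move=> x0; have h : \dim <[x]>%VS == 1%N by rewrite dim_vline x0.
by exists (exist (fun L : {vspace V} => \dim L == 1%N) _ h).
Qed.

Definition closed_hyp : set P := [set p | 0 <= hform (rep p) (rep p)].

Local Notation bd := (@hyp_boundary R d).
Local Notation dom := closed_hyp.

Lemma bd_dom : bd `<=` dom. Proof. by move=> p; rewrite /closed_hyp /hyp_boundary /= => ->. Qed.

Lemma hyp_dom : @hyp_space R d `<=` dom. Proof. by move=> p; rewrite /closed_hyp /hyp_space /= => /ltW. Qed.

Lemma ell_rep_neq0 p : dom p -> ell (rep p) != 0.
Proof.
rewrite /closed_hyp /= nonnegE => h; rewrite -nc_gt0 (lt_le_trans _ h)//.
by rewrite lt_neqAle nm_ge0 eq_sym nm_eq0 rep_neq0.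
Qed.

(* Sealed, because comparing representatives by computation does not end. *)
Lemma nvec_sig : {f : P -> V | forall p, f p = (ell (rep p))^-1 *: rep p}.
Proof. by exists (fun p => (ell (rep p))^-1 *: rep p). Qed.

Definition nvec : P -> V := sval nvec_sig.

Lemma nvecE p : nvec p = (ell (rep p))^-1 *: rep p.
Proof. exact: (svalP nvec_sig p). Qed.

Lemma ell_nvec p : dom p -> ell (nvec p) = 1.
Proof. by move=> /ell_rep_neq0 h; rewrite nvecE ellZ mulVf. Qed.

Lemma nvec_neq0 p : dom p -> nvec p != 0.
Proof. by move=> h; rewrite nvecE scaler_eq0 invr_eq0 negb_or ell_rep_neq0// rep_neq0. Qed.

Lemma rep_nvec p : dom p -> rep p = ell (rep p) *: nvec p.
Proof. by move=> h; rewrite nvecE scalerA divff ?scale1r// ell_rep_neq0. Qed.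

Lemma val_nvec p : dom p -> val p = <[nvec p]>%VS.
Proof.
by move=> h; apply: val_line (nvec_neq0 h); rewrite nvecE val_rep memvZ// memv_line.
Qed.

Lemma nvec_uniq p x : x \in val p -> x != 0 -> dom p -> ell x != 0 ->
  nvec p = (ell x)^-1 *: x.
Proof.
rewrite nvecE val_rep => /vlineP[k ->]; rewrite scaler_eq0 negb_or => /andP[k0 _] pd _.
by rewrite ellZ scalerA invfM mulrAC mulVf// mul1r.
Qed.

Lemma normalise_scale (k : R[i]) x : k != 0 ->
  (ell (k *: x))^-1 *: (k *: x) = (ell x)^-1 *: x.
Proof. by move=> k0; rewrite ellZ scalerA invfM mulrAC mulVf// mul1r. Qed.

Lemma hform_nvec p : hform (nvec p) (nvec p) =
  (nc (ell (rep p))^-1 ^+ 2)%:C%C * hform (rep p) (rep p).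
Proof. by rewrite nvecE hformZl hformZr mulrA conjM_nc. Qed.

Lemma nvec_inj p q : dom p -> dom q -> nvec p = nvec q -> p = q.
Proof. by move=> hp hq E; apply: val_inj; rewrite (val_nvec hp) (val_nvec hq) E. Qed.

Lemma bd_nvec p : bd p -> hform (nvec p) (nvec p) = 0.
Proof. by rewrite hform_nvec /hyp_boundary /= => ->; rewrite mulr0. Qed.

Lemma nm_nvec_le1 p : dom p -> nm (nvec p) <= 1.
Proof.
move=> hp; rewrite nvecE nmZ Normc.normcV mulrC ler_pdivrMr ?nc_gt0 ?ell_rep_neq0//.
by rewrite mul1r -nonnegE.
Qed.

Lemma nm_nvec_bd p : bd p -> nm (nvec p) = 1.
Proof.
move=> hp; have /eqP := bd_nvec hp; rewrite isotropicE ell_nvec; last exact: bd_dom.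
by rewrite Normc.normc1 => /eqP.
Qed.

Lemma nm_nvec_lt1 p : hyp_space p -> nm (nvec p) < 1.
Proof.
move=> hp; rewrite nvecE nmZ Normc.normcV mulrC ltr_pdivrMr ?nc_gt0 ?ell_rep_neq0//.
  by rewrite mul1r -positiveE.
exact: hyp_dom.
Qed.

(** The lifts [nvec] of boundary points have norm 1, so on the boundary this is the square of the
    Gromov-Bourdon metric. *)
Definition kap p q : R := nc (hform (nvec p) (nvec q)).

Lemma kapC p q : kap p q = kap q p. Proof. exact: nc_hform_sym. Qed.

Lemma kap_ge0 p q : 0 <= kap p q. Proof. exact: nc_ge0. Qed.

Lemma kap_le2 p q : dom p -> dom q -> kap p q <= 2.
Proof. by move=> hp hq; apply: hform1_le2; rewrite ?ell_nvec ?nm_nvec_le1. Qed.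

Lemma kap_dist p q : dom p -> dom q -> nm (nvec p - nvec q) ^+ 2 <= 2 * kap p q.
Proof. by move=> hp hq; apply: hform1_dist; rewrite ?ell_nvec ?nm_nvec_le1. Qed.

Lemma kap_eq0 p q : bd p -> bd q -> kap p q = 0 -> p = q.
Proof.
move=> /bd_dom hp /bd_dom hq k0; apply: nvec_inj => //; apply/eqP.
rewrite -subr_eq0 -nm_eq0 -sqrf_eq0 eq_le sqr_ge0 andbT.
by rewrite (le_trans (kap_dist hp hq))// k0 mulr0.
Qed.

Lemma kap_qt p q r : bd p -> dom q -> dom r ->
  kap p q <= Num.sqrt (2 * kap r p) + Num.sqrt (2 * kap r q).
Proof.
move=> hp hq hr; have hp' := bd_dom hp.
by apply: hform1_quasi_triangle; rewrite ?ell_nvec ?nm_nvec_le1 ?bd_nvec.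
Qed.

Lemma kap_le_dist p q : bd p -> dom q -> kap p q <= nm (nvec p - nvec q).
Proof.
move=> hp hq; have hp' := bd_dom hp.
by apply: hform1_triangle; rewrite ?ell_nvec ?bd_nvec.
Qed.

Definition realizes (f : 'End(V)) g : Prop :=
  preserves_hform f /\ forall p, val (val g p) = (f @: val p)%VS.

Definition lift g : 'End(V) := s2val (cid2 (PU_projective_unitary g)).

Lemma lift_realizes g : realizes (lift g) g.
Proof. by rewrite /lift; case: cid2. Qed.

Lemma realizes_nvec f g p : realizes f g -> dom p ->
  [/\ dom (val g p), ell (f (nvec p)) != 0
    & f (nvec p) = ell (f (nvec p)) *: nvec (val g p)].
Proof.
move=> [fu fg] hp; have xp := nvec_neq0 hp.
have fx0 : f (nvec p) != 0.
  apply: contra xp => /eqP fx0; have := preserves_hform_lker0 fu.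
  by move/lker0P => inj; apply/eqP/inj; rewrite fx0 linear0.
have fxp : f (nvec p) \in val (val g p).
  by rewrite fg memv_img// val_nvec// memv_line.
have [a E] : exists a, f (nvec p) = a *: rep (val g p).
  by move: fxp; rewrite val_rep => /vlineP.
have a0 : a != 0 by apply: contra fx0 => /eqP a0; rewrite E a0 scale0r.
have hg : dom (val g p).
  have : 0 <= hform (f (nvec p)) (f (nvec p)).
    by rewrite fu nonnegE ell_nvec// Normc.normc1 nm_nvec_le1.
  rewrite E nonnegE ellZ nmZ Normc.normcM ler_pM2l ?nc_gt0//.
  by rewrite /closed_hyp /= nonnegE.
have l0 : ell (f (nvec p)) != 0.
  by rewrite E ellZ mulf_neq0// ell_rep_neq0.
split=> //.
by rewrite (nvec_uniq fxp fx0 hg l0) scalerA divff// scale1r.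
Qed.

Lemma realizes_kap f g p q : realizes f g -> dom p -> dom q ->
  kap (val g p) (val g q) * (nc (ell (f (nvec p))) * nc (ell (f (nvec q)))) = kap p q.
Proof.
move=> fg hp hq; have [_ _ Ep] := realizes_nvec fg hp.
have [_ _ Eq] := realizes_nvec fg hq.
move: Ep Eq; set a := ell (f (nvec p)); set b := ell (f (nvec q)) => Ep Eq.
rewrite /kap -[in RHS](proj1 fg) Ep Eq hformZl hformZr !Normc.normcM nc_conj; ring.
Qed.

Definition jac g p : R := nc (ell (lift g (nvec p))).

Lemma jac_gt0 g p : dom p -> 0 < jac g p.
Proof. by move=> hp; have [_ h _] := realizes_nvec (lift_realizes g) hp; rewrite nc_gt0. Qed.

Lemma kap_act g p q : dom p -> dom q ->
  kap (val g p) (val g q) * (jac g p * jac g q) = kap p q.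
Proof. exact: realizes_kap (lift_realizes g). Qed.

Lemma dom_act g p : dom p -> dom (val g p).
Proof. by move=> hp; have [] := realizes_nvec (lift_realizes g) hp. Qed.

Lemma hform_act g p : dom p -> hform (nvec p) (nvec p) =
  (jac g p ^+ 2)%:C%C * hform (nvec (val g p)) (nvec (val g p)).
Proof.
move=> hp; have fg := lift_realizes g; have [_ _ E] := realizes_nvec fg hp.
move: E; rewrite /jac; set a := ell _ => E.
by rewrite -(proj1 fg) E hformZl hformZr mulrA conjM_nc.
Qed.

Lemma bdE p : dom p -> bd p <-> hform (nvec p) (nvec p) = 0.
Proof.
move=> hp; split; first exact: bd_nvec.
move=> h; rewrite /hyp_boundary /= (rep_nvec hp) hformZl hformZr h.
by rewrite !mulr0.
Qed.

Lemma bd_act g p : bd p -> bd (val g p).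
Proof.
move=> hp; have hp' := bd_dom hp; apply/bdE; first exact: dom_act.
have := hform_act g hp'; rewrite bd_nvec// => /esym/eqP.
rewrite mulf_eq0 => /orP[|/eqP//]; rewrite -(rmorph0 (real_complex R)).
by rewrite (inj_eq (@complexI _)) sqrf_eq0 gt_eqF// jac_gt0.
Qed.

Definition crs p q r : R := cross (nvec p) (nvec q) (nvec r).

Lemma crs_act g p q r : bd p -> bd q -> bd r ->
  crs (val g p) (val g q) (val g r) = jac g p ^+ 2 * crs p q r.
Proof.
move=> /bd_dom hp /bd_dom hq /bd_dom hr; have fg := lift_realizes g.
have [_ p0 Ep] := realizes_nvec fg hp; have [_ q0 Eq] := realizes_nvec fg hq.
have [_ r0 Er] := realizes_nvec fg hr.
have -> : crs p q r = cross (lift g (nvec p)) (lift g (nvec q)) (lift g (nvec r)).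
  by rewrite /crs /cross !(proj1 fg).
move: p0 q0 r0 Ep Eq Er; rewrite /jac; set a := ell _; set b := ell _; set c := ell _.
move=> a0 b0 c0 -> -> ->; rewrite cross_scale// mulrA divff ?mul1r//.
by rewrite sqrf_eq0 nc_eq0.
Qed.

Lemma hform_neq0 p q : bd p -> bd q -> p <> q -> hform (nvec p) (nvec q) != 0.
Proof. by move=> hp hq pq; rewrite -nc_eq0; apply/eqP => /(kap_eq0 hp hq). Qed.

Lemma crs_le p q r : bd p -> bd q -> bd r -> p <> q -> p <> r ->
  crs p q r <= 2 * (kap q r / (kap q p * kap p r)).
Proof.
move=> hp hq hr pq pr; apply: cross_le; apply: hform_neq0 => //.
by move=> E; apply: pq.
Qed.

Variable o : P.
Hypothesis ho : hyp_space o.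

Definition oval : R := 1 - nm (nvec o).

Lemma oval_gt0 : 0 < oval. Proof. by rewrite subr_gt0 nm_nvec_lt1. Qed.

Lemma kap_o p : dom p -> oval <= kap o p.
Proof.
move=> hp; apply: hform1_ge; rewrite ?ell_nvec ?nm_nvec_le1//.
exact: hyp_dom.
Qed.

(* Any lift can be used to compute jac, since two lifts of g multiply lifted
   vectors by factors of the same modulus; the point o is what excludes a
   factor depending on p. *)
Lemma jac_realizes f g p : realizes f g -> dom p -> nc (ell (f (nvec p))) = jac g p.
Proof.
move=> fg hp; have od := hyp_dom ho; have fl := lift_realizes g.
have [go fo0 _] := realizes_nvec fg od; have [gp fp0 _] := realizes_nvec fg hp.
have k0 q : dom q -> 0 < kap (val g o) (val g q).
  move=> hq; rewrite lt_neqAle kap_ge0 andbT eq_sym; apply/eqP => k0.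
  have := kap_o hq; have := kap_act g od hq; rewrite k0 mul0r => <-.
  by rewrite leNgt oval_gt0.
have E q : dom q -> nc (ell (f (nvec o))) * nc (ell (f (nvec q))) = jac g o * jac g q.
  move=> hq; apply: (mulfI (lt0r_neq0 (k0 q hq))).
  by rewrite (realizes_kap fg)// kap_act.
have Eo : nc (ell (f (nvec o))) = jac g o.
  apply/eqP; rewrite -(@eqrXn2 _ 2)// ?nc_ge0//.
  by rewrite !expr2 E.
have := E p hp; rewrite Eo => /mulfI; apply.
by rewrite gt_eqF// jac_gt0.
Qed.

Lemma jacM g h p : dom p -> jac (g * h)%g p = jac g (val h p) * jac h p.
Proof.
move=> hp; have [fgu fg] := lift_realizes g; have [fhu fh] := lift_realizes h.
have r : realizes (lift g \o lift h)%VF (g * h)%g.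
  split; first by move=> x y; rewrite !comp_lfunE fgu fhu.
  by move=> q; rewrite limg_comp -fh -fg.
rewrite -(jac_realizes r hp) comp_lfunE.
have [hh h0 E] := realizes_nvec (lift_realizes h) hp.
rewrite /jac; move: E; set a := ell (lift h _) => ->.
by rewrite linearZ ellZ Normc.normcM mulrC.
Qed.

(** * Hyperbolic distance and conformal factor at the base point *)

(** The distance is picked by [xget], which would return its default value if the equation had no
    solution. *)
Lemma cosh_solve (v : R) : 1 <= v -> exists2 t, 0 <= t & cosh t = v.
Proof.
move=> v1; pose u := v + Num.sqrt (v ^+ 2 - 1).
have s0 : 0 <= v ^+ 2 - 1 by rewrite subr_ge0 exprn_ege1.
have u1 : 1 <= u by rewrite /u; have := sqrtr_ge0 (v ^+ 2 - 1); lra.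
have u0 : 0 < u by lra.
exists (ln u); first exact: ln_ge0.
rewrite /cosh expRN lnK ?posrE//.
have : u * u - 2 * v * u + 1 = 0.
  have := sqr_sqrtr s0; rewrite /u; set w := Num.sqrt _; rewrite expr2; nra.
move=> E; apply: (mulIf (lt0r_neq0 u0)).
rewrite mulrAC mulrDl mulVf ?gt_eqF//; lra.
Qed.

Definition lam g : R := expR (- hyp_dist o (val g o)).

Lemma lam_gt0 g : 0 < lam g. Proof. exact: expR_gt0. Qed.

Lemma gram_normalised (x y : V) : ell x != 0 -> ell y != 0 ->
  let x' := (ell x)^-1 *: x in let y' := (ell y)^-1 *: y in
  nc (hform x y) / Num.sqrt (Re (hform x x) * Re (hform y y)) =
  nc (hform x' y') / Num.sqrt ((1 - nm x' ^+ 2) * (1 - nm y' ^+ 2)).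
Proof.
move=> x0 y0 x' y'.
have E (z : V) : ell z != 0 -> Re (hform z z) =
    nc (ell z) ^+ 2 * (1 - nm ((ell z)^-1 *: z) ^+ 2).
  move=> z0; have l0 : nc (ell z) != 0 by rewrite nc_eq0.
  by rewrite hformxx nmZ Normc.normcV /=; field.
rewrite (E x)// (E y)// -/x' -/y'.
have l1 : 0 < nc (ell x) by rewrite nc_gt0.
have l2 : 0 < nc (ell y) by rewrite nc_gt0.
have -> : nc (hform x' y') = (nc (ell x))^-1 * ((nc (ell y))^-1 * nc (hform x y)).
  by rewrite hformZl hformZr !Normc.normcM nc_conj !Normc.normcV.
rewrite mulrACA -exprMn sqrtrM ?sqr_ge0// sqrtr_sqr ger0_norm ?mulr_ge0 ?nc_ge0//.
set k := Num.sqrt _; rewrite [in LHS]invfM; move: k^-1 => S.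
by field; rewrite !gt_eqF.
Qed.

Let no2 : R := 1 - nm (nvec o) ^+ 2.

Let no2_gt0 : 0 < no2.
Proof.
by rewrite subr_gt0 expr_lt1// ?nm_ge0// nm_nvec_lt1.
Qed.

Lemma nm_act g p : dom p ->
  1 - nm (nvec p) ^+ 2 = jac g p ^+ 2 * (1 - nm (nvec (val g p)) ^+ 2).
Proof.
move=> hp; have := hform_act g hp; have := ell_nvec hp.
have := ell_nvec (dom_act g hp); move: (nvec _) (nvec _) (jac _ _) => x y a x1 y1.
rewrite !hformxx x1 y1 Normc.normc1 expr1n -rmorphM; exact: complexI.
Qed.

Lemma cosh_hyp_dist g : 0 <= hyp_dist o (val g o) /\
  cosh (hyp_dist o (val g o)) = kap o (val g o) * jac g o / no2.
Proof.
have od := hyp_dom ho; have gd := dom_act g od.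
have := nm_act g od; rewrite -/no2 => Eg; have j0 := jac_gt0 g od.
have b0 : 0 < 1 - nm (nvec (val g o)) ^+ 2.
  by move: no2_gt0; rewrite Eg pmulr_rgt0// exprn_gt0.
have E : nc (hform (rep o) (rep (val g o))) /
    Num.sqrt (Re (hform (rep o) (rep o)) * Re (hform (rep (val g o)) (rep (val g o)))) =
    kap o (val g o) * jac g o / no2.
  rewrite gram_normalised ?ell_rep_neq0// -!nvecE -/(kap o (val g o)) -/no2.
  move: Eg b0; set b := 1 - _ => -> b0.
  rewrite (_ : _ * b = (jac g o * b) ^+ 2); last by ring.
  rewrite sqrtr_sqr ger0_norm ?mulr_ge0 ?(ltW j0) ?(ltW b0)//.
  by field; rewrite !gt_eqF.
(* Reversed Cauchy-Schwarz inequality: for the norms [a] and [b] of the two lifts,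
   [(1 - a ^+ 2) * (1 - b ^+ 2)] is at most [(1 - b * a) ^+ 2]. *)
have v1 : 1 <= kap o (val g o) * jac g o / no2.
  rewrite ler_pdivlMr// mul1r.
  have h3 : 1 - nm (nvec o) * nm (nvec (val g o)) <= kap o (val g o).
    have := hform1_lower (ell_nvec od) (ell_nvec gd); exact.
  have a1 := nm_nvec_lt1 ho; have a0 := nm_ge0 (nvec o).
  have b1 := nm_nvec_le1 gd; have b2 := nm_ge0 (nvec (val g o)).
  have k0 := kap_ge0 o (val g o); move: no2_gt0 Eg b0; rewrite /no2.
  move: (nm _) (nm _) (kap _ _) (jac _ _) h3 a0 a1 b1 b2 k0 j0 => a b k j h3 a0 a1 b1 b2 k0 j0.
  move=> n0 Eg b0.
  rewrite -(@ler_pXn2r _ 2)// ?nnegrE ?mulr_ge0 ?(ltW j0) ?(ltW n0)//.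
  rewrite exprMn expr2 {1}Eg -[leLHS]mulrA mulrC ler_wpM2r ?sqr_ge0//.
  have h4 : (1 - a ^+ 2) * (1 - b ^+ 2) <= (1 - b * a) ^+ 2.
    rewrite -subr_ge0 (_ : _ - _ = (a - b) ^+ 2) ?sqr_ge0//; ring.
  rewrite (le_trans h4)// lerXn2r ?nnegrE//; nra.
have [t t0 ct] := cosh_solve v1.
rewrite -E in ct *; exact: (@xgetPex _ 0 [set t | 0 <= t /\ cosh t = _] (ex_intro _ t (conj t0 ct))).
Qed.

Definition clam : R := no2 / oval + 4 / no2.

Lemma clam_gt0 : 0 < clam. Proof. by rewrite addr_gt0 ?divr_gt0 ?oval_gt0. Qed.

(** The hyperbolic cosine of [t >= 0] lies between [expR t / 2] and [expR t], and [kap o] between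
    [oval] and 2; so [cosh_hyp_dist] makes [jac g o] comparable to the inverse of [lam g]. The two
    summands of [clam] serve the two inequalities. *)
Lemma lam_bounds g : lam g * jac g o <= clam /\ 1 <= clam * (lam g * jac g o).
Proof.
have od := hyp_dom ho; have gd := dom_act g od; have j0 := jac_gt0 g od.
have [t0] := cosh_hyp_dist g; rewrite /lam expRN /cosh; set t := hyp_dist _ _ in t0 *.
rewrite expRN; set E := expR t; set k := kap _ _ => H.
have E0 : 0 < E by exact: expR_gt0.
have E1 : 1 <= E by rewrite -expR0 ler_expR.
have Ei : E^-1 <= E by rewrite (le_trans _ E1)// invf_le1.
have Ei0 : 0 < E^-1 by rewrite invr_gt0.
have k1 : oval <= k by exact: kap_o.
have k2 : k <= 2 by exact: kap_le2.
have ov := oval_gt0; have n0 := no2_gt0.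
have h1 : k * jac g o / no2 <= E by rewrite -H; lra.
have h2 : E / 2 <= k * jac g o / no2 by rewrite -H; lra.
split.
  rewrite mulrC ler_pdivrMr//.
  move: h1; rewrite ler_pdivrMr// => h1.
  have h3 : oval * jac g o <= E * no2 by rewrite (le_trans _ h1)// ler_pM2r.
  rewrite /clam mulrDl ler_wpDr ?mulr_ge0 ?invr_ge0 ?(ltW n0) ?(ltW E0)//.
  by rewrite mulrAC ler_pdivlMr// mulrC [no2 * E]mulrC.
have h3 : E / 2 <= 2 * jac g o / no2.
  by rewrite (le_trans h2)// ler_pM2r ?invr_gt0// ler_pM2r.
have h4 : 1 <= 4 / no2 * (E^-1 * jac g o).
  rewrite mulrCA ler_pdivlMl// mulr1.
  have -> : 4 / no2 * jac g o = 2 * (2 * jac g o / no2) by ring.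
  lra.
rewrite (le_trans h4)// ler_pM2r ?mulr_gt0// lerDr divr_ge0 ?ltW//.
Qed.

Lemma lam_pow g (s : R) : lam g `^ s = expR (- s * hyp_dist o (val g o)).
Proof. by rewrite /powR gt_eqF ?lam_gt0// expRK mulrN mulNr. Qed.

End points.

(** * Topology of the projective space *)

Section vector_topology.
Variables (R : realType) (n : nat).
Local Notation V := 'rV[R[i]]_n.
Implicit Types (x y : V).

Lemma ballcE (a b : R[i]) (e : R) : ball a e%:C%C b <-> nc (a - b) < e.
Proof.
rewrite -ball_normE /ball_ /=.
have -> : `|a - b| = (nc (a - b))%:C%C by case: (a - b).
by rewrite ltcR.
Qed.

Lemma nbhs_nm x (A : set V) :
  nbhs x A <-> exists2 r : R, 0 < r & forall y, nm (y - x) < r -> A y.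
Proof.
split.
  move=> /nbhs_ballP[e e0 eA].
  have e0' : 0 < e by [].
  have eE : e = (Re e)%:C%C.
    by move: e0'; rewrite ltcE => /andP[/eqP h _]; case: (e) h => a b /= ->.
  have r0 : 0 < Re e by move: e0'; rewrite ltcE => /andP[].
  exists (Re e) => // y yx; apply: eA; split=> // i j; rewrite eE; apply/ballcE.
  have -> : x i j - y i j = - ((y - x) 0 j) by rewrite !mxE (ord1 i) opprB.
  by rewrite ncN (le_lt_trans _ yx)// nc_le_nm.
(* With [n] coordinates of modulus at most [r / n.+1], the squared norm is at most [n / n.+1 ^ 2]
   times [r ^+ 2], hence smaller than [r ^+ 2]. *)
move=> [r r0 rA]; apply/nbhs_ballP; exists (r / n.+1%:R)%:C%C.
  by rewrite /= -(rmorph0 (real_complex R)) ltcR divr_gt0.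
move=> y xy; apply: rA.
have h k : nc ((y - x) 0 k) <= r / n.+1%:R.
  rewrite -ncN !mxE opprB; apply: ltW; apply/ballcE; exact: xy.2.
have rn : 0 <= r / n.+1%:R by rewrite divr_ge0// ltW.
have h2 : nm (y - x) ^+ 2 <= n%:R * (r / n.+1%:R) ^+ 2.
  rewrite nmE (@le_trans _ _ (\sum_(k < n) (r / n.+1%:R) ^+ 2))//.
    by apply: ler_sum => k _; rewrite lerXn2r ?nnegrE ?nc_ge0.
  by rewrite sumr_const card_ord -[leLHS]mulr_natl.
rewrite -(@ltr_pXn2r _ 2)// ?nnegrE ?nm_ge0 ?(ltW r0)//.
rewrite (le_lt_trans h2)// exprMn mulrCA -[ltRHS]mulr1 ltr_pM2l ?exprn_gt0//.
rewrite exprVn ltr_pdivrMr ?exprn_gt0// mul1r -natrX ltr_nat.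
by rewrite (@leq_trans n.+1)// leq_pmulr.
Qed.

End vector_topology.

Section projective_topology.
Variables (R : realType) (d : nat).
Local Notation V := 'rV[R[i]]_d.+2.
Local Notation P := (cproj R d).
Local Notation dom := (@closed_hyp R d).
Local Notation bd := (@hyp_boundary R d).
Implicit Types (p q r : P) (x y z : V).

Lemma normalise_near x v (e : R) : ell x != 0 -> nm ((ell x)^-1 *: x - v) < e ->
  exists2 r : R, 0 < r & forall y, nm (y - x) < r ->
    ell y != 0 /\ nm ((ell y)^-1 *: y - v) < e.
Proof.
move=> x0 xv; pose l := nc (ell x); have l0 : 0 < l by rewrite nc_gt0.
pose eta := e - nm ((ell x)^-1 *: x - v); have eta0 : 0 < eta by rewrite subr_gt0.
have nx := nm_ge0 x; have m0 : 0 < l + 2 * nm x by rewrite ltr_pwDl// mulr_ge0.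
(* The first bound keeps [nc (ell y)] above [l / 2]; the second makes [nm (y - x) * (l + 2 * nm x)]
   smaller than [eta * (l * (l / 2))]. *)
pose r := Num.min (l / 4) (eta * l ^+ 2 / (2 * (l + 2 * nm x))).
exists r; first by rewrite lt_min !divr_gt0 ?mulr_gt0 ?exprn_gt0.
move=> y; rewrite lt_min => /andP[y1 y2].
have dl : nc (ell y - ell x) <= 2 * nm (y - x).
  by rewrite -ellN -ellD nc_ell.
have ly : l / 2 <= nc (ell y).
  have := nc_add (ell y) (ell x - ell y); rewrite addrC subrK -/l.
  have -> : nc (ell x - ell y) = nc (ell y - ell x) by rewrite -ncN opprB.
  lra.
have ly0 : 0 < nc (ell y) by lra.
have y0 : ell y != 0 by rewrite -nc_gt0.
split=> //.
have E : (ell y)^-1 *: y - (ell x)^-1 *: x =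
    (ell x * ell y)^-1 *: (ell x *: (y - x) - (ell y - ell x) *: x).
  apply/rowP => j; rewrite !mxE; field.
  by rewrite x0 y0.
have h : nm ((ell y)^-1 *: y - (ell x)^-1 *: x) < eta.
  rewrite E nmZ Normc.normcV Normc.normcM -/l mulrC ltr_pdivrMr ?mulr_gt0//.
  apply: (@le_lt_trans _ _ (nm (y - x) * (l + 2 * nm x))).
    rewrite (le_trans (nmD _ _))// nmN !nmZ -/l mulrDr mulrC lerD2l.
    by rewrite [leRHS]mulrCA mulrA ler_wpM2r.
  move: y2; rewrite -ltr_pdivlMr// => /lt_le_trans; apply.
  rewrite ler_pdivrMr ?mulr_gt0// mulrAC ler_pdivlMr//.
  have : eta * (l * (l / 2)) <= eta * (l * nc (ell y)) by rewrite !ler_pM2l.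
  rewrite -(ler_pM2r m0) => h; rewrite -(ler_pM2r (ltr0n R 2)).
  move: h; set M := l + _; set N := nc _; nra.
rewrite -[_ - v](subrKA ((ell x)^-1 *: x)) (le_lt_trans (nmD _ _))//.
by rewrite -ltrBrDr.
Qed.

Lemma cproj_nbhs p (N : set P) : nbhs p N <->
  exists Q : set P, [/\ open (cone Q), Q p & Q `<=` N].
Proof.
split.
  by rewrite nbhsE; case=> Q [oQ Qp] QN; exists Q.
by move=> [Q [oQ Qp QN]]; rewrite nbhsE; exists Q.
Qed.

Lemma nvec_near p (e : R) : dom p -> 0 < e ->
  nbhs p [set q | dom q -> nm (nvec q - nvec p) < e].
Proof.
move=> hp e0; apply/cproj_nbhs.
pose S x := ell x != 0 /\ nm ((ell x)^-1 *: x - nvec p) < e.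
exists [set q | exists2 x, val q = <[x]>%VS & S x]; split.
- rewrite openE => x [q [y qy [y0 Sy]] qx].
  have xy : exists2 k, x = k *: y & k != 0.
    have : x \in <[y]>%VS by rewrite -qy qx memv_line.
    move=> /vlineP[k E]; exists k => //; apply/eqP => k0.
    by have := valP q; rewrite qx E k0 scale0r dim_vline eqxx.
  have [k xk k0] := xy.
  have Sx : S x.
    by rewrite /S xk normalise_scale// ellZ mulf_neq0.
  have [r r0 hr] := normalise_near Sx.1 Sx.2.
  apply/nbhs_nm; exists r => // z /hr Sz.
  have z0 : z != 0.
    by apply: contraNneq Sz.1 => ->; rewrite /ell !mxE addr0.
  have [q' q'z] := point_of z0.
  by exists q' => //; exists z.
- exists (nvec p); first exact: val_nvec.
  by rewrite /S ell_nvec// oner_neq0 invr1 scale1r subrr (_ : nm 0 = 0) //; apply/eqP; rewrite nm_eq0.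
- move=> q [x qx [x0 hx]] hq; have xne : x != 0.
    by apply: contraNneq x0 => ->; rewrite /ell !mxE addr0.
  by rewrite (nvec_uniq _ xne)// qx memv_line.
Qed.

Lemma nbhs_nvec p (N : set P) : dom p -> nbhs p N ->
  exists2 r : R, 0 < r & forall q, dom q -> nm (nvec q - nvec p) < r -> N q.
Proof.
move=> hp /cproj_nbhs[Q [oQ Qp QN]].
have : nbhs (nvec p) (cone Q).
  by apply: open_nbhs_nbhs; split=> //; exists p => //; exact: val_nvec.
move=> /nbhs_nm[r r0 hr]; exists r => // q hq /hr[q' Oq' E].
by have <- : q' = q; [apply: val_inj; rewrite E val_nvec|exact: QN].
Qed.

Lemma kap_near p (e : R) : bd p -> 0 < e ->
  nbhs p [set q | dom q -> kap p q < e].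
Proof.
move=> hp e0; have hp' := bd_dom hp.
apply: filterS (nvec_near hp' e0) => q h hq.
by rewrite (le_lt_trans (kap_le_dist hp hq))// nmB; exact: h.
Qed.

End projective_topology.

Lemma compact_cluster_seq (T : topologicalType) (A : set T) (u : nat -> T) :
  compact A -> (forall n, A (u n)) ->
  exists2 p, A p & forall (N : set T) n, nbhs p N -> exists2 m, (n <= m)%N & N (u m).
Proof.
move=> cA uA; have [|p [Ap cp]] := cA (u @ \oo) _.
  by exists 0%N => // m _; exact: uA.
exists p => // N n Np.
have [|_ [[m nm <-] Nm]] := cp (u @` [set m | (n <= m)%N]) N _ Np.
  by exists n => // m nm; exists m.
by exists m.
Qed.

Section limit_sets.
Variables (R : realType) (d : nat).
Local Notation P := (cproj R d).
Local Notation bd := (@hyp_boundary R d).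

Lemma limit_setE (Gam : set (PU R d)) (o : P) : hyp_space o ->
  limit_set Gam o = [set p | bd p /\ forall e : R, 0 < e ->
    exists2 g, Gam g & kap p (val g o) < e].
Proof.
move=> ho; have od := hyp_dom ho.
apply/seteqP; split=> p [pbd hp]; split=> //.
  move=> e e0; have [_ [_ [g Gg <-] h]] := hp _ (kap_near pbd e0).
  by exists g => //; apply: h; exact: dom_act.
move=> N Np; have [r r0 hr] := nbhs_nvec (bd_dom pbd) Np.
have [|g Gg kg] := hp (r ^+ 2 / 2); first by rewrite divr_gt0// exprn_gt0.
have gd := dom_act g od; have pd := bd_dom pbd.
exists (val g o); split.
(* A limit point has to be approached by other points; the orbit of [o] stays in the open ball and
   never meets the boundary. *)
- apply/eqP => E; move: pbd; rewrite -E => /(bd_act g^-1%g).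
  have -> : val g^-1%g (val g o) = o by rewrite -[LHS]/(val (g^-1 * g)%g o) mulVg.
  by move: ho; rewrite /hyp_space /hyp_boundary /= => /[swap] ->; rewrite ltxx.
- by exists g.
apply: hr => //; rewrite -(@ltr_pXn2r _ 2)// ?nnegrE ?nm_ge0 ?(ltW r0)// nmB.
by rewrite (le_lt_trans (kap_dist pd gd))// -ltr_pdivlMl// mulrC.
Qed.

End limit_sets.

(** * Triples of boundary points *)

Section triples.
Variables (R : realType) (d : nat).
Local Notation V := 'rV[R[i]]_d.+2.
Local Notation P := (cproj R d).
Local Notation bd := (@hyp_boundary R d).
Implicit Types (p q r : P) (x y z : V).

Definition tri p q r : R := triple (nvec p) (nvec q) (nvec r).

Lemma tri_kap p q r : bd p -> bd q -> bd r -> tri p q r <= 4 * kap p q.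
Proof.
move=> /bd_dom hp /bd_dom hq /bd_dom hr.
rewrite (le_trans (Re_le_nc _))// !Normc.normcM -/(kap p q) -/(kap q r) -/(kap r p).
have := kap_le2 hq hr; have := kap_le2 hr hp; have := kap_ge0 p q.
have := kap_ge0 q r; have := kap_ge0 r p.
move: (kap p q) (kap q r) (kap r p) => a b c c0 b0 a0 c2 b2.
have : b * c <= 2 * 2 by rewrite ler_pM.
by move=> h; rewrite -mulrA mulrC ler_wpM2r//; lra.
Qed.

Lemma crs_tri p q r : bd p -> bd q -> bd r -> p <> q -> p <> r ->
  crs p q r = 2 * tri p q r / (kap q p * kap p r) ^+ 2.
Proof.
move=> hp hq hr pq pr; apply: cross_triple; apply: hform_neq0 => //.
by move=> E; apply: pq.
Qed.

Lemma crs_orth p q r : bd p -> bd q -> bd r -> p <> q -> p <> r ->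
  crs p q r = nm (orth (nvec p) (chord (nvec p) (nvec q) (nvec r))) ^+ 2.
Proof.
move=> hp hq hr pq pr; apply: crossE; rewrite ?bd_nvec ?hform_neq0//.
exact: nvec_neq0 (bd_dom hp).
Qed.

Lemma hyp_point_on x y : hform x x = 0 -> hform y y = 0 -> hform x y != 0 ->
  exists2 p, hyp_space p & (val p <= <[x]> + <[y]>)%VS.
Proof.
move=> xx yy xy; pose w := x + (hform x y)^-1 *: y.
have ww : hform w w = 2.
  rewrite hformDl !hformDr !hformZl !hformZr xx yy !mulr0 !addr0 add0r.
  by rewrite mulVf// [hform y x]hform_conj -rmorphM mulVf// rmorph1.
have w0 : w != 0.
  by apply: contra_eq_neq ww => ->; rewrite hform0l eq_sym pnatr_eq0.
have [p pw] := point_of w0; exists p; last first.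
  by rewrite pw -memvE memv_add// ?memvZ ?memv_line.
have : w \in val p by rewrite pw memv_line.
rewrite val_rep => /vlineP[k wk]; have k0 : k != 0.
  by apply: contraNneq w0 => k0; rewrite wk k0 scale0r.
have : 0 < hform w w by rewrite ww ltr0n.
rewrite wk !positiveE ellZ nmZ Normc.normcM ltr_pM2l ?nc_gt0//.
by rewrite /hyp_space /= positiveE.
Qed.

(** [crs] is a squared norm with the sign of [tri]. If it vanishes, the chord is a multiple of
    [nvec p], so [r] lies on the complex line through [p] and [q], which cuts the boundary in a
    chain. *)
Lemma tri_gt0 p q r : bd p -> bd q -> bd r -> p <> q -> p <> r ->
  (forall C, chain C -> C p -> C q -> ~ C r) -> 0 < tri p q r.
Proof.
move=> hp hq hr pq pr nochain.
have kqp : 0 < kap q p by rewrite nc_gt0 hform_neq0// => E; apply: pq.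
have kpr : 0 < kap p r by rewrite nc_gt0 hform_neq0.
have c0 : crs p q r != 0.
  apply/eqP; rewrite crs_orth// => /eqP; rewrite sqrf_eq0 nm_eq0 /orth subr_eq0.
  set k := _ / _ => /eqP E.
  have hpq := hform_neq0 hp hq pq; have hpr := hform_neq0 hp hr pr.
  pose W := (<[nvec p]> + <[nvec q]>)%VS.
  have pW : (val p <= W)%VS by rewrite (val_nvec (bd_dom hp)) addvSl.
  have qW : (val q <= W)%VS by rewrite (val_nvec (bd_dom hq)) addvSr.
  have rW : (val r <= W)%VS.
    rewrite (val_nvec (bd_dom hr)) -memvE.
    have -> : nvec r = - (hform (nvec p) (nvec r) * k) *: nvec p +
        (hform (nvec p) (nvec r) / hform (nvec p) (nvec q)) *: nvec q.
      have -> : - (hform (nvec p) (nvec r) * k) *: nvec p =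
          - (hform (nvec p) (nvec r) *: (k *: nvec p)) by rewrite scaleNr scalerA.
      rewrite -E /chord scalerBr !scalerA divff// scale1r opprB.
      by rewrite addrNK.
    by rewrite memv_add// memvZ// memv_line.
  have dW : \dim W = 2%N.
    rewrite dimv_disjoint_sum ?dim_vline ?nvec_neq0//; try exact: bd_dom.
    apply/eqP; rewrite -subv0; apply/subvP => v /memv_capP[/vlineP[a ->] /vlineP[b ab]].
    rewrite memv0 scaler_eq0; have [//|a0] := eqVneq a 0.
    have : hform (nvec p) (a *: nvec p) = hform (nvec p) (b *: nvec q) by rewrite ab.
    rewrite !hformZr bd_nvec// mulr0 => /esym/eqP; rewrite mulf_eq0 (negbTE hpq) orbF => /eqP b0.
    have := nvec_neq0 (bd_dom hp); have /eqP := ab.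
    by rewrite b0 scale0r scaler_eq0 (negbTE a0) /= => ->.
  apply: (nochain (bd `&` [set s | (val s <= W)%VS])) => //.
  exists W; split=> //; apply: hyp_point_on => //; exact: bd_nvec.
have : 0 < crs p q r by rewrite lt_neqAle eq_sym c0 crs_orth// sqr_ge0.
have hk : 0 < ((kap q p * kap p r) ^+ 2)^-1 by rewrite invr_gt0 exprn_gt0// mulr_gt0.
by rewrite crs_tri// (pmulr_lgt0 _ hk) (pmulr_rgt0 _ (ltr0n R 2)).
Qed.

Lemma hform_lip p q p' q' : bd p -> bd q -> bd p' -> bd q' ->
  nc (hform (nvec p) (nvec q) - hform (nvec p') (nvec q')) <=
  5 * nm (nvec p - nvec p') + 5 * nm (nvec q - nvec q').
Proof.
move=> hp hq hp' hq'.
have -> : hform (nvec p) (nvec q) - hform (nvec p') (nvec q') =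
    hform (nvec p - nvec p') (nvec q) + hform (nvec p') (nvec q - nvec q').
  by rewrite hformDl hformNl hformDr hformNr addrA subrK.
rewrite (le_trans (nc_add _ _))// lerD// (le_trans (nc_hform_le _ _))//.
  by rewrite nm_nvec_bd// mulr1.
by rewrite (nm_nvec_bd hp') mulr1.
Qed.

(** Change one factor at a time: the two others contribute at most 4, and each norm occurs in two of
    the three factors with coefficient 5, whence 40. *)
Lemma tri_lip p q r p' q' r' : bd p -> bd q -> bd r -> bd p' -> bd q' -> bd r' ->
  tri p q r - tri p' q' r' <= 40 * (nm (nvec p - nvec p') +
    nm (nvec q - nvec q') + nm (nvec r - nvec r')).
Proof.
move=> hp hq hr hp' hq' hr'.
have h1 := hform_lip hp hq hp' hq'; have h2 := hform_lip hq hr hq' hr'.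
have h3 := hform_lip hr hp hr' hp'.
have k1 : nc (hform (nvec p') (nvec q')) <= 2 by exact: kap_le2 (bd_dom hp') (bd_dom hq').
have k2 : nc (hform (nvec q') (nvec r')) <= 2 by exact: kap_le2 (bd_dom hq') (bd_dom hr').
have k3 : nc (hform (nvec q) (nvec r)) <= 2 by exact: kap_le2 (bd_dom hq) (bd_dom hr).
have k4 : nc (hform (nvec r) (nvec p)) <= 2 by exact: kap_le2 (bd_dom hr) (bd_dom hp).
have n1 := nm_ge0 (nvec p - nvec p'); have n2 := nm_ge0 (nvec q - nvec q').
have n3 := nm_ge0 (nvec r - nvec r').
rewrite /tri /triple -ReN -ReD (le_trans (Re_le_nc _))//.
set a := hform (nvec p) (nvec q) in h1 *; set a' := hform (nvec p') (nvec q') in h1 k1 *.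
set b := hform (nvec q) (nvec r) in h2 k3 *; set b' := hform (nvec q') (nvec r') in h2 k2 *.
set c := hform (nvec r) (nvec p) in h3 k4 *; set c' := hform (nvec r') (nvec p') in h3 *.
have -> : a * b * c - a' * b' * c' =
    (a - a') * b * c + a' * (b - b') * c + a' * b' * (c - c') by ring.
have e1 : nc ((a - a') * b * c) <= 4 * nc (a - a').
  rewrite !Normc.normcM -mulrA mulrC ler_wpM2r ?nc_ge0//.
  by rewrite (le_trans (ler_pM (nc_ge0 _) (nc_ge0 _) k3 k4))//; lra.
have e2 : nc (a' * (b - b') * c) <= 4 * nc (b - b').
  rewrite !Normc.normcM mulrAC ler_wpM2r ?nc_ge0//.
  by rewrite (le_trans (ler_pM (nc_ge0 _) (nc_ge0 _) k1 k4))//; lra.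
have e3 : nc (a' * b' * (c - c')) <= 4 * nc (c - c').
  rewrite !Normc.normcM ler_wpM2r ?nc_ge0//.
  by rewrite (le_trans (ler_pM (nc_ge0 _) (nc_ge0 _) k1 k2))//; lra.
have := nc_add ((a - a') * b * c + a' * (b - b') * c) (a' * b' * (c - c')).
have := nc_add ((a - a') * b * c) (a' * (b - b') * c).
lra.
Qed.

Lemma tri_lower (A B C : set P) : compact A -> compact B -> compact C ->
  A `<=` bd -> B `<=` bd -> C `<=` bd ->
  (forall p q r, A p -> B q -> C r -> 0 < tri p q r) ->
  exists2 c, 0 < c & forall p q r, A p -> B q -> C r -> c <= tri p q r.
Proof.
move=> cA cB cC Abd Bbd Cbd tpos; apply: contrapT => none.
have /choice[u hu] n : exists v : P * P * P,
    [/\ A v.1.1, B v.1.2, C v.2 & tri v.1.1 v.1.2 v.2 < n.+1%:R^-1].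
  apply: contrapT => h; apply: none; exists n.+1%:R^-1; first by rewrite invr_gt0.
  move=> p q r Ap Bq Cr; rewrite leNgt; apply/negP => lt; apply: h.
  by exists (p, q, r).
have [||[[p q] r] [[/= Ap Bq] Cr] hclus] :=
    @compact_cluster_seq _ (A `*` B `*` C) u.
- by apply: compact_setX => //; exact: compact_setX.
- by move=> n; have [] := hu n.
have [hp hq hr] : [/\ bd p, bd q & bd r] by split; [exact: Abd|exact: Bbd|exact: Cbd].
pose t := tri p q r; have t0 : 0 < t by exact: tpos.
(* Three norms below [t / 240], times the Lipschitz constant 40, stay below [t / 2]. *)
have t1 : 0 < t / 4 / 60 by rewrite !divr_gt0.
pose N s := [set s' : P | closed_hyp s' -> nm (nvec s' - nvec s) < t / 4 / 60].
have nN s : bd s -> nbhs s (N s) by move=> /bd_dom hs; exact: nvec_near.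
have NN : nbhs (p, q, r) (N p `*` N q `*` N r).
  exists (N p `*` N q, N r) => //=; split; last exact: nN.
  by exists (N p, N q) => //=; split; exact: nN.
pose n := Num.bound (t / 2)^-1.
have [m nm' [[Nu1 Nu2] Nu3]] := hclus _ n NN.
have [Au Bu Cu tu] := hu m; move: Nu1 Nu2 Nu3 Au Bu Cu tu.
move: (u m).1.1 (u m).1.2 (u m).2 => p' q' r' Np Nq Nr Ap' Bq' Cr'.
have [hp' hq' hr'] : [/\ bd p', bd q' & bd r'] by split; [exact: Abd|exact: Bbd|exact: Cbd].
have := tri_lip hp hq hr hp' hq' hr'.
have := Np (bd_dom hp'); have := Nq (bd_dom hq'); have := Nr (bd_dom hr').
rewrite -/t [nm (nvec p' - _)]nmB [nm (nvec q' - _)]nmB [nm (nvec r' - _)]nmB.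
move=> h1 h2 h3 h4; apply/negP; rewrite -leNgt.
have : m.+1%:R^-1 <= t / 2.
  rewrite -[leRHS]invrK lef_pV2 ?posrE ?invr_gt0 ?divr_gt0//.
  have := archi_boundP (ltW (etrans (invr_gt0 _) (divr_gt0 t0 (ltr0n R 2)))).
  by move/ltW/le_trans; apply; rewrite ler_nat (leq_trans nm').
move: m.+1%:R^-1 (nm _) (nm _) (nm _) (tri p' q' r') h1 h2 h3 h4 => a b c e f.
lra.
Qed.

End triples.

(** * Hausdorff null sets *)

Lemma esum_lty_iff (R : realType) (T : choiceType) (G : set T) (f : T -> R) :
  (forall g, 0 <= f g) ->
  (\esum_(g in G) (f g)%:E < +oo)%E <->
  exists S, forall l : seq T, uniq l -> (forall g, g \in l -> G g) ->
    \sum_(g <- l) f g <= S.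
Proof.
move=> f0; split.
  move=> lty; exists (fine (\esum_(g in G) (f g)%:E)) => l ul lG.
  have e0 : (0 <= \esum_(g in G) (f g)%:E)%E.
    by apply: esum_ge0 => g _; rewrite lee_fin.
  rewrite -lee_fin fineK ?ge0_fin_numE// -sumEFin.
  rewrite /esum; apply: ereal_sup_ubound; exists [set` l]; last first.
    by rewrite -fsbig_seq.
  by split; [exact: finite_seq|move=> g /= gl; exact: lG].
move=> [S HS]; apply: (@le_lt_trans _ _ S%:E); last exact: ltry.
apply: ge_ereal_sup => _ [A [fA AG] <-].
rewrite fsbig_finite//= sumEFin lee_fin; apply: HS; first exact: finmap.fset_uniq.
by move=> g; rewrite in_fset_set// => /set_mem /AG.
Qed.

Section hausdorff.
Variables (R : realType) (X T : Type) (dist : T -> T -> R) (pi : X -> T).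
Variables (crs : X -> X -> X -> R) (s : R) (A : set X) (x : X) (c C : R).
Hypotheses (s_gt0 : 0 < s) (c_gt0 : 0 < c) (C_gt0 : 0 < C)
  (dist_ge0 : forall u v, 0 <= dist u v)
  (dist_ge : forall y z, A y -> A z -> c * crs x y z <= dist (pi y) (pi z) ^+ 2)
  (dist_le : forall y z, A y -> A z -> dist (pi y) (pi z) ^+ 2 <= C * crs x y z).

Lemma diam_ge0 (B : set T) : (0 <= diam dist B)%E.
Proof. by apply: ereal_sup_ubound; left. Qed.

Lemma dist_le_diam (B : set T) u v : B u -> B v -> ((dist u v)%:E <= diam dist B)%E.
Proof. by move=> Bu Bv; apply: ereal_sup_ubound; right; exists (u, v). Qed.

Lemma premeasure_ge0 e (B : set T) : (0 <= hausdorff_premeasure dist s e B)%E.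
Proof.
apply: le_ereal_inf_tmp => _ [U _ <-].
by apply: nneseries_ge0 => i _ _; exact: poweR_ge0.
Qed.

(** From left to right the mesh 1 is enough, and it makes the diameters finite. From right to left a
    sum below the power [s] of [e / Num.sqrt C] bounds every [D i] by [e / Num.sqrt C], so that any
    mesh [e] is reached. *)
Lemma hausdorff_null_iff :
  hausdorff_measure dist s (pi @` A) = 0%E <-> null_cover crs s A x.
Proof.
have rc : 0 < Num.sqrt c by rewrite sqrtr_gt0.
have rC : 0 < Num.sqrt C by rewrite sqrtr_gt0.
split=> [H0 e e0|Hn].
- pose e' := e * Num.sqrt c `^ s; have e'0 : 0 < e' by rewrite mulr_gt0// powR_gt0.
  have : (hausdorff_premeasure dist s 1 (pi @` A) < e'%:E)%E.
    apply: (@le_lt_trans _ _ 0%E); last by rewrite lte_fin.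
    rewrite -[leRHS]H0; apply: ereal_sup_ubound; exists 1 => //=; exact: ltr01.
  move=> /ereal_inf_lt[_ [U [Ucov U1] <-] sumU].
  have Ufin i : diam dist (U i) = (fine (diam dist (U i)))%:E.
    rewrite fineK// ge0_fin_numE ?diam_ge0//.
    by rewrite (le_lt_trans (U1 i))// ltry.
  exists (fun i => pi @^-1` U i), (fun i => fine (diam dist (U i)) / Num.sqrt c); split.
  + by move=> y Ay; have [|i _ Ui] := Ucov (pi y); [exists y|exists i].
  + by move=> i; rewrite divr_ge0 ?sqrtr_ge0// fine_ge0// diam_ge0.
  + move=> i y z Ay Az Uy Uz.
    rewrite exprMn exprVn sqr_sqrtr ?(ltW c_gt0)// ler_pdivlMr// mulrC.
    rewrite (le_trans (dist_ge Ay Az))// lerXn2r ?nnegrE ?fine_ge0 ?diam_ge0//.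
    by rewrite -lee_fin -Ufin dist_le_diam.
  + move=> n; under eq_bigr => i _.
      rewrite powRM ?invr_ge0 ?sqrtr_ge0 ?fine_ge0 ?diam_ge0//.
      rewrite -powR_inv1 ?sqrtr_ge0// -powRrM mulN1r powRN.
      over.
    rewrite -mulr_suml ler_pdivrMr ?powR_gt0// -/e' -lee_fin -sumEFin.
    rewrite (le_trans _ (ltW sumU))//.
    have -> : (\sum_(i < n) (fine (diam dist (U i)) `^ s)%:E =
        \sum_(0 <= i < n) (diam dist (U i) `^ s))%E.
      rewrite big_mkord; apply: eq_bigr => i _.
      by rewrite -poweR_EFin -Ufin.
    by apply: nneseries_lim_ge => i _ _; exact: poweR_ge0.
have pre e : 0 < e -> hausdorff_premeasure dist s e (pi @` A) = 0%E.
    move=> e0; apply/eqP; rewrite eq_le premeasure_ge0 andbT.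
    apply/lee_addgt0Pr => eps eps0; rewrite add0e.
    pose K := Num.sqrt C `^ s; have K0 : 0 < K by exact: powR_gt0.
    have eC0 : 0 < e / Num.sqrt C by rewrite divr_gt0.
    have [|U [D [Ucov D0 UD Dsum]]] := Hn (Num.min (eps / K) ((e / Num.sqrt C) `^ s)).
      by rewrite lt_min divr_gt0// powR_gt0.
    have De i : D i <= e / Num.sqrt C.
      rewrite leNgt; apply/negP => De; have : (e / Num.sqrt C) `^ s < D i `^ s.
        by apply: gt0_ltr_powR; rewrite ?nnegrE ?(ltW eC0).
      apply/negP; rewrite -leNgt.
      have := Dsum i.+1; rewrite le_min => /andP[_]; apply: le_trans.
      by rewrite big_ord_recr lerDr sumr_ge0// => j _; exact: powR_ge0.
    have dU i : (diam dist (pi @` (A `&` U i)) <= (Num.sqrt C * D i)%:E)%E.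
      apply: ge_ereal_sup => _ [->|[[_ _] [[y [Ay Uy] <-] [z [Az Uz] <-]] <-]].
        by rewrite lee_fin mulr_ge0 ?D0// ltW.
      rewrite lee_fin -(@ler_pXn2r _ 2)// ?nnegrE ?dist_ge0 ?mulr_ge0 ?D0 ?(ltW rC)//.
      rewrite (le_trans (dist_le Ay Az))// exprMn sqr_sqrtr ?(ltW C_gt0)//.
      by rewrite ler_pM2l// UD.
    apply: (@le_trans _ _ (\sum_(0 <= i <oo) (diam dist (pi @` (A `&` U i)) `^ s))%E).
      apply: ereal_inf_lbound; exists (fun i => pi @` (A `&` U i)) => //; split.
        by move=> _ [y Ay <-]; have [i Ui] := Ucov y Ay; exists i => //; exists y.
      move=> i; rewrite (le_trans (dU i))// lee_fin mulrC -ler_pdivlMr//.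
    apply: lime_le; first by apply: is_cvg_nneseries => i _ _; exact: poweR_ge0.
    apply: nearW => n.
    apply: (@le_trans _ _ (\sum_(0 <= i < n) (K * D i `^ s)%:E)%E).
      apply: lee_sum => i _.
      rewrite /K -powRM ?(ltW rC) ?D0// -poweR_EFin.
      by apply: gt0_ler_poweR; rewrite ?(ltW s_gt0) ?in_itv/= ?leey ?andbT ?diam_ge0 ?lee_fin ?mulr_ge0 ?D0 ?(ltW rC).
    rewrite sumEFin lee_fin -mulr_sumr big_mkord mulrC -ler_pdivlMr//.
    by rewrite (le_trans (Dsum n))// ge_min lexx.
apply/eqP; rewrite eq_le; apply/andP; split.
  by apply: ge_ereal_sup => _ [e e0 <-]; rewrite pre.
by apply: ereal_sup_ubound; exists 1; [exact: (@ltr01 R)|exact: pre (@ltr01 R)].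
Qed.

End hausdorff.

(** * Schottky groups in good position *)

Section radial_projection_bounds.
Variables (R : realType) (d : nat).
Local Notation P := (cproj R d).
Local Notation bd := (@hyp_boundary R d).

Lemma radial_proj_bounds (xi : P) (h : ext R d.+2) : bd xi -> unit_normal xi h ->
  exists c C : R, [/\ 0 < c, 0 < C & forall p q, bd p -> bd q -> xi <> p -> xi <> q ->
    c * crs xi p q <= ext_dist (radial_proj xi h p) (radial_proj xi h q) ^+ 2 /\
    ext_dist (radial_proj xi h p) (radial_proj xi h q) ^+ 2 <= C * crs xi p q].
Proof.
move=> xibd [hm h1 hA]; have x0 := rep_neq0 xi.
have hA' u : multivectors d (dagger (rep xi)) u -> vwedge (rep xi) u = 0 -> eip h u = 0.
  by move=> um xu; apply: hA.
have [c c0 hc] := npencil_lower x0 xibd hm h1 hA'.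
have [C C0 hC] := npencil_upper x0 xibd hm h1 hA'.
pose l := (nc (ell (rep xi)) ^+ 2)^-1.
have l0 : 0 < l by rewrite invr_gt0 exprn_gt0// nc_gt0 ell_rep_neq0//; exact: bd_dom.
exists (c * l), (C * l); split; rewrite ?mulr_gt0// => p q pbd qbd xp xq.
have E : cross (rep xi) (rep p) (rep q) = l * crs xi p q.
  rewrite (rep_nvec (bd_dom xibd)) (rep_nvec (bd_dom pbd)) (rep_nvec (bd_dom qbd)).
  by rewrite cross_scale ?ell_rep_neq0//; exact: bd_dom.
have hn r : bd r -> xi <> r -> hform (rep xi) (rep r) != 0.
  move=> rbd xr; rewrite (rep_nvec (bd_dom xibd)) (rep_nvec (bd_dom rbd)).
  rewrite hformZl hformZr !mulf_neq0 ?conjC_eq0 ?ell_rep_neq0 ?hform_neq0//; exact: bd_dom.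
have D : ext_dist (radial_proj xi h p) (radial_proj xi h q) =
    ext_dist (npencil (rep xi) h (rep p)) (npencil (rep xi) h (rep q)).
  rewrite /ext_dist -[radial_proj xi h p]/(npencil (rep xi) h (rep p) - h).
  rewrite -[radial_proj xi h q]/(npencil (rep xi) h (rep q) - h).
  by move: (npencil _ _ _) (npencil _ _ _) => u v; rewrite opprB addrA addrNK.
rewrite D -!mulrA -E; split; first by apply: hc => //; exact: hn.
by apply: hC => //; exact: hn.
Qed.

End radial_projection_bounds.

Section schottky.
Variables (R : realType) (d k : nat) (g : 'I_k -> PU R d) (B : PU R d -> set (cproj R d)).
Local Notation P := (cproj R d).
Local Notation bd := (@hyp_boundary R d).
Hypotheses (k2 : (2 <= k)%N) (sys : schottky_system g B) (pos : good_position g B).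
Variable o : P.
Hypothesis ho : hyp_space o.

Let L : finType := ('I_k * bool)%type.
Let iv (a : L) : L := (a.1, ~~ a.2).
Let gen : L -> PU R d := letter g.
Let ball (a : L) : set P := B (gen a).
Let act (g : PU R d) : P -> P := val g.

Let gen_inj : injective gen. Proof. by case: sys. Qed.

Let genW a : range gen (gen a). Proof. by exists a. Qed.

Let ivK : involutive iv. Proof. by case=> i b; rewrite /iv /= negbK. Qed.

Let L4 : (3 < #|L|)%N.
Proof. by rewrite card_prod card_ord card_bool; case: k k2 => [|[|n]]//= _; rewrite !mulSn. Qed.

Let gen_iv a : gen (iv a) = (gen a)^-1%g.
Proof. by case: a => i [] //; rewrite /gen /letter /= invgK. Qed.

Let ball_bd a : ball a `<=` bd.
Proof. by case: sys => _ _ h _ _; case: (h _ (genW a)). Qed.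

Let ball_compact a : compact (ball a).
Proof. by case: sys => _ _ h _ _; case: (h _ (genW a)). Qed.

Let ball_ex a : exists x, ball a x.
Proof.
case: sys => _ _ _ h _; have [p pbd hp] := h _ (genW a); exists p.
exact: (nbhs_singleton hp).
Qed.

Let ball_disj a b x : ball a x -> ball b x -> a = b.
Proof.
case: sys => _ h _ _ _ ax bx; apply: gen_inj; apply: h; rewrite ?inE; try exact: genW.
by exists x.
Qed.

Let ball_act a x : bd x -> ~ ball (iv a) x -> ball a (act (gen a) x).
Proof.
case: sys => _ _ _ _ h xbd; rewrite /ball gen_iv => xN.
by apply: (h _ (genW a)); exists x.
Qed.

Let ball_neq a b x y : a <> b -> ball a x -> ball b y -> x <> y.
Proof. by move=> ab ax by_ xy; apply: ab; apply: ball_disj ax _; rewrite xy. Qed.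

(** Good position is applied here: no chain meets three distinct balls, so [tri] is positive on
    their product and bounded below by compactness. The value 1 is a default for triples of letters
    that are not distinct. *)
Let tri_ball : exists2 c, 0 < c & forall (a b e : L) x y z, a <> b -> a <> e -> b <> e ->
  ball a x -> ball b y -> ball e z -> c <= tri x y z.
Proof.
have /choice[f hf] (v : L * L * L) : exists c, 0 < c /\
    (v.1.1 <> v.1.2 -> v.1.1 <> v.2 -> v.1.2 <> v.2 -> forall x y z,
     ball v.1.1 x -> ball v.1.2 y -> ball v.2 z -> c <= tri x y z).
  case: v => -[a b] e /=; have [ab|ab] := eqVneq a b; first by exists 1.
  have [ae|ae] := eqVneq a e; first by exists 1.
  have [be|be] := eqVneq b e; first by exists 1.
  have [|c c0 hc] := tri_lower (@ball_compact a) (@ball_compact b) (@ball_compact e)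
      (@ball_bd a) (@ball_bd b) (@ball_bd e); last by exists c.
  move=> x y z ax by_ ez; apply: tri_gt0; try exact: ball_bd; try eassumption.
  - exact: ball_bd ax.
  - exact: ball_bd by_.
  - exact: ball_bd ez.
  - exact: ball_neq (elimN eqP ab) ax by_.
  - exact: ball_neq (elimN eqP ae) ax ez.
  move=> D chD Dx Dy Dz.
  apply: (pos (genW a) (genW b) (genW e)); rewrite ?(inj_eq gen_inj)//.
  by exists D; split=> //; [exists x|exists y|exists z].
have [c c0 hc] := positive_lower_bound (fun v => (hf v).1).
exists c => // a b e x y z ab ae be ax by_ ez.
exact: le_trans (hc (a, b, e)) ((hf (a, b, e)).2 ab ae be x y z ax by_ ez).
Qed.

Let ball_cluster a (u : nat -> P) : (forall n, ball a (u n)) ->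
  exists2 p, ball a p &
    forall (e : R) n, 0 < e -> exists2 m, (n <= m)%N & kap p (u m) < e.
Proof.
move=> hu; have [p ap hp] := compact_cluster_seq (@ball_compact a) hu.
exists p => // e n e0; have [m nm h] := hp _ n (kap_near (ball_bd ap) e0).
by exists m => //; apply: h; apply: bd_dom; exact: ball_bd (hu m).
Qed.

(** A point of a third ball turns the bound on triples into a separation of two balls. *)
Let kap_ball : exists2 c, 0 < c & forall (a b : L) x y, a <> b ->
  ball a x -> ball b y -> c <= kap x y.
Proof.
have [c c0 hc] := tri_ball; exists (c / 4); first by rewrite divr_gt0.
move=> a b x y ab ax by_; have [e [ea eb _]] := avoid3 L4 a b b.
have [z ez] := ball_ex e; rewrite ler_pdivrMr// mulrC.
apply: le_trans (tri_kap (ball_bd ax) (ball_bd by_) (ball_bd ez)).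
by apply: (hc a b e) => //; apply/eqP; rewrite eq_sym.
Qed.

Let crs_ball : exists2 c, 0 < c & forall (a b e : L) x y z, a <> b -> a <> e -> b <> e ->
  ball a x -> ball b y -> ball e z -> c <= crs x y z.
Proof.
(* This is [2 * c / 16]: the denominator in [crs_tri] is at most the square of [2 * 2]. *)
have [c c0 hc] := tri_ball; exists (c / 8); first by rewrite divr_gt0.
move=> a b e x y z ab ae be ax by_ ez.
have [xb yb zb] : [/\ bd x, bd y & bd z].
  by split; [exact: ball_bd ax|exact: ball_bd by_|exact: ball_bd ez].
have xy := ball_neq ab ax by_; have xz := ball_neq ae ax ez.
rewrite crs_tri//; have h := hc _ _ _ _ _ _ ab ae be ax by_ ez.
have k1 : 0 < kap y x by rewrite nc_gt0 hform_neq0// => E; apply: xy.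
have k2' : 0 < kap x z by rewrite nc_gt0 hform_neq0.
have k3 := kap_le2 (bd_dom yb) (bd_dom xb); have k4 := kap_le2 (bd_dom xb) (bd_dom zb).
have k5 : kap y x * kap x z <= 2 * 2 by rewrite ler_pM// ltW.
have k6 : 0 < kap y x * kap x z by rewrite mulr_gt0.
rewrite ler_pdivlMr ?exprn_gt0//.
have k7 : (kap y x * kap x z) ^+ 2 <= 16.
  by move: (kap y x * kap x z) k5 k6 => K; nra.
have c8 : 0 < c / 8 by rewrite divr_gt0.
by rewrite (le_trans (ler_wpM2l (ltW c8) k7))//; lra.
Qed.

Lemma generatedE : generated (range g) = [set ev gen w | w in red iv].
Proof.
apply/seteqP; split.
  apply: smallest_sub; last first.
    by move=> _ [i _ <-]; exists [:: (i, true)] => //=; rewrite mulg1.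
  split.
    by rewrite inE; exists [::].
  move=> x y; rewrite !inE => -[s rs <-] [t rt <-].
  have [|w rw E] := ev_mul gen_iv s (_ : red iv (winv iv t)); first by rewrite red_winv.
  by exists w => //; rewrite E (ev_winv gen_iv).
move=> _ [w _ <-] H [[H1 HB] gH].
have HV x : H x -> H x^-1%g.
  move=> Hx; have := HB 1%g x; rewrite !inE => /(_ _ Hx).
  by rewrite mul1g; apply; move: H1; rewrite inE.
have HM x y : H x -> H y -> H (x * y)%g.
  by move=> Hx /HV Hy; have := HB x y^-1%g; rewrite !inE invgK; apply.
elim: w => [|[i b] w IH] /=; first by move: H1; rewrite inE.
apply: HM => //; rewrite /gen /letter /=; case: b; last apply: HV;
  by apply: gH; exists i.
Qed.

(** Since [ev gen] is injective on reduced words and maps them onto the group, both sides bound the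
    same finite sums. *)
Lemma sum_words_iff (s : R) :
  (exists S, forall l : seq (PU R d), uniq l ->
     (forall x, x \in l -> generated (range g) x) ->
     \sum_(x <- l) lam o x `^ s <= S) <->
  exists S, forall l, uniq l -> all (red iv) l -> \sum_(w <- l) weight (lam o) gen s w <= S.
Proof.
have einj := ev_inj (act := act) (fun x => erefl) (fun g h x => erefl) (bd := bd)
  (fun g x => @bd_act R d g x) L4 ball_bd ball_ex ball_disj ball_act.
rewrite generatedE; split=> -[S HS]; exists S => l ul.
  move=> rl; rewrite -(big_map (ev gen) xpredT (fun x => lam o x `^ s)).
  apply: HS.
    rewrite map_inj_in_uniq// => v w vl wl; apply: einj.
      exact: (allP rl).
    exact: (allP rl).
  by move=> x /mapP[w wl ->]; exists w => //; exact: (allP rl).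
move=> lG.
have /choice[wd hwd] x : exists w, [set ev gen w | w in red iv] x -> red iv w /\ ev gen w = x.
  have [[w rw E]|nx] := pselect ([set ev gen w | w in red iv] x); first by exists w.
  by exists [::].
have E : \sum_(x <- l) lam o x `^ s = \sum_(w <- map wd l) weight (lam o) gen s w.
  rewrite big_map; apply: eq_big_seq => x xl.
  by congr (lam o _ `^ s); exact: esym (hwd x (lG x xl)).2.
rewrite E; apply: HS.
  rewrite map_inj_in_uniq// => x y xl yl xy.
  by rewrite -(hwd x (lG x xl)).2 -(hwd y (lG y yl)).2 xy.
by apply/allP => w /mapP[x xl ->]; exact: (hwd x (lG x xl)).1.
Qed.

Lemma limset_generated :
  limit_set (generated (range g)) o = limset act bd o (@kap R d) iv gen.
Proof.
rewrite limit_setE// generatedE; apply/seteqP; split=> p [pbd hp]; split=> // e e0.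
  by have [_ [w rw <-] h] := hp e e0; exists w.
by have [w rw h] := hp e e0; exists (ev gen w) => //; exists w.
Qed.

Lemma null_iff_summable (s : R) xi : 0 < s -> bd xi ->
  null_cover (@crs R d) s (limit_set (generated (range g)) o `\ xi) xi <->
  (\esum_(x in generated (range g)) (expR (- s * hyp_dist o (val x o)))%:E < +oo)%E.
Proof.
move=> s0 xibd.
have -> : limit_set (generated (range g)) o `\ xi =
    [set y | limset act bd o (@kap R d) iv gen y /\ xi <> y].
  rewrite limset_generated; apply/seteqP; split=> y [ly xy]; split=> //.
    by move=> E; apply: xy.
  by move=> E; apply: xy.
have [cb cb0 hcb] := kap_ball; have [ct ct0 hct] := crs_ball.
rewrite (null_iff_sum (act := act) (fun x => erefl) (fun g h x => erefl)
  (bd := bd) (dom := @closed_hyp R d) (o := o) (@bd_dom R d) (hyp_dom ho)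
  (fun g x => @bd_act R d g x) (fun g x => @dom_act R d g x)
  (@kapC R d) (@kap_ge0 R d) (@kap_le2 R d) (@kap_eq0 R d) (@kap_qt R d)
  (@jac_gt0 R d) (jacM ho) (@kap_act R d) (@crs_act R d) (@crs_le R d)
  (oval_gt0 ho) (kap_o ho) (lam_gt0 o) (clam_gt0 ho)
  (fun g => (lam_bounds ho g).1) (fun g => (lam_bounds ho g).2)
  ivK L4 gen_iv ball_bd ball_ex ball_disj ball_act cb0 ct0 hcb hct ball_cluster s0 xibd).
rewrite -sum_words_iff esum_lty_iff; last by move=> x; exact: expR_ge0.
have E (l : seq (PU R d)) : \sum_(x <- l) lam o x `^ s =
    \sum_(x <- l) expR (- s * hyp_dist o (val x o)).
  by apply: eq_bigr => x _; exact: lam_pow.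
by split=> -[S HS]; exists S => l ul lG; [rewrite -E|rewrite E]; exact: HS.
Qed.

End schottky.

Theorem theoremA (R : realType) (d : nat) (d_ge1 : (1 <= d)%N)
    (Gamma : set (PU R d)) (o : cproj R d) (ho : hyp_space o) :
  schottky_in_good_position Gamma ->
  forall (xi : cproj R d) (xhat : ext R d.+2),
    hyp_boundary xi -> unit_normal xi xhat ->
    transverse_dim xi xhat (limit_set Gamma o) = poincare_exponent Gamma o.
Proof.
move=> [k [g [B [k2 -> sys pos]]]] xi xhat xibd hx.
have [c [C [c0 C0 hcC]]] := radial_proj_bounds xibd hx.
rewrite /transverse_dim /hausdorff_dim /poincare_exponent.
(* Both sides are infima of sets of exponents, and the two sets are equal, so no limit in [s] is
   taken. *)
congr (ereal_inf [set _%:E | _ in _]); apply/seteqP.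
have iff (s : R) : 0 < s ->
    hausdorff_measure (@ext_dist R d.+2) s
      (radial_proj xi xhat @` (limit_set (generated (range g)) o `\ xi)) = 0%E <->
    (\esum_(x in generated (range g)) (expR (- s * hyp_dist o (val x o)))%:E < +oo)%E.
  move=> s0; rewrite -(null_iff_summable k2 sys pos ho s0 xibd).
  have lbd p : (limit_set (generated (range g)) o `\ xi) p -> hyp_boundary p /\ xi <> p.
    by move=> [[pbd _] px]; split=> // E; apply: px.
  apply: (hausdorff_null_iff (x := xi) s0 c0 C0) => [u v|y z /lbd[yb xy] /lbd[zb xz]|y z /lbd[yb xy] /lbd[zb xz]].
  - exact: ext_dist_ge0.
  - by have [] := hcC y z yb zb xy xz.
  - by have [] := hcC y z yb zb xy xz.
by split=> s [s0 /(iff s s0) h].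
Qed.
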